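(* Let $F=\mathrm{Diag}(a_1,\dots,a_d)\in M_d(\mathbb Z)$ with all $a_j>0$ and $G\in M_d(\mathbb Z)$ with $\det G\ne0$. Then $$\mathcal O_{F,G}(\mathbb T^d)\cong\mathcal O_{F,G}(\mathbb T^d)^\gamma\rtimes_\rho\mathbb N,$$ where $\mathcal O_{F,G}(\mathbb T^d)^\gamma$ is the fixed point algebra of the gauge action $\gamma$ and $\rho$ is the $*$-endomorphism of $\mathcal O_{F,G}(\mathbb T^d)^\gamma$ determined by $\rho(S_\alpha fS_\beta^* )=S_{(0,\alpha)}fS_{(0,\beta)}^*$ for $\alpha,\beta\in\mathfrak I(F)^k$, $k\in\mathbb N$, $f\in C(\mathbb T^d)$.
   Context: For $F\in M_d(\mathbb Z)$, $\sigma_F$ is the endomorphism of $\mathbb T^d$ given by $\sigma_F(e^{2\pi it})=e^{2\pi iFt}$, $t\in\mathbb R^d$. For $F,G\in M_d(\mathbb Z)$ with nonzero determinants let $\Omega_{F,G}(\mathbb T^d)=\{(x,y)\in\mathbb T^d\times\mathbb T^d:\sigma_F(y)=\sigma_G(x)\}$. The $C^*$-correspondence $\mathcal E=\mathcal E_{F,G}(\mathbb T^d)$ over $C(\mathbb T^d)$ is $C(\Omega_{F,G}(\mathbb T^d))$ with actions $(a\cdot\xi\cdot b)(x,y)=a(y)\xi(x,y)b(x)$ and inner product $\langle\xi,\eta\rangle(x)=\frac1{|\det F|}\sum_{\sigma_F(y)=\sigma_G(x)}\overline{\xi(x,y)}\eta(x,y)$. $\mathcal O_{F,G}(\mathbb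 T^d)$ is its Cuntz-Pimsner algebra, i.e. the $C^*$-algebra generated by the universal pair $(T,\pi)$ ($T$ linear on $\mathcal E$, $\pi$ a $*$-homomorphism of $A=C(\mathbb T^d)$) with $T(\xi)^*T(\eta)=\pi(\langle\xi,\eta\rangle)$, $T(a\cdot\xi)=\pi(a)T(\xi)$ and $\Psi_T(\phi(a))=\pi(a)$ for $a\in\phi^{-1}(\mathcal K(\mathcal E))\cap(\ker\phi)^\perp$, where $\phi$ is the left action, $(\ker\phi)^\perp=\{a:ab=0\ \forall b\in\ker\phi\}$, and $\Psi_T(\theta_{\xi,\eta})=T(\xi)T(\eta)^*$, $\theta_{\xi,\eta}(\zeta)=\xi\langle\eta,\zeta\rangle$. Here $F=\mathrm{Diag}(a_1,\dots,a_d)$, $a_j>0$; $\mathfrak I(F)=\{\nu\in\mathbb Z^d:0\le\nu_j\le a_j-1\}$; $U_j\in\mathcal O_{F,G}(\mathbb T^d)$ is the image of the coordinate function $y\mapsto y_j$; $U^\nu=\prod_jU_j^{\nu_j}$ for $\nu\in\mathbb Z^d$; $S=T(1)$, the image of the constant function $1\in C(\Omega_{F,G}(\mathbb T^d))$; $S_\nu=U^\nu S$ for $\nu\in\mathfrak I(F)$. Equivalently, $\mathcal O_{F,G}(\mathbb T^d)$ is the universal $C^*$-algebra generated by commuting unitaries $U_1,\dots,U_d$ and an isometry $S$ with $S^*U^\nu S=\delta_0^\nu$ ($\nu\in\mathfrak I(F)$), $U_j^{a_j}S=SU^{G_j}$ ($G_j$ the $j$-th row of $G$), and $\sum_{\nu\in\mathfrak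 I(F)}U^\nu SS^*U^{-\nu}=1$. $C(\mathbb T^d)$ is identified with its (faithful) image in $\mathcal O_{F,G}(\mathbb T^d)$. For $\alpha=(\alpha_1,\dots,\alpha_k)\in\mathfrak I(F)^k$, $S_\alpha=S_{\alpha_1}\cdots S_{\alpha_k}$, and $(0,\alpha)=(0,\alpha_1,\dots,\alpha_k)\in\mathfrak I(F)^{k+1}$. The gauge action $\gamma:\mathbb T\to\mathrm{Aut}(\mathcal O_{F,G}(\mathbb T^d))$ is $\gamma_t(S)=tS$, $\gamma_t(U_j)=U_j$; the fixed point algebra is $\{x:\gamma_t(x)=x\ \forall t\in\mathbb T\}$, which equals the closed span of $\{S_\alpha U^\nu S_\beta^*:\alpha,\beta \text{ of equal length},\ \nu\in\mathbb Z^d\}$. Crossed product by an endomorphism (Stacey, multiplicity 1): for an endomorphism $\rho$ of a unital $C^*$-algebra $A$ with $\mathrm{colim}(A\xrightarrow{\rho}A\xrightarrow{\rho}\cdots)\ne0$, $A\rtimes_\rho\mathbb N$ is the (unique) unital $C^*$-algebra together with a homomorphism $\iota:A\to A\rtimes_\rho\mathbb N$, $\iota(1)=1$, and an isometry $s\in A\rtimes_\rho\mathbb N$ such that (1) $\iota(\rho(a))=s\iota(a)s^*$ for all $a\in A$; (2) for every nondegenerate representation $\pi$ of $A$ and isometry $t$ with $\pi(\rho(a))=t\pi(a)t^*$ for all $a\in A$, there is a nondegenerate representation $\pi\times T$ of $A\rtimes_\rho\mathbb N$ with $(\pi\times T)\circ\iota=\pi$ and $(\pi\times T)(s)=t$;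 (3) $A\rtimes_\rho\mathbb N$ is generated by $\iota(A)$ and $s$. *)

(* Defs.v *)
From HB Require Import structures.
From mathcomp Require Import all_boot all_order all_algebra.
From mathcomp Require Import complex.
From mathcomp Require Import all_classical all_reals all_analysis.

Set Implicit Arguments.
Unset Strict Implicit.
Unset Printing Implicit Defensive.

Import Order.TTheory GRing.Theory Num.Theory.
Import numFieldNormedType.Exports.

Local Open Scope classical_set_scope.
Local Open Scope complex_scope.
Local Open Scope ring_scope.

(* MathComp rings have a unit, so the (possibly non-unital) product of a
   C*-algebra is a separate operation. *)
HB.mixin Record CompleteNormedModule_isCstar (R : realType) V
    of CompleteNormedModule R[i] V := {
  cmul : V -> V -> V ;
  cstar : V -> V ;
  cmulA : forall x y z, cmul x (cmul y z) = cmul (cmul x y) z ;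
  cmul_linearl : forall (k : R[i]) x y z,
    cmul (k *: x + y) z = k *: cmul x z + cmul y z ;
  cmul_linearr : forall (k : R[i]) x y z,
    cmul z (k *: x + y) = k *: cmul z x + cmul z y ;
  cstarK : forall x, cstar (cstar x) = x ;
  cstarM : forall x y, cstar (cmul x y) = cmul (cstar y) (cstar x) ;
  cstar_antilinear : forall (k : R[i]) x y,
    cstar (k *: x + y) = k^* *: cstar x + cstar y ;
  cnormM : forall x y, `|cmul x y| <= `|x| * `|y| ;
  cnorm_cstar : forall x, `|cmul (cstar x) x| = `|x| ^+ 2
}.

#[short(type="cstarType")]
HB.structure Definition Cstar (R : realType) :=
  {V of CompleteNormedModule_isCstar R V & CompleteNormedModule R[i] V}.

HB.mixin Record CompleteNormedModule_isHilbert (R : realType) H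
    of CompleteNormedModule R[i] H := {
  hdot : H -> H -> R[i] ;
  hdot_linearl : forall (k : R[i]) x y z,
    hdot (k *: x + y) z = k * hdot x z + hdot y z ;
  hdotC : forall x y, hdot x y = (hdot y x)^* ;
  hdot_norm : forall x, hdot x x = `|x| ^+ 2
}.

#[short(type="hilbertType")]
HB.structure Definition Hilbert (R : realType) :=
  {H of CompleteNormedModule_isHilbert R H & CompleteNormedModule R[i] H}.

(* The topology of R[i] is the one given by its norm. *)
HB.instance Definition _ (R : realType) := NormedModule.copy R[i] R[i]^o.

Section StarAlgebra.
Variable R : realType.
Implicit Types A B : cstarType R.

Definition star_hom A B (f : A -> B) : Prop :=
  [/\ forall (k : R[i]) x y, f (k *: x + y) = k *: f x + f y,
      forall x y, f (cmul x y) = cmul (f x) (f y) &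
      forall x, f (cstar x) = cstar (f x)].

Definition star_iso A B (f : A -> B) : Prop := star_hom f /\ bijective f.

Definition isomorphic A B : Prop := exists f : A -> B, star_iso f.

Definition is_one A (e : A) : Prop := forall x, cmul e x = x /\ cmul x e = x.

Definition closed_star_subalgebra B (D : set B) : Prop :=
  [/\ closed D, D 0,
      forall (k : R[i]) x y, D x -> D y -> D (k *: x + y),
      forall x y, D x -> D y -> D (cmul x y) &
      forall x, D x -> D (cstar x)].

Definition generates B (X : set B) : Prop :=
  smallest (@closed_star_subalgebra B) X = setT.

(* The inductive limit of A --rho--> A --rho--> ... in the category of (not
   necessarily unital) C*-algebras and star-homomorphisms. *)
Definition cocone A (rho : A -> A) B (g : nat -> A -> B) : Prop :=
  (forall n, star_hom (g n)) /\ (forall n x, g n.+1 (rho x) = g n x).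

Definition is_colim A (rho : A -> A) B (g : nat -> A -> B) : Prop :=
  cocone rho g /\
  forall (D : cstarType R) (h : nat -> A -> D), cocone rho h ->
    exists! f : B -> D, star_hom f /\ forall n x, f (g n x) = h n x.

Definition colim_nonzero A (rho : A -> A) : Prop :=
  exists (B : cstarType R) (g : nat -> A -> B),
    is_colim rho g /\ exists x : B, x <> 0.

End StarAlgebra.

Section Representation.
Variable R : realType.
Implicit Types (A B : cstarType R) (H : hilbertType R).

Definition bounded_op H (u : H -> H) : Prop :=
  (forall (k : R[i]) x y, u (k *: x + y) = k *: u x + u y) /\ continuous u.

Definition adjoint H (u v : H -> H) : Prop :=
  forall x y, hdot (u x) y = hdot x (v y).

Record representation A H (p : A -> H -> H) : Prop := {
  rep_bounded : forall a, bounded_op (p a) ;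
  rep_linear : forall (k : R[i]) a b x, p (k *: a + b) x = k *: p a x + p b x ;
  rep_mul : forall a b x, p (cmul a b) x = p a (p b x) ;
  rep_star : forall a, adjoint (p a) (p (cstar a)) }.

Definition nondegenerate A H (p : A -> H -> H) : Prop :=
  closure [set y | exists n (a : 'I_n -> A) (x : 'I_n -> H),
             y = \sum_(i < n) p (a i) (x i)] = setT.

(* t is an isometry of the Hilbert space H and t' is its adjoint. *)
Definition isometry_with_adjoint H (t t' : H -> H) : Prop :=
  [/\ bounded_op t, bounded_op t', adjoint t t' & forall x, t' (t x) = x].

(* (B, iota, s) is the crossed product of the unital C*-algebra A by rho. *)
Record crossed_product A (rho : A -> A) B (iota : A -> B) (s : B) : Prop := {
  crossed_hom : star_hom iota ;
  crossed_unital : exists eA eB,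
    [/\ is_one eA, is_one eB, iota eA = eB & cmul (cstar s) s = eB] ;
  crossed_rel : forall a, iota (rho a) = cmul (cmul s (iota a)) (cstar s) ;
  crossed_universal : forall H (p : A -> H -> H) (t t' : H -> H),
    representation p -> nondegenerate p -> isometry_with_adjoint t t' ->
    (forall a x, p (rho a) x = t (p a (t' x))) ->
    exists q : B -> H -> H,
      [/\ representation q, nondegenerate q,
          forall a x, q (iota a) x = p a x & forall x, q s x = t x] ;
  crossed_generated : generates (range iota `|` [set s]) }.

End Representation.

Section Torus.
Variables (R : realType) (d : nat).

Definition torus : set 'rV[R[i]]_d := [set z | forall j, `|z 0 j| = 1].

Definition sigma (F : 'M[int]_d) (z : 'rV[R[i]]_d) : 'rV[R[i]]_d :=
  \row_j \prod_k z 0 k ^ F j k.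

Definition expi (t : R) : R[i] := cos (2 * pi * t) +i* sin (2 * pi * t).

Definition torus_exp (t : 'cV[R]_d) : 'rV[R[i]]_d := \row_j expi (t j 0).

Lemma expiD t u : expi (t + u) = expi t * expi u.
Proof.
rewrite /expi mulrDr cosD sinD; apply/eqP; rewrite eq_complex /=.
by rewrite eqxx /= addrC.
Qed.

Lemma expi0 : expi 0 = 1.
Proof. by rewrite /expi mulr0 cos0 sin0. Qed.

Lemma expiMz t (n : int) : expi (n%:~R * t) = expi t ^ n.
Proof.
have expiMn (u : R) m : expi (m%:R * u) = expi u ^+ m.
  elim: m => [|m IHm]; first by rewrite mul0r expi0.
  by rewrite -natr1 mulrDl mul1r expiD IHm exprSr.
case: n => n; first exact: expiMn.
have expiV u : expi (- u) = (expi u)^-1.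
  apply/esym/mulr1_eq; by rewrite -expiD subrr expi0.
by rewrite NegzE mulrNz mulNr expiV -exprnN expiMn.
Qed.

(* sigma F is the endomorphism e^(2 pi i t) |-> e^(2 pi i F t). *)
Lemma sigmaE (F : 'M[int]_d) (t : 'cV[R]_d) :
  sigma F (torus_exp t) = torus_exp (map_mx intr F *m t).
Proof.
apply/rowP => j; rewrite !mxE.
rewrite (big_morph expi expiD expi0).
by apply: eq_bigr => k _; rewrite !mxE expiMz.
Qed.

Definition Omega (F G : 'M[int]_d) : set (torus * torus) :=
  [set p | sigma F (\val p.2) = sigma G (\val p.1)].

End Torus.

Arguments torus R d : clear implicits.
Arguments Omega R {d} F G.

(* C(X) is handled as the continuous functions among all functions X -> R[i];
   the maps pi : C(T^d) -> B and T : C(Omega) -> B below are thus defined on all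
   functions, but only their values at continuous ones matter. *)
Section Correspondence.
Variables (R : realType) (d : nat) (F G : 'M[int]_d).
Local Notation X := (torus R d).
Local Notation E := (Omega R F G).

Definition lact (a : X -> R[i]) (xi : E -> R[i]) : E -> R[i] :=
  fun p => a (\val p).2 * xi p.

Definition ract (xi : E -> R[i]) (b : X -> R[i]) : E -> R[i] :=
  fun p => xi p * b (\val p).1.

Definition inner (xi eta : E -> R[i]) : X -> R[i] := fun x =>
  ((`|\det F|)%:~R)^-1 *
    \sum_(p \in [set p : E | (\val p).1 = x]) ((xi p)^* * eta p).

(* The norm of the Hilbert module, the square root of the sup norm of
   <xi, xi> >= 0. *)
Definition Enorm (xi : E -> R[i]) : R :=
  Num.sqrt (sup (range (fun x => complex.Re (inner xi xi x)))).

Definition opnorm_le (k : (E -> R[i]) -> E -> R[i]) (e : R) : Prop :=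
  forall xi : E -> R[i], continuous xi -> Enorm (k xi) <= e * Enorm xi.

Definition theta (xi eta zeta : E -> R[i]) : E -> R[i] :=
  ract xi (inner eta zeta).

(* The sum of the theta_{xi_i, eta_i}. *)
Definition finite_rank n (xi eta : 'I_n -> E -> R[i]) (zeta : E -> R[i]) :
    E -> R[i] :=
  fun p => \sum_(i < n) theta (xi i) (eta i) zeta p.

Definition compact_op (k : (E -> R[i]) -> E -> R[i]) : Prop :=
  forall e : R, 0 < e -> exists n (xi eta : 'I_n -> E -> R[i]),
    [/\ forall i, continuous (xi i), forall i, continuous (eta i) &
        opnorm_le (fun zeta p => k zeta p - finite_rank xi eta zeta p) e].

Definition ker_lact (b : X -> R[i]) : Prop :=
  continuous b /\ forall xi : E -> R[i], continuous xi -> forall p, lact b xi p = 0.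

(* phi^-1(K(E)) intersected with the annihilator of ker phi. *)
Definition katsura_ideal (a : X -> R[i]) : Prop :=
  [/\ continuous a, compact_op (lact a) &
      forall b, ker_lact b -> forall y, a y * b y = 0].

Section Pair.
Variables (B : cstarType R) (T : (E -> R[i]) -> B) (pi : (X -> R[i]) -> B).

(* b = Psi_T(k): since || sum_i T(xi_i) T(eta_i)^* || is at most the norm of
   sum_i theta_{xi_i, eta_i}, the closure of the graph of
   sum_i theta_{xi_i, eta_i} |-> sum_i T(xi_i) T(eta_i)^* is the graph of the
   extension of this map to K(E). *)
Definition Psi (k : (E -> R[i]) -> E -> R[i]) (b : B) : Prop :=
  forall e : R, 0 < e -> exists n (xi eta : 'I_n -> E -> R[i]),
    [/\ forall i, continuous (xi i), forall i, continuous (eta i),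
        opnorm_le (fun zeta p => k zeta p - finite_rank xi eta zeta p) e &
        `|b - \sum_(i < n) cmul (T (xi i)) (cstar (T (eta i)))| <= e%:C].

Record covariant_pair : Prop := {
  pi_linear : forall (k : R[i]) (f g : X -> R[i]), continuous f -> continuous g ->
    pi (fun x => k * f x + g x) = k *: pi f + pi g ;
  pi_mul : forall f g : X -> R[i], continuous f -> continuous g ->
    pi (fun x => f x * g x) = cmul (pi f) (pi g) ;
  pi_star : forall f : X -> R[i], continuous f -> pi (fun x => (f x)^*) = cstar (pi f) ;
  T_linear : forall (k : R[i]) (xi eta : E -> R[i]), continuous xi -> continuous eta ->
    T (fun p => k * xi p + eta p) = k *: T xi + T eta ;
  T_inner : forall xi eta : E -> R[i], continuous xi -> continuous eta ->
    cmul (cstar (T xi)) (T eta) = pi (inner xi eta) ;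
  T_lact : forall (a : X -> R[i]) (xi : E -> R[i]), continuous a -> continuous xi ->
    T (lact a xi) = cmul (pi a) (T xi) ;
  pair_covariant : forall a, katsura_ideal a -> Psi (lact a) (pi a) }.

End Pair.

Record cuntz_pimsner (O : cstarType R) (T : (E -> R[i]) -> O)
    (pi : (X -> R[i]) -> O) : Prop := {
  cuntz_pimsner_pair : covariant_pair T pi ;
  cuntz_pimsner_generated :
    generates ([set T xi | xi in [set xi : E -> R[i] | continuous xi]] `|`
               [set pi a | a in [set a : X -> R[i] | continuous a]]) ;
  cuntz_pimsner_universal : forall (B : cstarType R)
      (T' : (E -> R[i]) -> B) (pi' : (X -> R[i]) -> B),
    covariant_pair T' pi' ->
    exists f : O -> B,
      [/\ star_hom f, forall xi : E -> R[i], continuous xi -> f (T xi) = T' xi &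
          forall a : X -> R[i], continuous a -> f (pi a) = pi' a] }.

Section Generators.
Variables (O : cstarType R) (T : (E -> R[i]) -> O) (pi : (X -> R[i]) -> O).

Definition gen_U (j : 'I_d) : O := pi (fun y => (\val y : 'rV__) 0 j).

(* U^nu = prod_j U_j^(nu_j), as the image under pi of the monomial y^nu. *)
Definition gen_Upow (nu : 'rV[int]_d) : O :=
  pi (fun y => \prod_j (\val y : 'rV__) 0 j ^ nu 0 j).

Definition gen_S : O := T (fun=> 1).

Definition gen_Snu (nu : 'rV[int]_d) : O := cmul (gen_Upow nu) gen_S.

(* S_alpha x and S_alpha x S_beta^*; the empty word acts as the unit. *)
Definition Sword (alpha : seq 'rV[int]_d) (x : O) : O :=
  foldr (fun nu => cmul (gen_Snu nu)) x alpha.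

Definition Sconj (alpha beta : seq 'rV[int]_d) (x : O) : O :=
  Sword alpha (cstar (Sword beta (cstar x))).

Record gauge_action (gamma : R[i] -> O -> O) : Prop := {
  gauge_auto : forall t, `|t| = 1 -> star_iso (gamma t) ;
  gauge_one : forall x, gamma 1 x = x ;
  gauge_mul : forall s t x, `|s| = 1 -> `|t| = 1 ->
    gamma (s * t) x = gamma s (gamma t x) ;
  gauge_S : forall t, `|t| = 1 -> gamma t gen_S = t *: gen_S ;
  gauge_U : forall t j, `|t| = 1 -> gamma t (gen_U j) = gen_U j }.

(* The C*-algebra A, through the isometric embedding incl, is the fixed point
   algebra of gamma. *)
Definition fixed_point_algebra (gamma : R[i] -> O -> O) (A : cstarType R)
    (incl : A -> O) : Prop :=
  [/\ star_hom incl, forall x, `|incl x| = `|x| &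
      range incl = [set x | forall t, `|t| = 1 -> gamma t x = x]].

End Generators.

End Correspondence.

Section Diagonal.
Variables (R : realType) (d : nat) (a : 'rV[int]_d) (G : 'M[int]_d).
Local Notation X := (torus R d).
Local Notation E := (Omega R (diag_mx a) G).

Definition index_set (nu : 'rV[int]_d) : bool :=
  [forall j, 0 <= nu 0 j <= a 0 j - 1].

Variables (O : cstarType R) (T : (E -> R[i]) -> O) (pi : (X -> R[i]) -> O).

(* A is embedded in O by incl; S_alpha f S_beta^* is required to lie in A, and
   rho sends it to S_(0,alpha) f S_(0,beta)^*, where alpha, beta may be empty. *)
Definition shift_endomorphism (A : cstarType R) (incl : A -> O)
    (rho : A -> A) : Prop :=
  star_hom rho /\
  forall k (alpha beta : k.-tuple 'rV[int]_d) (f : X -> R[i]),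
    all index_set alpha -> all index_set beta -> continuous f ->
    exists x : A,
      incl x = Sconj T pi alpha beta (pi f) /\
      incl (rho x) = Sconj T pi (0 :: alpha) (0 :: beta) (pi f).

End Diagonal.

(* Main.v *)
(* O itself is the crossed product: iota is the inclusion of the fixed point
   algebra and s is the isometry S, so that rho x = S x S* .  Everything is
   reduced to the density of the span of the S_alpha f S_beta* with alpha and
   beta of equal length, which follows by averaging gamma over roots of unity.
   The universal property comes from that of O, applied in B(H) to the pair
   T' xi = p (T xi S* ) t and pi' = p o pi.  The compression x |-> S* x S is a
   retraction of rho, so the colimit of rho is realised by the sequences y with
   y_n = S* y_(n+1) S that are asymptotically orbits of rho; it is nonzero
   because O acts on l^2 by weighted shifts along backward orbits in the torus. *)
Require Import Defs.
From HB Require Import structures.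
From mathcomp Require Import all_boot all_order all_algebra.
From mathcomp Require Import complex.
From mathcomp Require Import all_classical all_reals all_analysis.
From mathcomp Require Import zify ring lra.
From mathcomp Require cyclic separable cyclotomic.

Set Implicit Arguments.
Unset Strict Implicit.
Unset Printing Implicit Defensive.

Import Order.TTheory GRing.Theory Num.Theory.
Import numFieldNormedType.Exports.

Local Open Scope classical_set_scope.
Local Open Scope complex_scope.
Local Open Scope ring_scope.

(** * Real-valued norms and Banach spaces *)

(** Continuity rests on elementary norm estimates. Star-homomorphisms are contractive because a
    self-adjoint b with ||b|| < 1 is the mean of b + i sqrt(1 - b^2) and b - i sqrt(1 - b^2), the
    root coming from a fixed point iteration; the same device bounds [pi], whose domain carries no
    C*-structure here. The gauge action is prescribed only on S and on the coordinates: that it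
    fixes every [pi f] requires trigonometric density, and that it scales every [T xi] requires the
    finite Fourier expansion T xi = sum_nu S_nu pi<chi_nu, xi>, the chi_nu being the characters of
    the fibres. O can serve as the crossed product because T xi is the product of T xi S^*, a fixed
    point, with S. A colimit is normally a quotient by null sequences; the retraction selects one
    exact representative in each class, so no quotient is formed. That O is nonzero cannot be read
    off a universal property: a covariant pair has to be exhibited, and the common fixed point 1 of
    sigma_F and sigma_G is a root whose tree of backward orbits can be numbered by the natural
    numbers. *)

Section RealNorm.
Variable R : realType.

Lemma realCM (x y : R) : (x * y)%:C = x%:C * y%:C. Proof. exact: rmorphM. Qed.
Lemma realCD (x y : R) : (x + y)%:C = x%:C + y%:C. Proof. exact: rmorphD. Qed.
Lemma realCB (x y : R) : (x - y)%:C = x%:C - y%:C. Proof. exact: rmorphB. Qed.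

(** Norms take values in [R[i]]; the real part loses nothing and gives access to suprema, square
    roots and linear arithmetic. *)
Definition nrm (V : normedZmodType R[i]) (x : V) : R := complex.Re `|x|.

Section Zmod.
Variable V : normedZmodType R[i].
Implicit Types x y z : V.

Lemma nrmE x : `|x| = (nrm x)%:C.
Proof. by rewrite /nrm RRe_real // ger0_real. Qed.

Lemma nrm_ge0 x : 0 <= nrm x.
Proof. by rewrite -ler0c -nrmE. Qed.

Lemma nrmD x y : nrm (x + y) <= nrm x + nrm y.
Proof. by rewrite -lecR rmorphD /= -!nrmE ler_normD. Qed.

Lemma nrmN x : nrm (- x) = nrm x.
Proof. by rewrite /nrm normrN. Qed.

Lemma nrmB x y : nrm (x - y) <= nrm x + nrm y.
Proof. by rewrite -(nrmN y) nrmD. Qed.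

Lemma nrmC x y : nrm (x - y) = nrm (y - x).
Proof. by rewrite /nrm distrC. Qed.

Lemma nrm0 : nrm (0 : V) = 0.
Proof. by rewrite /nrm normr0. Qed.

Lemma nrm_eq0 x : nrm x = 0 -> x = 0.
Proof. by move=> x0; apply/normr0_eq0; rewrite nrmE x0. Qed.

Lemma nrm_tri z x y : nrm (x - y) <= nrm (x - z) + nrm (z - y).
Proof. by apply: le_trans (nrmD _ _); rewrite addrA subrK. Qed.

Lemma nrm_split z x y (e : R) : nrm (x - z) <= e / 2 -> nrm (z - y) <= e / 2 ->
  nrm (x - y) <= e.
Proof. by move=> xz zy; apply: le_trans (nrm_tri z _ _) _; rewrite (splitr e) lerD. Qed.

Lemma nrm_sub_le x y : nrm x <= nrm y + nrm (x - y).
Proof. by apply: le_trans (nrmD _ _); rewrite addrC subrK. Qed.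

Lemma nrm_sum I (s : seq I) (P : pred I) (F : I -> V) :
  nrm (\sum_(i <- s | P i) F i) <= \sum_(i <- s | P i) nrm (F i).
Proof.
elim/big_ind2: _ => [|x1 x2 y1 y2 h1 h2|//]; first by rewrite nrm0.
by apply: le_trans (nrmD _ _) _; apply: lerD.
Qed.

Lemma nrm_small x : (forall e : R, 0 < e -> nrm x <= e) -> x = 0.
Proof.
move=> h; apply: nrm_eq0; apply/eqP; rewrite eq_le nrm_ge0 andbT.
by apply/ler_addgt0Pr => e /h; rewrite add0r.
Qed.

Lemma nrm_small_eq x y : (forall e : R, 0 < e -> nrm (x - y) <= e) -> x = y.
Proof. by move=> h; apply/eqP; rewrite -subr_eq0; apply/eqP/nrm_small. Qed.

End Zmod.

Lemma nrmM (x y : R[i]) : nrm (x * y) = nrm x * nrm y.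
Proof. by apply: complexI; rewrite rmorphM /= -!nrmE normrM. Qed.

Lemma nrmV (k : R[i]) : nrm k^-1 = (nrm k)^-1.
Proof. by apply: complexI; rewrite fmorphV /= -!nrmE normfV. Qed.

Lemma nrmX (x : R[i]) n : nrm (x ^+ n) = nrm x ^+ n.
Proof. by apply: complexI; rewrite rmorphXn /= -!nrmE normrX. Qed.

Lemma nrm1 : nrm (1 : R[i]) = 1.
Proof. by rewrite /nrm normr1. Qed.

Lemma nrm_conj (x : R[i]) : nrm x^* = nrm x.
Proof. by rewrite /nrm normcJ. Qed.

Lemma nrmR (x : R) : nrm x%:C = `|x|.
Proof. by rewrite /nrm normc_def /= expr0n addr0 sqrtr_sqr. Qed.

Lemma nrm_Re (x : R[i]) : `|complex.Re x| <= nrm x.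
Proof. by rewrite -lecR -nrmE normc_ge_Re. Qed.

Lemma nrm_i : nrm ('i : R[i]) = 1.
Proof. by rewrite /nrm normc_def /= expr0n expr1n add0r sqrtr1. Qed.

Lemma nrm_Im (x : R[i]) : `|complex.Im x| <= nrm x.
Proof.
rewrite -normrN -ReiNIm; apply: le_trans (nrm_Re _) _.
by rewrite nrmM nrm_i mulr1.
Qed.

Lemma nrm_ReIm (x : R[i]) : nrm x <= `|complex.Re x| + `|complex.Im x|.
Proof.
rewrite {1}(complexE x); apply: le_trans (nrmD _ _) _.
by rewrite nrmM !nrmR nrm_i mul1r.
Qed.

Lemma nrm_sqr (x : R[i]) : (nrm x ^+ 2)%:C = x * x^*.
Proof. by rewrite rmorphXn /= -nrmE sqr_normc. Qed.

Lemma nrm1_conjV (x : R[i]) : nrm x = 1 -> x * x^* = 1.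
Proof. by move=> x1; rewrite -nrm_sqr x1 expr1n. Qed.

Lemma nrmZ (V : normedModType R[i]) (k : R[i]) (x : V) : nrm (k *: x) = nrm k * nrm x.
Proof. by apply: complexI; rewrite rmorphM /= -!nrmE normrZ. Qed.

Lemma ler_mul_div (b e x y : R) : 0 < b -> 0 <= x <= b -> 0 <= y <= e / b -> x * y <= e.
Proof.
move=> b0 /andP[x0 xb] /andP[y0 yb].
have -> : e = b * (e / b) by rewrite mulrC divfK // gt_eqF.
exact: ler_pM.
Qed.

(** Dividing by [nrm k + 1] rather than [nrm k] keeps the tolerance meaningful for [k = 0]. *)
Lemma nrm_linear_close (V : normedModType R[i]) (k : R[i]) (x y x' y' : V) (e : R) :
  nrm (x - x') <= e / 2 / (nrm k + 1) -> nrm (y - y') <= e / 2 ->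
  nrm (k *: x + y - (k *: x' + y')) <= e.
Proof.
move=> xx yy; rewrite opprD addrACA -scalerBr; apply: le_trans (nrmD _ _) _.
rewrite (splitr e) lerD // nrmZ.
apply: (@ler_mul_div (nrm k + 1)); rewrite ?nrm_ge0 ?xx //; first by rewrite ltr_wpDl ?nrm_ge0.
by rewrite /= lerDl.
Qed.

(** Only [x] and [y'] need bounds, by m x y - m x' y' = m x (y - y') + m (x - x') y'. The same
    estimate serves products and scalar multiplication. *)
Lemma nrm_bilin_close (U V W : normedZmodType R[i]) (m : U -> V -> W) (C D e : R) x y x' y' :
  (forall a b c, m (a - b) c = m a c - m b c) ->
  (forall a b c, m c (a - b) = m c a - m c b) ->
  (forall a b, nrm (m a b) <= nrm a * nrm b) -> nrm x <= C -> nrm y' <= D ->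
  nrm (x - x') <= e / 2 / (D + 1) -> nrm (y - y') <= e / 2 / (C + 1) ->
  nrm (m x y - m x' y') <= e.
Proof.
move=> ml mr mn xC yD xx yy.
have -> : m x y - m x' y' = m x (y - y') + m (x - x') y' by rewrite ml mr addrA subrK.
apply: le_trans (nrmD _ _) _; rewrite (splitr e); apply: lerD.
  apply: le_trans (mn _ _) _; have C0 := le_trans (nrm_ge0 x) xC.
  apply: (@ler_mul_div (C + 1)); rewrite ?nrm_ge0 //; first by rewrite ltr_wpDl.
  by rewrite /= (le_trans xC) // lerDl.
apply: le_trans (mn _ _) _; have D0 := le_trans (nrm_ge0 y') yD; rewrite mulrC.
apply: (@ler_mul_div (D + 1)); rewrite ?nrm_ge0 //; first by rewrite ltr_wpDl.
by rewrite /= (le_trans yD) // lerDl.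
Qed.

Definition tends (V : normedZmodType R[i]) (u : nat -> V) (l : V) : Prop :=
  forall e : R, 0 < e -> exists N, forall n, (N <= n)%N -> nrm (u n - l) <= e.

Lemma tends_sub_shift (V : normedZmodType R[i]) (u : nat -> V) l c N :
  tends u l -> tends (fun m => c - u (m + N)%N) (c - l).
Proof.
move=> h e /h[M hM]; exists M => m Mm; rewrite opprB addrC addrA subrK nrmC.
by rewrite hM // (leq_trans Mm) // leq_addr.
Qed.

Definition cauchy_seq (V : normedZmodType R[i]) (u : nat -> V) : Prop :=
  forall e : R, 0 < e -> exists N, forall m n, (N <= m)%N -> (N <= n)%N ->
    nrm (u m - u n) <= e.

Lemma ball_nrm (V : normedModType R[i]) (x y : V) (e : R) :
  ball x e%:C y <-> nrm (x - y) < e.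
Proof. by rewrite -ball_normE /ball_ /= nrmE ltcR. Qed.

(** The order of [R[i]] only compares numbers with equal imaginary parts, so a positive radius is
    real. *)
Lemma pos_complex (e : R[i]) : 0 < e -> exists2 r : R, 0 < r & e = r%:C.
Proof.
move=> e0; exists (complex.Re e); last by rewrite RRe_real // gtr0_real.
by move: e0; rewrite ltcE => /andP[].
Qed.

Lemma nbhs_nrm (V : normedModType R[i]) (x : V) (U : set V) :
  nbhs x U <-> exists2 e : R, 0 < e & forall y, nrm (x - y) < e -> U y.
Proof.
split=> [/nbhs_ballP[_ /pos_complex[e e0 ->] h]|[e e0 h]].
  by exists e => // w zw; apply: h; apply/ball_nrm.
apply/nbhs_ballP; exists e%:C; first by rewrite /= ltcR.
by move=> w /ball_nrm; exact: h.
Qed.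

Lemma archi_inv (e : R) : 0 < e -> exists N, forall n, (N <= n)%N -> n.+1%:R^-1 <= e.
Proof.
move=> e0; exists (Num.truncn e^-1) => n hn.
rewrite -[leRHS]invrK lef_pV2 ?posrE ?ltr0n ?invr_gt0 //.
apply/ltW/(lt_le_trans (truncnS_gt (e^-1))); by rewrite ler_nat.
Qed.

(** A Cauchy filter contains balls of radius 1/(n+1); their centres form a Cauchy sequence, and its
    limit is the limit of the filter. *)
Lemma seq_complete (V : normedModType R[i]) :
  (forall u : nat -> V, cauchy_seq u -> exists l, tends u l) ->
  forall F : set_system V, ProperFilter F -> cauchy F -> cvg F.
Proof.
move=> sc F PF cF.
have /choice[x xP] : forall n, exists x : V, F (ball x (n.+1%:R^-1 : R)%:C).
  move=> n; have e0 : 0 < (n.+1%:R^-1 : R)%:C by rewrite ltcR invr_gt0.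
  have /cauchy_ballP/(_ _ e0) := cF.
  by move=> /nearP_dep h; have [y] := filter_ex h; exists y.
have x2 m n : nrm (x m - x n) <= m.+1%:R^-1 + n.+1%:R^-1.
  have [z [/ball_nrm zm /ball_nrm zn]] := filter_ex (filterI (xP m) (xP n)).
  by apply: le_trans (nrm_tri z _ _) _; rewrite (nrmC z); apply: lerD; apply: ltW.
have [e e0|l xl] := sc x.
  have [N hN] := archi_inv (divr_gt0 e0 (ltr0n _ 2)).
  exists N => m n Nm Nn; apply: le_trans (x2 _ _) _.
  by rewrite (splitr e); apply: lerD; apply: hN.
apply: (cvgP l); apply/cvg_ballP => _ /pos_complex[e e0 ->].
have [N hN] := archi_inv (divr_gt0 e0 (ltr0n _ 3)).
have [M hM] := xl _ (divr_gt0 e0 (ltr0n _ 3)).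
apply: filterS (xP (maxn N M)) => y /ball_nrm xy; apply/ball_nrm.
apply: le_lt_trans (nrm_tri (x (maxn N M)) _ _) _.
rewrite (nrmC l); move: xy (hM _ (leq_maxr N M)) (hN _ (leq_maxl N M)).
move: (nrm _) (nrm _) _^-1 => p q r; lra.
Qed.

Lemma complete_cauchy_seq (V : completeNormedModType R[i]) (u : nat -> V) :
  cauchy_seq u -> exists l, tends u l.
Proof.
move=> cu; have /cvg_ex[l ul] : cvg (u @ \oo).
  apply/cauchy_cvgP/cauchy_ballP => _ /pos_complex[e e0 ->].
  have [N hN] := cu _ (divr_gt0 e0 (ltr0n _ 2)).
  exists (u @` [set n | (N <= n)%N], u @` [set n | (N <= n)%N]).
    by split; exists N => // n /= Nn; exists n.
  move=> [_ _] [/= [m Nm <-] [n Nn <-]]; apply/ball_nrm.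
  by apply: le_lt_trans (hN _ _ Nm Nn) _; lra.
exists l => e e0; have e0' : 0 < e%:C by rewrite ltcR.
have /cvg_ballP/(_ _ e0') := ul; case=> N _ hN.
by exists N => n /hN /ball_nrm; rewrite nrmC => /ltW.
Qed.

Lemma closed_nrm (V : normedModType R[i]) (D : set V) :
  closed D <-> forall x, (forall e : R, 0 < e -> exists2 y, D y & nrm (x - y) <= e) -> D x.
Proof.
split=> [cD x h|h].
  apply: cD => B /nbhs_ballP[_ /pos_complex[e e0 ->]] hB.
  have [|y Dy xy] := h (e / 2); first by lra.
  by exists y; split => //; apply: hB; apply/ball_nrm; lra.
move=> x clx; apply: h => e e0.
have [|y [Dy /ball_nrm/ltW yx]] := clx (ball x e%:C); last by exists y.
by apply: nbhsx_ballx; rewrite ltcR.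
Qed.

End RealNorm.

(** An instance supplies only what is easy to check: a real norm, one inequality of homogeneity and
    sequential completeness. *)
HB.factory Record Lmodule_isBanach (R : realType) V & GRing.Lmodule R[i] V := {
  bnorm : V -> R ;
  bnormD : forall x y, bnorm (x + y) <= bnorm x + bnorm y ;
  bnormZ_le : forall (k : R[i]) x, bnorm (k *: x) <= nrm k * bnorm x ;
  bnorm_eq0 : forall x, bnorm x = 0 -> x = 0 ;
  bnorm_complete : forall u : nat -> V,
    (forall e : R, 0 < e -> exists N, forall m n, (N <= m)%N -> (N <= n)%N ->
       bnorm (u m - u n) <= e) ->
    exists l, forall e : R, 0 < e -> exists N, forall n, (N <= n)%N ->
       bnorm (u n - l) <= e }.

HB.builders Context R V & Lmodule_isBanach R V.

Let bnormZ k x : bnorm (k *: x) = nrm k * bnorm x.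
Proof.
apply/eqP; rewrite eq_le bnormZ_le /=; have [->|k0] := eqVneq k 0.
  (* For [k = 0] the goal is 0 <= bnorm 0, which is subadditivity at 0 + 0. *)
  by have := bnormD 0 (0 : V); rewrite nrm0 mul0r scale0r addr0; lra.
have := bnormZ_le k^-1 (k *: x); rewrite scalerA mulVf // scale1r nrmV.
by rewrite ler_pdivlMl // lt0r nrm_ge0 andbT; apply: contra_neq k0 => /nrm_eq0.
Qed.

Let cnorm (x : V) : R[i] := (bnorm x)%:C.

Let cnormD x y : cnorm (x + y) <= cnorm x + cnorm y.
Proof. by rewrite /cnorm -rmorphD lecR bnormD. Qed.

Let cnormZ k x : cnorm (k *: x) = `|k| * cnorm x.
Proof. by rewrite /cnorm bnormZ rmorphM /= -nrmE. Qed.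

Let cnorm_eq0 x : cnorm x = 0 -> x = 0.
Proof. by move=> /complexI/bnorm_eq0. Qed.

HB.instance Definition _ := Lmodule_isNormed.Build R[i] V cnormD cnormZ cnorm_eq0.

Let complete (F : set_system V) : ProperFilter F -> cauchy F -> cvg F.
Proof. by apply: seq_complete => u cu; apply: bnorm_complete. Qed.

HB.instance Definition _ := Uniform_isComplete.Build V complete.

HB.end.

(** * Star-homomorphisms are contractive *)

Section Cstar.
Variable R : realType.
Implicit Types A B : cstarType R.

Section Algebra.
Variable A : cstarType R.
Implicit Types x y z : A.

Lemma cmulDl x y z : cmul (x + y) z = cmul x z + cmul y z.
Proof. by rewrite -[x]scale1r cmul_linearl !scale1r. Qed.

Lemma cmulDr x y z : cmul z (x + y) = cmul z x + cmul z y.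
Proof. by rewrite -[x]scale1r cmul_linearr !scale1r. Qed.

Lemma cmul0l x : cmul 0 x = 0.
Proof. by apply: (addrI (cmul 0 x)); rewrite -cmulDl !addr0. Qed.

Lemma cmul0r x : cmul x 0 = 0.
Proof. by apply: (addrI (cmul x 0)); rewrite -cmulDr !addr0. Qed.

Lemma cmulZl k x y : cmul (k *: x) y = k *: cmul x y.
Proof. by rewrite -{1}[k *: x]addr0 cmul_linearl cmul0l addr0. Qed.

Lemma cmulZr k x y : cmul x (k *: y) = k *: cmul x y.
Proof. by rewrite -{1}[k *: y]addr0 cmul_linearr cmul0r addr0. Qed.

Lemma cmulNl x y : cmul (- x) y = - cmul x y.
Proof. by rewrite -scaleN1r cmulZl scaleN1r. Qed.

Lemma cmulNr x y : cmul x (- y) = - cmul x y.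
Proof. by rewrite -scaleN1r cmulZr scaleN1r. Qed.

Lemma cmulBl x y z : cmul (x - y) z = cmul x z - cmul y z.
Proof. by rewrite cmulDl cmulNl. Qed.

Lemma cmulBr x y z : cmul z (x - y) = cmul z x - cmul z y.
Proof. by rewrite cmulDr cmulNr. Qed.

Lemma cmul_suml I (s : seq I) (P : pred I) (F : I -> A) y :
  cmul (\sum_(i <- s | P i) F i) y = \sum_(i <- s | P i) cmul (F i) y.
Proof. exact: (big_morph (cmul^~ y) (fun a b => cmulDl a b y) (cmul0l y)). Qed.

Lemma cstarD x y : cstar (x + y) = cstar x + cstar y.
Proof. by rewrite -[x]scale1r cstar_antilinear rmorph1 !scale1r. Qed.

Lemma cstar0 : cstar (0 : A) = 0.
Proof. by apply: (addrI (cstar 0)); rewrite -cstarD !addr0. Qed.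

Lemma cstarZ k x : cstar (k *: x) = k^* *: cstar x.
Proof. by rewrite -{1}[k *: x]addr0 cstar_antilinear cstar0 addr0. Qed.

Lemma cstarN x : cstar (- x) = - cstar x.
Proof. by rewrite -scaleN1r cstarZ rmorphN1 scaleN1r. Qed.

Lemma cstarB x y : cstar (x - y) = cstar x - cstar y.
Proof. by rewrite cstarD cstarN. Qed.

Lemma nrm_cmul x y : nrm (cmul x y) <= nrm x * nrm y.
Proof. by rewrite -lecR rmorphM /= -!nrmE cnormM. Qed.

Lemma nrm_cstar_mul x : nrm (cmul (cstar x) x) = nrm x ^+ 2.
Proof. by apply: complexI; rewrite rmorphXn /= -!nrmE cnorm_cstar. Qed.

Lemma nrm_cstar x : nrm (cstar x) = nrm x.
Proof.
have le y : nrm y <= nrm (cstar y).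
  have := nrm_cmul (cstar y) y; rewrite nrm_cstar_mul expr2.
  have [->|y0] := eqVneq (nrm y) 0; first by rewrite nrm_ge0.
  by rewrite ler_pM2r // lt0r y0 nrm_ge0.
by apply/eqP; rewrite eq_le le andbT -{2}(cstarK x) le.
Qed.

Lemma cstar_mul_eq0 x : cmul (cstar x) x = 0 -> x = 0.
Proof.
move=> x0; apply: nrm_eq0; apply/eqP; rewrite -sqrf_eq0 -nrm_cstar_mul x0.
by rewrite nrm0.
Qed.

End Algebra.

Section Hom.
Variables (A B : cstarType R) (f : A -> B).
Hypothesis hf : star_hom f.

Lemma homM x y : f (cmul x y) = cmul (f x) (f y). Proof. by case: hf. Qed.
Lemma homS x : f (cstar x) = cstar (f x). Proof. by case: hf. Qed.

Lemma homD x y : f (x + y) = f x + f y.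
Proof. by case: hf => h _ _; rewrite -{1}[x]scale1r h scale1r. Qed.

Lemma hom0 : f 0 = 0.
Proof. by apply: (addrI (f 0)); rewrite -homD !addr0. Qed.

Lemma homZ k x : f (k *: x) = k *: f x.
Proof. by case: hf => h _ _; rewrite -{1}[k *: x]addr0 h hom0 addr0. Qed.

Lemma homN x : f (- x) = - f x.
Proof. by rewrite -scaleN1r homZ scaleN1r. Qed.

Lemma homB x y : f (x - y) = f x - f y.
Proof. by rewrite homD homN. Qed.

Lemma hom_sum I (s : seq I) (P : pred I) (F : I -> A) :
  f (\sum_(i <- s | P i) F i) = \sum_(i <- s | P i) f (F i).
Proof. exact: (big_morph f homD hom0). Qed.

End Hom.

Lemma expr_small (c e : R) : 0 <= c < 1 -> 0 < e -> exists N, c ^+ N <= e.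
Proof.
move=> /andP[c0 c1] e0; have : `|c| < 1 by rewrite ger0_norm.
move=> /cvg_expr/cvgrPdist_le/(_ _ e0)[N _ hN]; exists N.
by have /= := hN N (leqnn N); rewrite sub0r normrN ger0_norm // exprn_ge0.
Qed.

Lemma geometric_cauchy (V : normedZmodType R[i]) (u : nat -> V) (c : R) :
  0 <= c < 1 -> (forall n, nrm (u n.+1 - u n) <= c ^+ n) -> cauchy_seq u.
Proof.
move=> c01 hu e e0; have /andP[c0 c1] := c01.
(* A power c^N below this constant makes the geometric tail c^N / (1 - c) at most e / 2. *)
have e1 : 0 < e * (1 - c) / 2 by rewrite divr_gt0 // mulr_gt0 // subr_gt0.
have [N hN] := expr_small c01 e1.
have tail k : nrm (u (N + k)%N - u N) * (1 - c) <= c ^+ N * (1 - c ^+ k).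
  elim: k => [|k IH]; first by rewrite addn0 subrr nrm0 mul0r expr0 subrr mulr0.
  have h := nrm_tri (u (N + k)%N) (u (N + k.+1)%N) (u N).
  have hk := hu (N + k)%N; rewrite -addnS in hk.
  apply: (@le_trans _ _ ((c ^+ (N + k)%N + nrm (u (N + k)%N - u N)) * (1 - c))).
    by rewrite ler_wpM2r ?subr_ge0 ?(ltW c1) // (le_trans h) // lerD2r.
  rewrite mulrDl; apply: le_trans (lerD (lexx _) IH) _.
  rewrite exprD exprS; lra.
have tail' n : (N <= n)%N -> nrm (u n - u N) <= e / 2.
  move=> /subnKC <-; move: (n - N)%N => k.
  rewrite -(ler_pM2r (_ : 0 < 1 - c)) ?subr_gt0 //.
  apply: le_trans (tail k) _; apply: (@le_trans _ _ (c ^+ N)); last lra.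
  by rewrite ler_piMr ?exprn_ge0 // lerBlDr lerDl exprn_ge0.
exists N => m n Nm Nn; apply: le_trans (nrm_tri (u N) _ _) _.
by rewrite (splitr e) lerD // ?(nrmC (u N)) tail'.
Qed.

Lemma tends_unique (V : normedZmodType R[i]) (u : nat -> V) l l' :
  tends u l -> tends u l' -> l = l'.
Proof.
move=> ul ul'; apply: nrm_small_eq => e e0.
have e2 : 0 < e / 2 by rewrite divr_gt0.
have [[N hN] [M hM]] := (ul _ e2, ul' _ e2).
apply: le_trans (nrm_tri (u (maxn N M)) _ _) _.
by rewrite (splitr e) nrmC lerD ?hN ?hM ?leq_maxl ?leq_maxr.
Qed.

Lemma tends_lipschitz (V W : normedZmodType R[i]) (g : V -> W) (C : R) u l :
  (forall x y, nrm (g x - g y) <= C * nrm (x - y)) -> tends u l -> tends (g \o u) (g l).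
Proof.
move=> hg ul e e0; have C0 : 0 < `|C| + 1 by rewrite ltr_wpDl.
have [N hN] := ul _ (divr_gt0 e0 C0); exists N => n /hN h /=.
have -> : e = (`|C| + 1) * (e / (`|C| + 1)) by rewrite mulrC divfK // gt_eqF.
apply: le_trans (hg _ _) (le_trans _ (ler_wpM2l (ltW C0) h)).
by rewrite ler_wpM2r ?nrm_ge0 // (le_trans (ler_norm C)) // lerDl.
Qed.

(** Closedness in epsilon form; used with half-lines and balls, it passes inequalities to limits. *)
Lemma tends_small (V : normedZmodType R[i]) (u : nat -> V) l (D : set V) :
  (forall x, (forall e : R, 0 < e -> exists2 y, D y & nrm (x - y) <= e) -> D x) ->
  (forall n, D (u n)) -> tends u l -> D l.
Proof.
move=> cD Du ul; apply: cD => e e0; have [N /(_ N (leqnn N)) h] := ul _ e0.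
by exists (u N) => //; rewrite nrmC.
Qed.

Lemma tends_norm (V : normedZmodType R[i]) (u : nat -> V) l (C : R) :
  (forall n, nrm (u n) <= C) -> tends u l -> nrm l <= C.
Proof.
move=> uC; apply: (@tends_small _ _ _ [set x | nrm x <= C]) => // x h.
apply/ler_addgt0Pr => e /h[y /= yC xy].
by apply: le_trans (nrm_sub_le x y) _; rewrite lerD.
Qed.

Lemma tends_eq (V W : normedZmodType R[i]) (g k : V -> W) (C : R) u l :
  (forall x y, nrm (g x - g y) <= C * nrm (x - y)) ->
  (forall x y, nrm (k x - k y) <= C * nrm (x - y)) ->
  (forall n, g (u n) = k (u n)) -> tends u l -> g l = k l.
Proof.
move=> hg hk e ul; apply: (tends_unique (tends_lipschitz hg ul)).
have := tends_lipschitz hk ul; rewrite (_ : k \o u = g \o u) //.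
by apply/funext => n /=; rewrite e.
Qed.

(* The fixed point of z |-> (h + z^2) / 2, so that (1 - z)^2 = 1 - h in a unital
   algebra. *)
Lemma one_minus_sqrt A (h : A) : cstar h = h -> nrm h < 1 ->
  exists z, [/\ cstar z = z, z + z = h + cmul z z &
    forall x, cmul x h = cmul h x -> cmul x z = cmul z x].
Proof.
move=> hs h1; set c := nrm h; have c0 : 0 <= c by exact: nrm_ge0.
pose step z := 2^-1 *: (h + cmul z z).
pose u n := iter n step 0.
have nrm2 : nrm (2^-1 : R[i]) = 2^-1.
  have -> : (2^-1 : R[i]) = (2^-1 : R)%:C by rewrite fmorphV rmorph_nat.
  by rewrite nrmR ger0_norm.
have step_norm z : nrm z <= c -> nrm (step z) <= c.
  move=> zc; rewrite nrmZ nrm2; apply: (@le_trans _ _ (2^-1 * (c + c * c))).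
    rewrite ler_wpM2l ?invr_ge0 //; apply: le_trans (nrmD _ _) _.
    by rewrite lerD // (le_trans (nrm_cmul _ _)) // ler_pM ?nrm_ge0.
  have : c * c <= c by rewrite ler_piMl // ltW.
  lra.
have u_norm n : nrm (u n) <= c.
  by elim: n => [|n IH]; [rewrite nrm0 | exact: step_norm].
(* On the ball of radius c squaring is 2c-Lipschitz; the factor 1/2 in [step] turns this into a
   contraction of ratio c < 1. *)
have sqr_lip (x y : A) : nrm x <= c -> nrm y <= c ->
    nrm (cmul x x - cmul y y) <= 2 * c * nrm (x - y).
  move=> xc yc; have -> : cmul x x - cmul y y = cmul x (x - y) + cmul (x - y) y.
    by rewrite cmulBr cmulBl addrA subrK.
  apply: le_trans (nrmD _ _) _; have d0 := nrm_ge0 (x - y).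
  have := le_trans (nrm_cmul x (x - y)) (ler_wpM2r d0 xc).
  have := le_trans (nrm_cmul (x - y) y) (ler_wpM2l d0 yc).
  lra.
have step_lip x y : nrm x <= c -> nrm y <= c ->
    nrm (step x - step y) <= c * nrm (x - y).
  move=> xc yc; rewrite /step -scalerBr opprD addrACA subrr add0r nrmZ nrm2.
  have := sqr_lip _ _ xc yc; move: (nrm _) => a; lra.
have cu : cauchy_seq u.
  apply: (@geometric_cauchy _ u c); first by rewrite c0.
  elim=> [|n IH].
    by rewrite expr0 subr0 (le_trans (u_norm 1%N)) // ltW.
  rewrite exprS; apply: le_trans (step_lip (u n.+1) (u n) (u_norm _) (u_norm _)) _.
  by rewrite ler_wpM2l.
have [z uz] := complete_cauchy_seq cu.
have zc : nrm z <= c by exact: tends_norm uz.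
have us : tends (u \o S) z by move=> e /uz[N hN]; exists N => n Nn; apply/hN/leqW.
have zE : step z = z.
  apply: (tends_unique _ us) => e /uz[N hN]; exists N => n /hN h'.
  apply: le_trans (step_lip _ _ (u_norm _) zc) _.
  by apply: le_trans h'; rewrite ler_piMl ?nrm_ge0 // ltW.
exists z; split.
- apply: (@tends_eq _ _ (@cstar R A) id 1 _ _ _ _ _ uz).
  + by move=> x y; rewrite -cstarB nrm_cstar mul1r.
  + by move=> x y; rewrite mul1r.
  elim=> [|n IH]; first by rewrite cstar0.
  by rewrite /u /= -/(u n) /step cstarZ cstarD hs cstarM IH fmorphV rmorphMn rmorph1.
- rewrite -{1 2}zE /step -scalerDl; have -> : 2^-1 + 2^-1 = 1 :> R[i] by field.
  by rewrite scale1r.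
- move=> x xh; apply: (@tends_eq _ _ (cmul x) (cmul^~ x) (nrm x) _ _ _ _ _ uz).
  + by move=> y y'; rewrite -cmulBr nrm_cmul.
  + by move=> y y'; rewrite -cmulBl mulrC nrm_cmul.
  elim=> [|n IH]; first by rewrite cmul0l cmul0r.
  rewrite /u /= -/(u n) /step cmulZl cmulZr cmulDr cmulDl xh; congr (_ *: (_ + _)).
  by rewrite cmulA IH -cmulA IH cmulA.
Qed.

(* If b and w are commuting self-adjoint elements with b^2 + (1 - w)^2 = 1, then
   b + i (1 - w) is unitary; multiplying by y avoids the unit. *)
Lemma unitary_mul A (b w y : A) (j : R[i]) :
  cstar b = b -> cstar w = w -> cmul b w = cmul w b -> w + w = cmul b b + cmul w w ->
  j^* = - j -> j * j = -1 -> nrm (cmul b y + j *: (y - cmul w y)) = nrm y.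
Proof.
move=> bs ws bw wE jc jj; set q := cmul w y; set v := y - q.
have vE x : cmul (cstar v) x = cmul (cstar y) (x - cmul w x).
  by rewrite /v /q cstarB cstarM ws cmulBl cmulBr cmulA.
set p := cmul b y.
have bv : cmul (cstar p) v = cmul (cstar v) p.
  by rewrite vE /p /v cstarM bs -cmulA cmulBr /q !cmulA bw.
have pv : cmul (cstar p) p + cmul (cstar v) v = cmul (cstar y) y.
  rewrite vE /p cstarM bs -cmulA -cmulDr; congr cmul.
  have -> : cmul b (cmul b y) = q + q - cmul w q.
    by rewrite /q !cmulA -cmulDl wE cmulDl addrK.
  rewrite /v cmulBr -/q opprB addrACA [in X in _ + X]addrA.
  by rewrite addNr add0r addrACA subrr addr0 addrAC subrr add0r.
suff: cmul (cstar (p + j *: v)) (p + j *: v) = cmul (cstar y) y.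
  move=> /(congr1 (@nrm R A)); rewrite !nrm_cstar_mul => /eqP.
  by rewrite eqrXn2 ?nrm_ge0 // => /eqP.
rewrite -pv cstarD cstarZ jc scaleNr cmulBl ![cmul _ (_ + j *: _)]cmulDr !cmulZl !cmulZr scalerA jj bv.
by rewrite scaleN1r opprD opprK addrA addrK.
Qed.

(** Reduces by x^* x to self-adjoint elements and by scaling to ||y|| < 1. With (1 - z)^2 = 1 - y^2
    and w = f z, multiplying b = f y by b + i (1 - w) or by b - i (1 - w) preserves its norm; the
    two products add up to 2 b^2, whence ||b||^2 <= ||b||. *)
Lemma star_hom_norm A B (f : A -> B) x : star_hom f -> nrm (f x) <= nrm x.
Proof.
move=> hf.
have unit_ball y : cstar y = y -> nrm y < 1 -> nrm (f y) <= 1.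
  move=> ys y1; have := @one_minus_sqrt A (cmul y y).
  rewrite cstarM ys => -[//||z [zs zE zc]].
    rewrite (le_lt_trans (nrm_cmul _ _)) //.
    by rewrite (le_lt_trans _ y1) // ler_piMl ?nrm_ge0 // ltW.
  set b := f y; set w := f z.
  have bs : cstar b = b by rewrite -homS // ys.
  have ws : cstar w = w by rewrite -homS // zs.
  have bw : cmul b w = cmul w b by rewrite -!homM // (zc y) ?cmulA.
  have wE : w + w = cmul b b + cmul w w.
    by rewrite -(homD hf) zE (homD hf) !(homM hf).
  have i2 : ('i : R[i]) * 'i = -1 by rewrite -expr2 sqrCi.
  have u1 := unitary_mul b bs ws bw wE (conjCi _) i2.
  have u2 : nrm (cmul b b + - 'i *: (b - cmul w b)) = nrm b.
    apply: (unitary_mul b bs ws bw wE); last by rewrite mulrNN.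
    by rewrite raddfN /= conjCi.
  have : nrm (2 *: cmul b b) <= nrm b + nrm b.
    rewrite -{1}u1 -u2; apply: le_trans (nrmD _ _).
    by rewrite scaleNr addrACA subrr addr0 scaler_nat mulr2n.
  have -> : nrm (2 *: cmul b b) = 2 * nrm b ^+ 2.
    rewrite -nrm_cstar_mul bs nrmZ; congr (_ * _).
    by rewrite -[2](rmorph_nat (@real_complex R)) nrmR ger0_norm.
  have [->|b0] := eqVneq (nrm b) 0; first by rewrite ler01.
  have {}b0 : 0 < nrm b by rewrite lt0r b0 nrm_ge0.
  move: (nrm b) b0 => c c0 h; nra.
have self y : cstar y = y -> nrm (f y) <= nrm y.
  (* [c] exceeds the norm strictly, since [unit_ball] needs norm < 1 to extract the square root. *)
  move=> ys; apply/ler_addgt0Pr => e e0; set c := nrm y + e.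
  have c0 : 0 < c by rewrite ltr_wpDl ?nrm_ge0.
  have := unit_ball ((c^-1)%:C *: y).
  have ic : nrm (c^-1)%:C = c^-1 by rewrite nrmR ger0_norm ?invr_ge0 ?ltW.
  rewrite (homZ hf) cstarZ ys !nrmZ ic !(mulrC c^-1).
  rewrite ltr_pdivrMr // mul1r ltrDl ler_pdivrMr // mul1r; apply => //.
  by congr (_ *: _); exact: conjc_real.
have := self (cmul (cstar x) x); rewrite cstarM cstarK (homM hf) (homS hf).
rewrite !nrm_cstar_mul => /(_ erefl).
by rewrite ler_pXn2r ?nnegrE ?nrm_ge0.
Qed.

End Cstar.

(** * Operators on a Hilbert space *)

(** The value of [q] at q(y) x - <x, y> y equals q(y) (q(x) q(y) - |<x, y>|^2). Stated without a
    norm, because the triangle inequality in [Lmodule_isHilbert] relies on it. *)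
Lemma pre_cauchy_schwarz (R : realType) (V : lmodType R[i]) (dot : V -> V -> R[i])
    (q : V -> R) :
  (forall (k : R[i]) x y z, dot (k *: x + y) z = k * dot x z + dot y z) ->
  (forall x y, dot x y = (dot y x)^*) -> (forall x, dot x x = (q x)%:C) ->
  (forall x, 0 <= q x) -> (forall x, q x = 0 -> x = 0) ->
  forall x y, nrm (dot x y) ^+ 2 <= q x * q y.
Proof.
move=> lin sym dotxx q0 qeq0 x y.
have linr k z w : dot z (k *: w) = k^* * dot z w.
  rewrite sym -[k *: w]addr0 lin rmorphD rmorphM /= -!sym.
  suff -> : dot z 0 = 0 by rewrite addr0.
  rewrite sym; have := lin 1 0 0 z.
  by rewrite scaler0 addr0 mul1r -{1}[dot 0 z]addr0 => /addrI <-; rewrite conjC0.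
have addr z w v : dot z (w + v) = dot z w + dot z v.
  by rewrite sym -[w]scale1r lin mul1r rmorphD /= -!sym scale1r.
set c := dot x y; have [y0|y0] := eqVneq (q y) 0.
  by rewrite /c (qeq0 _ y0) -(scale0r (0 : V)) linr conjC0 mul0r nrm0 expr0n mulr_ge0.
have {}y0 : 0 < q y by rewrite lt0r y0 q0.
have : (q ((q y)%:C *: x + - c *: y))%:C = (q y * (q x * q y - nrm c ^+ 2))%:C.
  rewrite -dotxx lin -[- c *: y]addr0 !lin !addr !linr dotxx -/c.
  rewrite [dot y x]sym -/c !dotxx rmorphN /=.
  have -> : ((q y)%:C)^* = (q y)%:C by exact: conjc_real.
  have z0 w : dot w 0 = 0 by rewrite -(scale0r (0 : V)) linr conjC0 mul0r.
  have z0' w : dot 0 w = 0 by rewrite sym z0 conjC0.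
  have -> : (q 0)%:C = 0 by rewrite -dotxx z0.
  rewrite ?z0 ?z0' realCM realCB realCM nrm_sqr; ring.
move=> /complexI e; have := q0 ((q y)%:C *: x + - c *: y).
by rewrite e pmulr_rge0 // subr_ge0.
Qed.

Section HilbertTheory.
Variables (R : realType) (H : hilbertType R).
Implicit Types (x y z : H) (k : R[i]).

Lemma hdotDl x y z : hdot (x + y) z = hdot x z + hdot y z.
Proof. by rewrite -[x]scale1r hdot_linearl mul1r scale1r. Qed.

Lemma hdot0l x : hdot 0 x = 0.
Proof. by apply: (addrI (hdot 0 x)); rewrite -hdotDl !addr0. Qed.

Lemma hdotZl k x y : hdot (k *: x) y = k * hdot x y.
Proof. by rewrite -{1}[k *: x]addr0 hdot_linearl hdot0l addr0. Qed.

Lemma hdotDr x y z : hdot z (x + y) = hdot z x + hdot z y.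
Proof. by rewrite hdotC hdotDl rmorphD /= -!hdotC. Qed.

Lemma hdotZr k x y : hdot x (k *: y) = k^* * hdot x y.
Proof. by rewrite hdotC hdotZl rmorphM /= -hdotC. Qed.

Lemma hdotNl x y : hdot (- x) y = - hdot x y.
Proof. by rewrite -scaleN1r hdotZl mulN1r. Qed.

Lemma hdotNr x y : hdot x (- y) = - hdot x y.
Proof. by rewrite -scaleN1r hdotZr rmorphN1 mulN1r. Qed.

Lemma hdotBl x y z : hdot (x - y) z = hdot x z - hdot y z.
Proof. by rewrite hdotDl hdotNl. Qed.

Lemma hdotBr x y z : hdot z (x - y) = hdot z x - hdot z y.
Proof. by rewrite hdotDr hdotNr. Qed.

Lemma hdotxx x : hdot x x = (nrm x ^+ 2)%:C.
Proof. by rewrite hdot_norm nrmE rmorphXn. Qed.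

Lemma hdot_eq x y : (forall z, hdot x z = hdot y z) -> x = y.
Proof.
move=> h; apply/eqP; rewrite -subr_eq0; apply/eqP/nrm_eq0/eqP.
rewrite -sqrf_eq0; apply/eqP/complexI; rewrite -hdotxx.
by rewrite hdotBl h subrr.
Qed.

Lemma cauchy_schwarz x y : nrm (hdot x y) <= nrm x * nrm y.
Proof.
have q0 z : nrm z ^+ 2 = 0 -> z = 0 by move/eqP; rewrite sqrf_eq0 => /eqP/nrm_eq0.
have := pre_cauchy_schwarz (@hdot_linearl R H) (@hdotC R H) hdotxx (fun z => sqr_ge0 _) q0 x y.
by rewrite -exprMn ler_pXn2r ?nnegrE ?mulr_ge0 ?nrm_ge0.
Qed.

End HilbertTheory.

Section Operators.
Variables (R : realType) (H : hilbertType R).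

(** An adjoint is demanded instead of being produced by the Riesz theorem: every operator met below
    comes with one. *)
Definition is_bop (u : H -> H) : Prop :=
  [/\ forall (k : R[i]) x y, u (k *: x + y) = k *: u x + u y,
      exists C : R, forall x, nrm (u x) <= C * nrm x &
      exists v, adjoint u v].

Definition is_bopb (u : H -> H) : bool := `[< is_bop u >].

Record bop := Bop { bop_val :> H -> H ; _ : is_bopb bop_val }.

HB.instance Definition _ := [isSub for bop_val].
HB.instance Definition _ := [Choice of bop by <:].

Lemma bopP (u : bop) : is_bop u.
Proof. by case: u => u h; apply/asboolP. Qed.

Lemma bop_eq (u v : bop) : u =1 v -> u = v.
Proof. by move=> uv; apply/val_inj/funext. Qed.

Lemma bop_closed : submod_closed is_bopb.
Proof.
split.
  apply/asboolP; split.
  - by move=> k x y; rewrite scaler0 addr0.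
  - by exists 0 => x; rewrite nrm0 mul0r.
  - by exists 0 => x y; rewrite hdot0l hdotC hdot0l conjC0.
move=> k u v /asboolP[lu [C hC] [u' hu]] /asboolP[lv [D hD] [v' hv]].
have E x : (k *: u + v) x = k *: u x + v x by [].
apply/asboolP; split.
- move=> j x y; rewrite !E lu lv !scalerDr !scalerA.
  by rewrite mulrC addrACA.
- exists (nrm k * C + D) => x; rewrite mulrDl -mulrA E; apply: le_trans (nrmD _ _) _.
  by rewrite lerD // nrmZ ler_wpM2l ?nrm_ge0.
- exists (k^* *: u' + v') => x y; rewrite E hdotDl hdotZl hu hv.
  have -> : (k^* *: u' + v') y = k^* *: u' y + v' y by [].
  by rewrite hdotDr hdotZr conjCK.
Qed.

HB.instance Definition _ := GRing.isSubmodClosed.Build R[i] (H -> H) is_bopb bop_closed.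
HB.instance Definition _ := [SubChoice_isSubLmodule of bop by <:].

Lemma bopDE (u v : bop) x : (u + v) x = u x + v x. Proof. by []. Qed.
Lemma bopBE (u v : bop) x : (u - v) x = u x - v x. Proof. by []. Qed.
Lemma bopZE k (u : bop) x : (k *: u) x = k *: u x. Proof. by []. Qed.

Lemma bop_linear (u : bop) k x y : u (k *: x + y) = k *: u x + u y.
Proof. by case: (bopP u). Qed.

Lemma bop0r (u : bop) : u 0 = 0.
Proof. by apply: (addrI (u 0)); rewrite -{1}[u 0]scale1r -bop_linear scaler0 !addr0. Qed.

Lemma bopZr (u : bop) k x : u (k *: x) = k *: u x.
Proof. by rewrite -{1}[k *: x]addr0 bop_linear bop0r addr0. Qed.

Lemma bopBr (u : bop) x y : u (x - y) = u x - u y.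
Proof. by rewrite addrC -scaleN1r bop_linear scaleN1r addrC. Qed.

Definition opn (u : bop) : R := sup [set nrm (u x) | x in [set x | nrm x <= 1]].

Lemma opn_le (u : bop) (C : R) : 0 <= C -> (forall x, nrm (u x) <= C * nrm x) -> opn u <= C.
Proof.
move=> C0 hC; apply: ge_sup; first by exists (nrm (u 0)), 0 => //=; rewrite nrm0.
move=> _ [x /= x1 <-]; apply: le_trans (hC x) _.
by rewrite ler_piMr.
Qed.

Lemma opn_has_sup (u : bop) : has_sup [set nrm (u x) | x in [set x | nrm x <= 1]].
Proof.
have [_ [C hC] _] := bopP u.
split; first by exists (nrm (u 0)), 0 => //=; rewrite nrm0.
exists `|C| => _ [y /= y1 <-]; apply: le_trans (hC y) _.
apply: le_trans (ler_norm _) _; rewrite normrM ler_piMr //.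
by rewrite ger0_norm ?nrm_ge0.
Qed.

Lemma opn_ge0 (u : bop) : 0 <= opn u.
Proof.
apply: ub_le_sup; first by case: (opn_has_sup u).
by exists 0; rewrite /= ?nrm0 // bop0r nrm0.
Qed.

Lemma opn_bound (u : bop) x : nrm (u x) <= opn u * nrm x.
Proof.
have [x0|x0] := eqVneq (nrm x) 0.
  by rewrite (nrm_eq0 x0) bop0r !nrm0 mulr0.
have {}x0 : 0 < nrm x by rewrite lt0r x0 nrm_ge0.
rewrite -ler_pdivrMr //; apply: ub_le_sup; first by case: (opn_has_sup u).
have nx : nrm ((nrm x)^-1)%:C = (nrm x)^-1.
  by rewrite nrmR ger0_norm // invr_ge0 nrm_ge0.
exists (((nrm x)^-1)%:C *: x) => /=; last by rewrite bopZr nrmZ nx mulrC.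
by rewrite nrmZ nx mulVf ?gt_eqF.
Qed.

Lemma opnD (u v : bop) : opn (u + v) <= opn u + opn v.
Proof.
apply: opn_le => [|x]; first by rewrite addr_ge0 ?opn_ge0.
rewrite bopDE mulrDl; apply: le_trans (nrmD _ _) _.
by rewrite lerD ?opn_bound.
Qed.

Lemma opnZ_le k (u : bop) : opn (k *: u) <= nrm k * opn u.
Proof.
apply: opn_le => [|x]; first by rewrite mulr_ge0 ?opn_ge0 ?nrm_ge0.
by rewrite bopZE nrmZ -mulrA ler_wpM2l ?nrm_ge0 ?opn_bound.
Qed.

Lemma opn0_eq0 (u : bop) : opn u = 0 -> u = 0.
Proof.
move=> u0; apply: bop_eq => x; apply: nrm_eq0; apply/eqP.
by rewrite eq_le nrm_ge0 andbT (le_trans (opn_bound u x)) // u0 mul0r.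
Qed.

Definition bop_adj (u : bop) : H -> H :=
  let: And3 _ _ h := bopP u in projT1 (cid h).

Lemma bop_adjP (u : bop) : adjoint u (bop_adj u).
Proof. by rewrite /bop_adj; case: (bopP u) => _ _ h; case: cid. Qed.

Lemma adjointC (u v : H -> H) : adjoint u v -> adjoint v u.
Proof. by move=> h x y; rewrite hdotC -h -hdotC. Qed.

(** From ||v x||^2 = <u (v x), x> <= C ||v x|| ||x||. *)
Lemma adjoint_bound (u v : H -> H) (C : R) : adjoint u v ->
  (forall x, nrm (u x) <= C * nrm x) -> forall x, nrm (v x) <= C * nrm x.
Proof.
move=> uv hC x; have [->|v0] := eqVneq (nrm (v x)) 0.
  by apply: le_trans (nrm_ge0 (u x)) (hC x).
have {}v0 : 0 < nrm (v x) by rewrite lt0r v0 nrm_ge0.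
rewrite -(ler_pM2l v0) -expr2; have -> : nrm (v x) ^+ 2 = nrm (hdot (u (v x)) x).
  by rewrite uv hdotxx nrmR ger0_norm ?sqr_ge0.
apply: le_trans (cauchy_schwarz _ _) _.
by rewrite mulrA (mulrC _ C) ler_wpM2r ?nrm_ge0.
Qed.

Lemma adjoint_is_bop (u : bop) (v : H -> H) : adjoint u v -> is_bop v.
Proof.
move=> uv; split.
- move=> k x y; apply: hdot_eq => z.
  by rewrite hdotDl hdotZl !(adjointC uv) hdotDl hdotZl.
- by exists (opn u); apply: adjoint_bound uv (opn_bound u).
- by exists u; apply: adjointC.
Qed.

Lemma is_bopbP (u : H -> H) : is_bop u -> is_bopb u. Proof. by move=> h; apply/asboolP. Qed.

Definition bop_star (u : bop) : bop := Bop (is_bopbP (adjoint_is_bop (@bop_adjP u))).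

Lemma bop_starP (u : bop) x y : hdot (u x) y = hdot x (bop_star u y).
Proof. exact: bop_adjP. Qed.

Lemma bop_starPl (u : bop) x y : hdot (bop_star u x) y = hdot x (u y).
Proof. exact: (adjointC (@bop_adjP u)). Qed.

Lemma bop_star_uniq (u v : bop) : adjoint u v -> bop_star u = v.
Proof. by move=> uv; apply: bop_eq => x; apply: hdot_eq => y; rewrite bop_starPl (adjointC uv). Qed.

Lemma bop_mul_subproof (u v : bop) : is_bop (u \o v).
Proof.
split=> /=.
- by move=> k x y; rewrite !bop_linear.
- exists (opn u * opn v) => x; apply: le_trans (opn_bound u (v x)) _.
  by rewrite -mulrA ler_wpM2l ?opn_ge0 ?opn_bound.
- by exists (bop_star v \o bop_star u) => x y /=; rewrite !bop_starP.
Qed.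

Definition bop_mul (u v : bop) : bop := Bop (is_bopbP (bop_mul_subproof u v)).

Lemma opn_star u : opn (bop_star u) <= opn u.
Proof. by apply: opn_le (opn_ge0 u) _; apply: adjoint_bound (opn_bound u) => x y; exact: bop_starP. Qed.

Lemma opn_mul u v : opn (bop_mul u v) <= opn u * opn v.
Proof.
apply: opn_le => [|x]; first by rewrite mulr_ge0 ?opn_ge0.
apply: le_trans (opn_bound u (v x)) _.
by rewrite -mulrA ler_wpM2l ?opn_ge0 ?opn_bound.
Qed.

Lemma opn_star_mul u : opn (bop_mul (bop_star u) u) = opn u ^+ 2.
Proof.
apply/eqP; rewrite eq_le; apply/andP; split.
  by apply: le_trans (opn_mul _ _) _; rewrite expr2 ler_wpM2r ?opn_ge0 ?opn_star.
set C := opn (bop_mul _ _); have C0 : 0 <= C by exact: opn_ge0.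
suff h : opn u <= Num.sqrt C.
  by rewrite -(sqr_sqrtr C0) ler_pXn2r ?nnegrE ?opn_ge0 ?sqrtr_ge0.
apply: opn_le => [|x]; first exact: sqrtr_ge0.
rewrite -(@ler_pXn2r _ 2) ?nnegrE ?mulr_ge0 ?nrm_ge0 ?sqrtr_ge0 // exprMn sqr_sqrtr //.
have -> : nrm (u x) ^+ 2 = nrm (hdot x (bop_mul (bop_star u) u x)).
  by rewrite /= -bop_starP hdotxx nrmR ger0_norm ?sqr_ge0.
apply: le_trans (cauchy_schwarz _ _) _.
by rewrite expr2 mulrA [leLHS]mulrC ler_wpM2r ?nrm_ge0 // opn_bound.
Qed.

Lemma opnB_pt (u v : bop) x : nrm (u x - v x) <= opn (u - v) * nrm x.
Proof. by rewrite -bopBE opn_bound. Qed.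

Lemma bop_starB (u v : bop) : bop_star (u - v) = bop_star u - bop_star v.
Proof.
apply: bop_star_uniq => x y.
by rewrite !bopBE hdotBl hdotBr !bop_starP.
Qed.

Lemma tends_hdotl (f : nat -> H) x y : tends f x -> tends (fun n => hdot (f n) y) (hdot x y).
Proof.
apply: (@tends_lipschitz _ _ _ (hdot^~ y) (nrm y)) => a b.
by rewrite -hdotBl mulrC cauchy_schwarz.
Qed.

Lemma tends_hdotr (f : nat -> H) x y : tends f x -> tends (fun n => hdot y (f n)) (hdot y x).
Proof.
apply: (@tends_lipschitz _ _ _ (hdot y) (nrm y)) => a b.
by rewrite -hdotBr cauchy_schwarz.
Qed.

Lemma bop_pointwise (u : nat -> bop) :
  (forall e : R, 0 < e -> exists N, forall m n, (N <= m)%N -> (N <= n)%N ->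
     opn (u m - u n) <= e) ->
  exists w : H -> H, forall x, tends (fun n => u n x) (w x).
Proof.
move=> cu; have h x : exists l, tends (fun n => u n x) l; last by have [w hw] := choice h; exists w.
apply: complete_cauchy_seq => e e0; have x0 : 0 < nrm x + 1 by rewrite ltr_wpDl ?nrm_ge0.
have [N hN] := cu _ (divr_gt0 e0 x0); exists N => m n Nm Nn.
apply: le_trans (opnB_pt _ _ _) _.
by rewrite mulrC; apply: (ler_mul_div x0); rewrite ?opn_ge0 ?nrm_ge0 ?hN //= lerDl.
Qed.

Lemma opn_complete (u : nat -> bop) :
  (forall e : R, 0 < e -> exists N, forall m n, (N <= m)%N -> (N <= n)%N ->
     opn (u m - u n) <= e) ->
  exists l, forall e : R, 0 < e -> exists N, forall n, (N <= n)%N -> opn (u n - l) <= e.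
Proof.
move=> cu; have [w hw] := bop_pointwise cu.
(* The adjoints form a Cauchy sequence as well; their pointwise limit is the adjoint that [is_bop]
   asks for. *)
have [|v hv] := @bop_pointwise (fun n => bop_star (u n)).
  move=> e /cu[N hN]; exists N => m n Nm Nn; rewrite -bop_starB.
  exact: le_trans (opn_star _) (hN _ _ Nm Nn).
have close e : 0 < e -> exists N, forall n x, (N <= n)%N -> nrm (u n x - w x) <= e * nrm x.
  move=> /cu[N hN]; exists N => n x Nn.
  apply: (@tends_norm _ _ (fun m => u n x - u (m + N)%N x)).
    move=> m; apply: le_trans (opnB_pt _ _ _) _.
    by rewrite ler_wpM2r ?nrm_ge0 // hN // leq_addl.
  exact: tends_sub_shift (hw x).
have wbop : is_bop w.
  split.
  - move=> k x y; apply: (tends_unique (hw _)) => e e0.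
    have k0 : 0 < nrm k + 1 by rewrite ltr_wpDl ?nrm_ge0.
    have e2 : 0 < e / 2 by rewrite divr_gt0.
    have [[N hN] [M hM]] := (hw x _ (divr_gt0 e2 k0), hw y _ e2).
    exists (maxn N M) => n; rewrite geq_max => /andP[/hN h1 /hM h2].
    by rewrite bop_linear nrm_linear_close.
  - have [N /(_ N _ (leqnn N)) hN] := close 1 ltr01; exists (opn (u N) + 1) => x.
    rewrite mulrDl; apply: le_trans (nrm_sub_le _ (u N x)) _.
    by rewrite lerD ?opn_bound // nrmC hN.
  - exists v => x y; apply: (tends_unique (tends_hdotl y (hw x))).
    have := tends_hdotr x (hv y); congr tends; apply/funext => n.
    by rewrite bop_starP.
exists (Bop (is_bopbP wbop)) => e e0; have [N hN] := close e e0.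
by exists N => n Nn; apply: opn_le (ltW e0) _ => x; exact: hN.
Qed.

HB.instance Definition _ :=
  @Lmodule_isBanach.Build R bop opn opnD opnZ_le opn0_eq0 opn_complete.

End Operators.

Section OperatorAlgebra.
Variables (R : realType) (H : hilbertType R).
Local Notation bop := (bop H).
Implicit Types (u v w : bop) (k : R[i]).

Let mulA u v w : bop_mul u (bop_mul v w) = bop_mul (bop_mul u v) w.
Proof. exact: bop_eq. Qed.

Let linl k u v w : bop_mul (k *: u + v) w = k *: bop_mul u w + bop_mul v w.
Proof. exact: bop_eq. Qed.

Let linr k u v w : bop_mul w (k *: u + v) = k *: bop_mul w u + bop_mul w v.
Proof. by apply: bop_eq => x; rewrite bopDE bopZE [LHS]bop_linear. Qed.

Let starK u : bop_star (bop_star u) = u.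
Proof. by apply: bop_star_uniq => x y; rewrite bop_starPl. Qed.

Let starM u v : bop_star (bop_mul u v) = bop_mul (bop_star v) (bop_star u).
Proof. by apply: bop_star_uniq => x y; rewrite /= !bop_starP. Qed.

Let star_antilinear k u v : bop_star (k *: u + v) = k^* *: bop_star u + bop_star v.
Proof.
apply: bop_star_uniq => x y.
by rewrite !bopDE !bopZE hdotDl hdotDr hdotZl hdotZr conjCK !bop_starP.
Qed.

Let normM u v : `|bop_mul u v| <= `|u| * `|v|.
Proof. by rewrite !nrmE -realCM lecR opn_mul. Qed.

Let norm_star u : `|bop_mul (bop_star u) u| = `|u| ^+ 2.
Proof. by rewrite !nrmE -rmorphXn; congr real_complex_def; exact: opn_star_mul. Qed.

HB.instance Definition _ := @CompleteNormedModule_isCstar.Build R bop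
  (@bop_mul R H) (@bop_star R H) mulA linl linr starK starM star_antilinear normM norm_star.

Lemma cmul_bopE u v x : cmul u v x = u (v x). Proof. by []. Qed.

Lemma cstar_bopE u : cstar u = bop_star u. Proof. by []. Qed.

End OperatorAlgebra.

(** * Hilbert spaces from an inner product *)

(** Stated through squared norms, so that an instance meets no square root; the norm and its
    triangle inequality are derived in the builder. *)
HB.factory Record Lmodule_isHilbert (R : realType) V & GRing.Lmodule R[i] V := {
  pdot : V -> V -> R[i] ;
  pnorm2 : V -> R ;
  pdot_linearl : forall (k : R[i]) x y z, pdot (k *: x + y) z = k * pdot x z + pdot y z ;
  pdotC : forall x y, pdot x y = (pdot y x)^* ;
  pdotxx : forall x, pdot x x = (pnorm2 x)%:C ;
  pnorm2_ge0 : forall x, 0 <= pnorm2 x ;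
  pnorm2_eq0 : forall x, pnorm2 x = 0 -> x = 0 ;
  pnorm2_complete : forall u : nat -> V,
    (forall e : R, 0 < e -> exists N, forall m n, (N <= m)%N -> (N <= n)%N ->
       pnorm2 (u m - u n) <= e ^+ 2) ->
    exists l, forall e : R, 0 < e -> exists N, forall n, (N <= n)%N ->
       pnorm2 (u n - l) <= e ^+ 2 }.

HB.builders Context R V & Lmodule_isHilbert R V.

Let pn (x : V) : R := Num.sqrt (pnorm2 x).

Let pn_ge0 x : 0 <= pn x. Proof. exact: sqrtr_ge0. Qed.

Let pn_sqr x : pn x ^+ 2 = pnorm2 x. Proof. by rewrite sqr_sqrtr // pnorm2_ge0. Qed.

Let pnD x y : pn (x + y) <= pn x + pn y.
Proof.
rewrite -(@ler_pXn2r _ 2) ?nnegrE ?addr_ge0 ?pn_ge0 // pn_sqr sqrrD !pn_sqr.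
have e : pnorm2 (x + y) = pnorm2 x + complex.Re (pdot x y) *+ 2 + pnorm2 y.
  apply: complexI; rewrite -pdotxx -[x in LHS]scale1r pdot_linearl mul1r !scale1r.
  have dr z : pdot z (x + y) = pdot z x + pdot z y.
    by rewrite pdotC -[x in LHS]scale1r pdot_linearl mul1r rmorphD /= -!pdotC.
  rewrite !dr (pdotC y x) !pdotxx 2!realCD mulr2n realCD -!addrA; congr (_ + _).
  rewrite !addrA; congr (_ + _); have := addcJ (pdot x y).
  by rewrite mulr_natl mulr2n => <-.
rewrite e lerD2r lerD2l lerMn2r /=; apply: le_trans (ler_norm _) _.
apply: le_trans (nrm_Re _) _.
rewrite -(@ler_pXn2r _ 2) ?nnegrE ?mulr_ge0 ?nrm_ge0 // exprMn !pn_sqr.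
exact: pre_cauchy_schwarz pdot_linearl pdotC pdotxx pnorm2_ge0 pnorm2_eq0 x y.
Qed.

Let pnorm2Z k x : pnorm2 (k *: x) = nrm k ^+ 2 * pnorm2 x.
Proof.
apply: complexI; rewrite -pdotxx realCM nrm_sqr -pdotxx.
have z y : pdot 0 y = 0.
  have := pdot_linearl 1 0 0 y.
  by rewrite scaler0 addr0 mul1r -{1}[pdot 0 y]addr0 => /addrI <-.
rewrite -[k *: x]addr0 pdot_linearl z pdotC pdot_linearl z !addr0.
by rewrite rmorphM /= -pdotC mulrA.
Qed.

Let pnZ k x : pn (k *: x) <= nrm k * pn x.
Proof. by rewrite /pn pnorm2Z sqrtrM ?sqr_ge0 // sqrtr_sqr ger0_norm ?nrm_ge0. Qed.

Let pn_eq0 x : pn x = 0 -> x = 0.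
Proof. by move=> h; apply: pnorm2_eq0; rewrite -pn_sqr h expr0n. Qed.

Let pn_le x (e : R) : 0 < e -> (pn x <= e) = (pnorm2 x <= e ^+ 2).
Proof. by move=> e0; rewrite -pn_sqr ler_pXn2r ?nnegrE ?pn_ge0 // ltW. Qed.

Let pn_complete (u : nat -> V) :
  (forall e : R, 0 < e -> exists N, forall m n, (N <= m)%N -> (N <= n)%N ->
     pn (u m - u n) <= e) ->
  exists l, forall e : R, 0 < e -> exists N, forall n, (N <= n)%N -> pn (u n - l) <= e.
Proof.
move=> cu; have /pnorm2_complete[l hl] : forall e : R, 0 < e -> exists N, forall m n,
    (N <= m)%N -> (N <= n)%N -> pnorm2 (u m - u n) <= e ^+ 2.
  by move=> e e0; have [N hN] := cu e e0; exists N => m n Nm Nn; rewrite -pn_le // hN.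
exists l => e e0; have [N hN] := hl e e0.
by exists N => n Nn; rewrite pn_le // hN.
Qed.

HB.instance Definition _ := Lmodule_isBanach.Build R V pnD pnZ pn_eq0 pn_complete.

Let dot_norm (x : V) : pdot x x = `|x| ^+ 2.
Proof. by rewrite pdotxx -pn_sqr rmorphXn. Qed.

HB.instance Definition _ := CompleteNormedModule_isHilbert.Build R V
  pdot_linearl pdotC dot_norm.

HB.end.

(** * Limits of sequences and completeness of the complex numbers *)

Section Tends.
Variable R : realType.

Lemma tends_cst (V : normedZmodType R[i]) (x : V) : tends (fun=> x) x.
Proof. by move=> e e0; exists 0%N => n _; rewrite subrr nrm0 ltW. Qed.

Lemma tendsD (V : normedZmodType R[i]) (u v : nat -> V) x y :
  tends u x -> tends v y -> tends (fun n => u n + v n) (x + y).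
Proof.
move=> ux vy e e0; have e2 : 0 < e / 2 by rewrite divr_gt0.
have [[N hN] [M hM]] := (ux _ e2, vy _ e2); exists (maxn N M) => n.
rewrite geq_max => /andP[/hN h1 /hM h2]; rewrite opprD addrACA.
by apply: le_trans (nrmD _ _) _; rewrite (splitr e) lerD.
Qed.

Lemma tends_sum (V : normedZmodType R[i]) I (s : seq I) (u : I -> nat -> V) (x : I -> V) :
  (forall i, tends (u i) (x i)) -> tends (fun n => \sum_(i <- s) u i n) (\sum_(i <- s) x i).
Proof.
move=> h; elim: s => [|i s IH].
  rewrite big_nil; have := tends_cst (0 : V); congr tends.
  by apply/funext => n; rewrite big_nil.
rewrite big_cons; have := tendsD (h i) IH; congr tends.
by apply/funext => n; rewrite big_cons.
Qed.

Lemma tends_bounded (V : normedZmodType R[i]) (u : nat -> V) x :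
  tends u x -> exists C N, 0 < C /\ forall n, (N <= n)%N -> nrm (u n) <= C.
Proof.
move=> ux; have [N hN] := ux 1 ltr01; exists (nrm x + 1), N.
split=> [|n /hN h]; first by rewrite ltr_wpDl ?nrm_ge0.
by apply: le_trans (nrm_sub_le _ x) _; rewrite lerD2l.
Qed.

Lemma tends_bilin (U V W : normedZmodType R[i]) (m : U -> V -> W) u v x y :
  (forall a b c, m (a - b) c = m a c - m b c) ->
  (forall a b c, m c (a - b) = m c a - m c b) ->
  (forall a b, nrm (m a b) <= nrm a * nrm b) ->
  tends u x -> tends v y -> tends (fun n => m (u n) (v n)) (m x y).
Proof.
move=> ml mr mn ux vy e e0; have [C [N0 [C0 hC]]] := tends_bounded ux.
have y0 : 0 < nrm y + 1 by rewrite ltr_wpDl ?nrm_ge0.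
have C1 : 0 < C + 1 by rewrite ltr_wpDl // ltW.
have e2 : 0 < e / 2 by rewrite divr_gt0.
have [[N hN] [M hM]] := (ux _ (divr_gt0 e2 y0), vy _ (divr_gt0 e2 C1)).
exists (maxn N0 (maxn N M)) => n; rewrite !geq_max => /and3P[/hC h0 /hN h1 /hM h2].
exact: (nrm_bilin_close ml mr mn h0 (lexx _)).
Qed.

Lemma tendsM (u v : nat -> R[i]) x y :
  tends u x -> tends v y -> tends (fun n => u n * v n) (x * y).
Proof.
apply: (@tends_bilin _ _ _ (fun a b => a * b)) => a b.
- by move=> c; rewrite mulrBl.
- by move=> c; rewrite mulrBr.
- by rewrite nrmM.
Qed.

Lemma tends_conj (u : nat -> R[i]) x : tends u x -> tends (fun n => (u n)^*) x^*.
Proof.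
by move=> ux e /ux[N hN]; exists N => n /hN; rewrite -rmorphB nrm_conj.
Qed.

Lemma tends_sub (V : normedZmodType R[i]) (u : nat -> V) (g : nat -> nat) l :
  (forall n, (n <= g n)%N) -> tends u l -> tends (u \o g) l.
Proof. by move=> hg ul e /ul[N hN]; exists N => n Nn; apply: hN; rewrite (leq_trans Nn). Qed.

Lemma complex_complete (u : nat -> R[i]) : cauchy_seq u -> exists l, tends u l.
Proof.
have real (v : nat -> R) : (forall e : R, 0 < e -> exists N, forall m n, (N <= m)%N ->
    (N <= n)%N -> `|v m - v n| <= e) -> exists l, forall e : R, 0 < e -> exists N,
    forall n, (N <= n)%N -> `|v n - l| <= e.
  move=> cv; have /cvg_ex[l vl] : cvg (v @ \oo).
    apply/cauchy_cvgP/cauchy_ballP => e e0.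
    have [N hN] := cv _ (divr_gt0 e0 (ltr0n _ 2)).
    exists (v @` [set n | (N <= n)%N], v @` [set n | (N <= n)%N]).
      by split; exists N => // n /= Nn; exists n.
    move=> [_ _] [/= [m Nm <-] [n Nn <-]]; rewrite -ball_normE /ball_ /=.
    by apply: le_lt_trans (hN _ _ Nm Nn) _; lra.
  exists l => e e0; move/cvgrPdist_le : vl => /(_ _ e0)[N _ hN].
  by exists N => n /hN /=; rewrite distrC.
move=> cu.
have [e /cu[N hN]|a ha] := real (fun n => complex.Re (u n)).
  by exists N => m n Nm Nn; rewrite -raddfB; apply: le_trans (nrm_Re _) (hN _ _ Nm Nn).
have [e /cu[N hN]|b hb] := real (fun n => complex.Im (u n)).
  by exists N => m n Nm Nn; rewrite -raddfB; apply: le_trans (nrm_Im _) (hN _ _ Nm Nn).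
exists (a +i* b) => e e0; have e2 : 0 < e / 2 by rewrite divr_gt0.
have [[N hN] [M hM]] := (ha _ e2, hb _ e2); exists (maxn N M) => n.
rewrite geq_max => /andP[/hN h1 /hM h2]; apply: le_trans (nrm_ReIm _) _.
by rewrite (splitr e); apply: lerD; move: h1 h2; case: (u n).
Qed.

End Tends.

(** * Square-summable sequences *)

Section SquareSummable.
Variable R : realType.
Implicit Types (x y z f g : nat -> R[i]) (C : R).

Definition psum f n : R[i] := \sum_(i < n) f i.
Definition abs_summable f : Prop := exists C, forall n, \sum_(i < n) nrm (f i) <= C.
Definition csum f : R[i] := xget 0 [set l | tends (psum f) l].

Lemma csumP f : abs_summable f -> tends (psum f) (csum f).
Proof.
move=> [C hC]; pose s n := \sum_(i < n) nrm (f i).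
have smon m n : (m <= n)%N -> nrm (psum f n - psum f m) <= s n - s m.
  move=> /subnKC <-; rewrite /psum /s !big_split_ord /=.
  rewrite addrAC subrr add0r [leRHS]addrAC subrr add0r; exact: nrm_sum.
have hs : has_sup (range s).
  by split; [exists (s 0%N), 0%N | exists C => _ [n _ <-]; exact: hC].
suff /complex_complete[l hl] : cauchy_seq (psum f).
  by rewrite /csum; case: xgetP => [l' -> //|/(_ l)].
move=> e e0; have [_ [N _ <-] hN] := sup_adherent e0 hs.
have small m n : (N <= m)%N -> (m <= n)%N -> nrm (psum f n - psum f m) <= e.
  move=> Nm mn; apply: le_trans (smon _ _ mn) _.
  have sn : s n <= sup (range s) by apply: ub_le_sup; [case: hs | exists n].
  have := le_trans (nrm_ge0 _) (smon _ _ Nm); lra.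
exists N => m n Nm Nn; have [mn|/ltnW nm] := leqP m n.
  by rewrite nrmC small.
by rewrite small.
Qed.

Lemma csum_eq f l : tends (psum f) l -> csum f = l.
Proof.
move=> h; rewrite /csum; case: xgetP => [l' -> h'|/(_ l)//].
exact: tends_unique h' h.
Qed.

Lemma psum_linear k f g n : psum (fun i => k * f i + g i) n = k * psum f n + psum g n.
Proof. by rewrite /psum big_split /= mulr_sumr. Qed.

Lemma csum_linear k f g : abs_summable f -> abs_summable g ->
  csum (fun i => k * f i + g i) = k * csum f + csum g.
Proof.
move=> /csumP hf /csumP hg; apply: csum_eq.
have := tendsD (tendsM (tends_cst k) hf) hg; congr tends.
by apply/funext => n; rewrite psum_linear.
Qed.

Lemma csum_conj f : abs_summable f -> csum (fun i => (f i)^*) = (csum f)^*.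
Proof.
move=> /csumP hf; apply: csum_eq; have := tends_conj hf; congr tends.
by apply/funext => n; rewrite /psum rmorph_sum.
Qed.

(** Grouping in blocks passes to the subsequence of partial sums with index n * N; it computes the
    adjoint of the operator that repeats entries. *)
Lemma tends_psum_block N f l : (0 < N)%N -> tends (psum f) l ->
  tends (psum (fun p => \sum_(i < N) f (p * N + i)%N)) l.
Proof.
move=> N0 h; have /(tends_sub _) := h => /(_ (fun n => (n * N)%N)).
move=> h'; suff -> : psum (fun p => \sum_(i < N) f (p * N + i)%N) = psum f \o (muln^~ N).
  by apply: h' => n; rewrite leq_pmulr.
apply/funext => n /=; elim: n => [|n IH]; first by rewrite /psum !big_ord0.
rewrite /psum big_ord_recr /= -/(psum (fun p => \sum_(i < N) f (p * N + i)%N) n) IH.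
by rewrite mulSnr /psum big_split_ord.
Qed.

Definition sqsum x n : R := \sum_(i < n) nrm (x i) ^+ 2.
Definition is_l2 x : bool := `[< exists C, forall n, sqsum x n <= C >].

Lemma is_l2P x C : (forall n, sqsum x n <= C) -> is_l2 x.
Proof. by move=> h; apply/asboolP; exists C. Qed.

Lemma sqsum_ge0 x n : 0 <= sqsum x n.
Proof. by apply: sumr_ge0 => i _; rewrite sqr_ge0. Qed.

Lemma abs_summable_mul x y : is_l2 x -> is_l2 y -> abs_summable (fun i => x i * (y i)^*).
Proof.
move=> /asboolP[C hC] /asboolP[D hD]; exists (C + D) => n.
apply: le_trans (lerD (hC n) (hD n)); rewrite -big_split /=; apply: ler_sum => i _.
rewrite nrmM nrm_conj; have := sqr_ge0 (nrm (x i) - nrm (y i)).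
have := sqr_ge0 (nrm (x i) + nrm (y i)); lra.
Qed.

Lemma l2_closed : submod_closed is_l2.
Proof.
split; first by apply: (@is_l2P _ 0) => n; rewrite /sqsum big1 // => i _; rewrite nrm0 expr0n.
move=> k x y /asboolP[C hC] /asboolP[D hD].
(* The factor 2 comes from (s + t)^2 <= 2 (s^2 + t^2). *)
apply: (@is_l2P _ (2 * (nrm k ^+ 2 * C + D))) => n.
apply: (@le_trans _ _ (2 * (nrm k ^+ 2 * sqsum x n + sqsum y n))); last first.
  by rewrite ler_wpM2l // lerD // ler_wpM2l // sqr_ge0.
rewrite /sqsum mulr_sumr -big_split /= mulr_sumr; apply: ler_sum => i _.
have h := nrmD (k * x i) (y i); rewrite nrmM in h.
apply: (@le_trans _ _ ((nrm k * nrm (x i) + nrm (y i)) ^+ 2)).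
  by rewrite ler_pXn2r ?nnegrE ?addr_ge0 ?mulr_ge0 ?nrm_ge0.
have := sqr_ge0 (nrm k * nrm (x i) - nrm (y i)); rewrite -exprMn; lra.
Qed.

Record l2 := L2 { l2_val :> nat -> R[i] ; _ : is_l2 l2_val }.

HB.instance Definition _ := [isSub for l2_val].
HB.instance Definition _ := [Choice of l2 by <:].
HB.instance Definition _ := GRing.isSubmodClosed.Build R[i] (nat -> R[i]) is_l2 l2_closed.
HB.instance Definition _ := [SubChoice_isSubLmodule of l2 by <:].

Lemma l2DE (x y : l2) n : (x + y) n = x n + y n. Proof. by []. Qed.
Lemma l2ZE k (x : l2) n : (k *: x) n = k * x n. Proof. by []. Qed.

Lemma l2P (x : l2) : is_l2 x. Proof. by case: x. Qed.

Definition l2_dot (x y : l2) : R[i] := csum (fun i => x i * (y i)^*).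
Definition l2_norm2 (x : l2) : R := complex.Re (l2_dot x x).

Lemma l2_dotP (x y : l2) : tends (psum (fun i => x i * (y i)^*)) (l2_dot x y).
Proof. by apply: csumP; apply: abs_summable_mul; exact: l2P. Qed.

Lemma l2_dot_linearl k (x y z : l2) : l2_dot (k *: x + y) z = k * l2_dot x z + l2_dot y z.
Proof.
rewrite /l2_dot -csum_linear; do ?[by apply: abs_summable_mul; exact: l2P].
by congr csum; apply/funext => i; rewrite mulrA -mulrDl.
Qed.

Lemma l2_dotC (x y : l2) : l2_dot x y = (l2_dot y x)^*.
Proof.
rewrite /l2_dot -csum_conj; last by apply: abs_summable_mul; exact: l2P.
by congr csum; apply/funext => i; rewrite rmorphM /= conjCK mulrC.
Qed.

Lemma l2_dotxx (x : l2) : l2_dot x x = (l2_norm2 x)%:C.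
Proof.
have /CrealP : l2_dot x x \is Num.real by rewrite CrealE -l2_dotC.
by move=> h; rewrite /l2_norm2 RRe_real // CrealE -l2_dotC.
Qed.

Lemma psum_sqsum x n : psum (fun i => x i * (x i)^*) n = (sqsum x n)%:C.
Proof. by rewrite /psum /sqsum rmorph_sum /=; apply: eq_bigr => i _; rewrite nrm_sqr. Qed.

Lemma l2_norm2_ub (x : l2) n : sqsum x n <= l2_norm2 x.
Proof.
apply: (@tends_small _ _ (fun m => psum (fun i => x i * (x i)^*) (m + n)%N) (l2_dot x x)
  [set z | sqsum x n <= complex.Re z]).
- move=> z h /=; apply/ler_addgt0Pr => e /h[w /= le].
  have := nrm_Re (z - w); rewrite raddfB /= ler_norml => /andP[+ _]; lra.
- move=> m /=; rewrite psum_sqsum /= addnC /sqsum big_split_ord /= lerDl.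
  by apply: sumr_ge0 => i _; rewrite sqr_ge0.
- move=> e /(l2_dotP x x)[N hN]; exists N => m Nm.
  by apply: hN; rewrite (leq_trans Nm) // leq_addr.
Qed.

Lemma l2_norm2_le (x : l2) C : (forall n, sqsum x n <= C) -> l2_norm2 x <= C.
Proof.
move=> h; apply: (@tends_small _ _ _ _ [set z | complex.Re z <= C] _ _ (l2_dotP x x)).
- move=> z h' /=; apply/ler_addgt0Pr => e /h'[w /= le].
  have := nrm_Re (z - w); rewrite raddfB /= ler_norml => /andP[_]; lra.
- by move=> m /=; rewrite psum_sqsum /=; exact: h.
Qed.

Lemma l2_norm2_ge0 (x : l2) : 0 <= l2_norm2 x.
Proof. by apply: le_trans (l2_norm2_ub x 0); rewrite sqsum_ge0. Qed.

Lemma l2_coord (x : l2) i : nrm (x i) ^+ 2 <= l2_norm2 x.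
Proof.
apply: le_trans (l2_norm2_ub x i.+1); rewrite /sqsum big_ord_recr /= lerDr.
exact: (sqsum_ge0 x i).
Qed.

Lemma l2_norm2_eq0 (x : l2) : l2_norm2 x = 0 -> x = 0.
Proof.
move=> x0; apply/val_inj/funext => i; apply: nrm_eq0; apply/eqP.
by rewrite -sqrf_eq0 eq_le sqr_ge0 andbT -x0 l2_coord.
Qed.

Lemma l2_complete (u : nat -> l2) :
  (forall e : R, 0 < e -> exists N, forall m n, (N <= m)%N -> (N <= n)%N ->
     l2_norm2 (u m - u n) <= e ^+ 2) ->
  exists l, forall e : R, 0 < e -> exists N, forall n, (N <= n)%N ->
     l2_norm2 (u n - l) <= e ^+ 2.
Proof.
move=> cu; have h i : exists l, tends (fun n => u n i) l.
  apply: complex_complete => e e0; have [N hN] := cu e e0; exists N => m n Nm Nn.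
  rewrite -(@ler_pXn2r _ 2) ?nnegrE ?nrm_ge0 ?(ltW e0) //.
  by apply: le_trans (hN _ _ Nm Nn); apply: (l2_coord (u m - u n)).
have {h}[w hw] := choice h.
(* For fixed [p] only finitely many coordinates occur, so the Cauchy estimate passes to the limit in
   the second index, uniformly in [p]. *)
have close e : 0 < e -> exists N, forall n p, (N <= n)%N ->
    sqsum (fun i => u n i - w i) p <= e ^+ 2.
  move=> e0; have [N hN] := cu e e0; exists N => n p Nn.
  pose f i := fun m => u n i - u (m + N)%N i.
  have hf i : tends (f i) (u n i - w i) by exact: tends_sub_shift (hw i).
  have ht : tends (fun m => psum (fun i => f i m * (f i m)^*) p)
      (psum (fun i => (u n i - w i) * (u n i - w i)^*) p).
    by apply: tends_sum => i; apply: tendsM => //; apply: tends_conj.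
  rewrite -lecR -psum_sqsum.
  (* Being below a real number in [R[i]] includes having imaginary part 0, and both conditions must
     survive the limit. *)
  apply: (@tends_small _ _ _ _ [set z : R[i] | z <= (e ^+ 2)%:C] _ _ ht).
    move=> z hz /=; have zi : complex.Im z = 0.
      apply/eqP; rewrite -normr_eq0 eq_le normr_ge0 andbT; apply/ler_addgt0Pr => d.
      move=> /hz[y /= + zy]; rewrite lecE /= => /andP[/eqP y0 _].
      by rewrite add0r; have := nrm_Im (z - y); rewrite raddfB /= -y0 subr0; lra.
    rewrite lecE /= zi eqxx /=; apply/ler_addgt0Pr => d /hz[y /= + zy].
    rewrite lecE /= => /andP[_ ye].
    have := nrm_Re (z - y); rewrite raddfB /= ler_norml => /andP[_]; lra.
  move=> m /=; rewrite psum_sqsum lecR; apply: le_trans (hN n (m + N)%N Nn (leq_addl _ _)).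
  exact: (l2_norm2_ub (u n - u (m + N)%N)).
have [N /(_ N _ (leqnn N)) hN] := close 1 ltr01.
have wl2 : is_l2 w.
  have -> : w = (u N : nat -> R[i]) - (fun i => u N i - w i) :> (nat -> R[i]).
    by apply/funext => i; rewrite /= opprB addrC subrK.
  by apply: rpredB; [exact: l2P | exact: is_l2P hN].
exists (L2 wl2) => e e0; have [M hM] := close e e0.
by exists M => n Mn; apply: l2_norm2_le => p; exact: hM.
Qed.

HB.instance Definition _ := Lmodule_isHilbert.Build R l2
  l2_dot_linearl l2_dotC l2_dotxx l2_norm2_ge0 l2_norm2_eq0 l2_complete.

Lemma l2_hdotE (x y : l2) : hdot x y = l2_dot x y. Proof. by []. Qed.

Lemma l2_nrm (x : l2) : nrm x ^+ 2 = l2_norm2 x.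
Proof. by apply: complexI; rewrite -hdotxx l2_hdotE l2_dotxx. Qed.

Lemma l2_nrm_le (x : l2) C : 0 <= C -> (forall n, sqsum x n <= C ^+ 2) -> nrm x <= C.
Proof.
move=> C0 h; rewrite -(@ler_pXn2r _ 2) ?nnegrE ?nrm_ge0 // l2_nrm.
exact: l2_norm2_le.
Qed.

End SquareSummable.

(** * Colimits of split endomorphisms *)

Section Colimit.
Variables (R : realType) (A : cstarType R).

(** Models rho x = S x S^* with the compression x |-> S^* x S, which is linear, star-preserving and
    contractive but not multiplicative. *)
Record split_endo := SplitEndo {
  endo : A -> A ;
  retr : A -> A ;
  endo_hom : star_hom endo ;
  retr_linear : forall (k : R[i]) x y, retr (k *: x + y) = k *: retr x + retr y ;
  retr_star : forall x, retr (cstar x) = cstar (retr x) ;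
  retr_norm : forall x, nrm (retr x) <= nrm x ;
  endoK : forall x, retr (endo x) = x }.

Variable r : split_endo.
Local Notation rho := (endo r).
Local Notation kappa := (retr r).
Implicit Types (u v w : nat -> A) (x y : A).

Lemma retr0 : kappa 0 = 0.
Proof.
have := retr_linear r 1 0 0; rewrite !scale1r addr0 -{1}[kappa 0]addr0.
by move/addrI.
Qed.

Lemma retrB x y : kappa (x - y) = kappa x - kappa y.
Proof. by rewrite addrC -scaleN1r retr_linear scaleN1r addrC. Qed.

Lemma endo_norm x : nrm (rho x) = nrm x.
Proof.
apply/eqP; rewrite eq_le (star_hom_norm _ (endo_hom r)) /=.
by rewrite -{1}(endoK r x) retr_norm.
Qed.

Lemma iter_endo_hom n : star_hom (iter n rho).
Proof.
elim: n => [|n [h1 h2 h3]]; first by [].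
by split=> [k x y|x y|x] /=; rewrite ?h1 ?h2 ?h3 ?(homM (endo_hom r)) ?(homS (endo_hom r))
  ?(homD (endo_hom r)) ?(homZ (endo_hom r)).
Qed.

Lemma iter_endo_norm n x : nrm (iter n rho x) = nrm x.
Proof. by elim: n => [//|n IH]; rewrite /= endo_norm. Qed.

Lemma iter_retr_norm n x : nrm (iter n kappa x) <= nrm x.
Proof. by elim: n => [//|n IH]; rewrite /=; apply: le_trans (retr_norm _ _) IH. Qed.

Lemma iter_retrB n x y : iter n kappa (x - y) = iter n kappa x - iter n kappa y.
Proof. by elim: n => [//|n IH]; rewrite /= IH retrB. Qed.

Lemma iter_endoK n x : iter n kappa (iter n rho x) = x.
Proof. by elim: n x => [//|n IH] x; rewrite iterSr /= endoK IH. Qed.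

(** Modulo null sequences these are the elements of the colimit; uniformity in [k] is what makes
    their images under a cocone a Cauchy sequence. *)
Definition asymptotic u : Prop := forall e : R, 0 < e ->
  exists N, forall n k, (N <= n)%N -> nrm (u (n + k)%N - iter k rho (u n)) <= e.

Definition asyeq u v : Prop := forall e : R, 0 < e ->
  exists N, forall n, (N <= n)%N -> nrm (u n - v n) <= e.

(** Selects one representative of each asymptotic orbit modulo null sequences. *)
Definition compressed u : Prop := forall n, kappa (u n.+1) = u n.

Lemma asyeq_sym u v : asyeq u v -> asyeq v u.
Proof. by move=> h e /h[N hN]; exists N => n /hN; rewrite nrmC. Qed.

Lemma asyeq_trans v u w : asyeq u v -> asyeq v w -> asyeq u w.
Proof.
move=> uv vw e e0; have e2 : 0 < e / 2 by rewrite divr_gt0.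
have [[N hN] [M hM]] := (uv _ e2, vw _ e2); exists (maxn N M) => n.
rewrite geq_max => /andP[/hN h1 /hM h2].
exact: (@nrm_split _ _ (v n)).
Qed.

Lemma asyeq_refl u : asyeq u u.
Proof. by move=> e e0; exists 0%N => n _; rewrite subrr nrm0 ltW. Qed.

Lemma asyeq_linear k u u' v v' : asyeq u u' -> asyeq v v' ->
  asyeq (fun n => k *: u n + v n) (fun n => k *: u' n + v' n).
Proof.
move=> uu vv e e0; have k0 : 0 < nrm k + 1 by rewrite ltr_wpDl ?nrm_ge0.
have e2 : 0 < e / 2 by rewrite divr_gt0.
have [[N hN] [M hM]] := (uu _ (divr_gt0 e2 k0), vv _ e2); exists (maxn N M) => n.
rewrite geq_max => /andP[/hN h1 /hM h2].
exact: nrm_linear_close.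
Qed.

Lemma asyeq_star u v : asyeq u v -> asyeq (fun n => cstar (u n)) (fun n => cstar (v n)).
Proof. by move=> h e /h[N hN]; exists N => n /hN; rewrite -cstarB nrm_cstar. Qed.

Definition bounded_seq u : Prop := exists C : R, forall n, nrm (u n) <= C.

Lemma asyeq_mul u u' v v' : bounded_seq u -> bounded_seq v' -> asyeq u u' -> asyeq v v' ->
  asyeq (fun n => cmul (u n) (v n)) (fun n => cmul (u' n) (v' n)).
Proof.
move=> [C hC] [D hD] uu vv e e0; have e2 : 0 < e / 2 by rewrite divr_gt0.
have C0 : 0 < C + 1 by rewrite ltr_wpDl // (le_trans (nrm_ge0 (u 0%N))).
have D0 : 0 < D + 1 by rewrite ltr_wpDl // (le_trans (nrm_ge0 (v' 0%N))).
have [[N hN] [M hM]] := (uu _ (divr_gt0 e2 D0), vv _ (divr_gt0 e2 C0)).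
exists (maxn N M) => n; rewrite geq_max => /andP[/hN h1 /hM h2].
exact: (nrm_bilin_close (@cmulBl _ A) (@cmulBr _ A) (@nrm_cmul _ A) (hC n) (hD n)).
Qed.

(** As [kappa] is contractive, norms increase along a compressed sequence, so eventual bounds hold
    from the start. *)
Lemma compressed_le u n k : compressed u -> nrm (u n) <= nrm (u (n + k)%N).
Proof.
move=> cu; elim: k => [|k IH]; first by rewrite addn0.
by apply: le_trans IH _; rewrite addnS -[u (n + k)%N]cu retr_norm.
Qed.

Lemma compressed_small u C : compressed u ->
  (forall e : R, 0 < e -> exists N, forall n, (N <= n)%N -> nrm (u n) <= C + e) ->
  forall n, nrm (u n) <= C.
Proof.
move=> cu h n; apply/ler_addgt0Pr => e /h[N hN].
by apply: le_trans (compressed_le n N cu) _; apply: hN; rewrite leq_addl.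
Qed.

Lemma compressed_asyeq_le u w C : compressed u -> asyeq u w ->
  (exists N, forall n, (N <= n)%N -> nrm (w n) <= C) -> forall n, nrm (u n) <= C.
Proof.
move=> cu uw [M hM]; apply: compressed_small => // e /uw[N hN].
exists (maxn N M) => n; rewrite geq_max => /andP[/hN h1 /hM h2].
by apply: le_trans (nrm_sub_le _ (w n)) _; rewrite lerD.
Qed.

Lemma compressed_linear k u v : compressed u -> compressed v ->
  compressed (fun n => k *: u n + v n).
Proof. by move=> cu cv n; rewrite retr_linear cu cv. Qed.

Lemma compressed_uniq u v : compressed u -> compressed v -> asyeq u v -> u = v.
Proof.
move=> cu cv uv; apply/funext => n; apply/esym/eqP; rewrite -subr_eq0; apply/eqP/nrm_eq0/eqP.
rewrite eq_le nrm_ge0 andbT -scaleN1r.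
have := @compressed_asyeq_le (fun n => (-1) *: u n + v n) (fun=> 0) 0.
rewrite [v n + _]addrC; apply; [exact: compressed_linear| |by exists 0%N => *; rewrite nrm0].
move=> e /uv[N hN]; exists N => m /hN; rewrite subr0 scaleN1r nrmC.
by rewrite [- _ + _]addrC.
Qed.

Lemma asymptotic_bounded u : asymptotic u -> exists C N, forall n, (N <= n)%N -> nrm (u n) <= C.
Proof.
move=> au; have [N hN] := au 1 ltr01; exists (nrm (u N) + 1), N => n /subnKC <-.
apply: le_trans (nrm_sub_le _ (iter (n - N) rho (u N))) _.
by rewrite iter_endo_norm lerD2l hN.
Qed.

Lemma asymptotic_asyeq u v : asyeq u v -> asymptotic v -> asymptotic u.
Proof.
move=> uv av e e0; have e3 : 0 < e / 3 by rewrite divr_gt0.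
have [[N hN] [M hM]] := (uv _ e3, av _ e3); exists (maxn N M) => n k.
rewrite geq_max => /andP[h1 /(hM _ k) h2].
have h3 := hN _ h1; have h4 := hN _ (leq_trans h1 (leq_addr k n)).
apply: le_trans (nrm_tri (v (n + k)%N) _ _) _.
have -> : e = e / 3 + (e / 3 + e / 3) by lra.
apply: lerD => //; apply: le_trans (nrm_tri (iter k rho (v n)) _ _) _.
apply: lerD => //; rewrite -(homB (iter_endo_hom k)) iter_endo_norm.
by rewrite nrmC.
Qed.

Lemma asymptotic_linear k u v : asymptotic u -> asymptotic v ->
  asymptotic (fun n => k *: u n + v n).
Proof.
move=> uu vv e e0; have k0 : 0 < nrm k + 1 by rewrite ltr_wpDl ?nrm_ge0.
have e2 : 0 < e / 2 by rewrite divr_gt0.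
have [[N hN] [M hM]] := (uu _ (divr_gt0 e2 k0), vv _ e2); exists (maxn N M) => n j.
rewrite geq_max => /andP[/(hN _ j) h1 /(hM _ j) h2].
rewrite (homD (iter_endo_hom j)) (homZ (iter_endo_hom j)).
exact: nrm_linear_close.
Qed.

Lemma asymptotic_star u : asymptotic u -> asymptotic (fun n => cstar (u n)).
Proof.
move=> uu e /uu[N hN]; exists N => n k /(hN _ k).
by rewrite (homS (iter_endo_hom k)) -cstarB nrm_cstar.
Qed.

Lemma asymptotic_mul u v : asymptotic u -> asymptotic v ->
  asymptotic (fun n => cmul (u n) (v n)).
Proof.
move=> uu vv e e0; have e2 : 0 < e / 2 by rewrite divr_gt0.
have [C [N1 hC]] := asymptotic_bounded uu; have [D [N2 hD]] := asymptotic_bounded vv.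
have C0 : 0 < C + 1 by rewrite ltr_wpDl // (le_trans (nrm_ge0 (u N1))) ?hC.
have D0 : 0 < D + 1 by rewrite ltr_wpDl // (le_trans (nrm_ge0 (v N2))) ?hD.
have [[N hN] [M hM]] := (uu _ (divr_gt0 e2 D0), vv _ (divr_gt0 e2 C0)).
exists (maxn (maxn N1 N2) (maxn N M)) => n k; rewrite !geq_max.
move=> /andP[/andP[n1 n2] /andP[/(hN _ k) h1 /(hM _ k) h2]].
rewrite (homM (iter_endo_hom k)).
apply: (nrm_bilin_close (@cmulBl _ A) (@cmulBr _ A) (@nrm_cmul _ A) (C := C) (D := D)) => //.
  by rewrite hC // (leq_trans n1) // leq_addr.
by rewrite iter_endo_norm hD.
Qed.

(** Takes v_n = lim_k kappa^k u_(n+k). Since kappa^k u_(n+k) = kappa^(k+j) rho^j u_(n+k), the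
    increments are controlled by the defect u_(n+k+j) - rho^j u_(n+k), which is small for an
    asymptotic orbit. *)
Lemma compression u : asymptotic u -> exists v, compressed v /\ asyeq v u.
Proof.
move=> au; have close n k j : nrm (iter (k + j) kappa (u (n + (k + j))%N) -
    iter k kappa (u (n + k)%N)) <= nrm (u (n + k + j)%N - iter j rho (u (n + k)%N)).
  have -> : iter k kappa (u (n + k)%N) =
      iter (k + j) kappa (iter j rho (u (n + k)%N)) by rewrite iterD iter_endoK.
  by rewrite -iter_retrB addnA iter_retr_norm.
have h n : exists l, tends (fun k => iter k kappa (u (n + k)%N)) l.
  apply: complete_cauchy_seq => e e0; have [N hN] := au _ e0.
  have le k j : (N <= k)%N -> (k <= j)%N ->
      nrm (iter j kappa (u (n + j)%N) - iter k kappa (u (n + k)%N)) <= e.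
    move=> Nk /subnKC <-; apply: le_trans (close _ _ _) _; apply: hN.
    by rewrite (leq_trans Nk) // leq_addl.
  exists N => i j Ni Nj; have [ij|/ltnW ji] := leqP i j; last exact: le.
  by rewrite nrmC; apply: le.
have {h}[v hv] := choice h; exists v; split=> [n|e e0].
  have lip x y : nrm (kappa x - kappa y) <= 1 * nrm (x - y).
    by rewrite mul1r -retrB retr_norm.
  apply: (tends_unique (tends_lipschitz lip (hv n.+1))).
  have := tends_sub (g := S) _ (hv n) => /(_ (fun n => leqnSn n)); congr tends.
  by apply/funext => k /=; rewrite addSnnS.
have [N hN] := au _ e0; exists N => n Nn.
(* Every term of the sequence defining v_n is compared with the term k = 0, which is u_n. *)
apply: (@tends_norm _ _ (fun k => iter k kappa (u (n + k)%N) - u n)).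
  by move=> k; have := close n 0%N k; rewrite add0n !addn0 /= => /le_trans; apply; apply: hN.
exact: (tendsD (hv n) (tends_cst (- u n))).
Qed.

Definition in_clim u : bool := `[< compressed u /\ asymptotic u >].

Lemma in_climP u : compressed u -> asymptotic u -> in_clim u.
Proof. by move=> h1 h2; apply/asboolP. Qed.

Lemma clim_closed : submod_closed in_clim.
Proof.
split.
  apply: in_climP => [n|]; first exact: retr0.
  by move=> e e0; exists 0%N => n k _; rewrite (hom0 (iter_endo_hom k)) subrr nrm0 ltW.
move=> k u v /asboolP[cu au] /asboolP[cv av]; apply: in_climP.
  exact: compressed_linear.
exact: asymptotic_linear.
Qed.

Record clim := Clim { clim_val :> nat -> A ; _ : in_clim clim_val }.
HB.instance Definition _ := [isSub for clim_val].
HB.instance Definition _ := [Choice of clim by <:].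
HB.instance Definition _ := GRing.isSubmodClosed.Build R[i] (nat -> A) in_clim clim_closed.
HB.instance Definition _ := [SubChoice_isSubLmodule of clim by <:].

Lemma clim_compressed (u : clim) : compressed u.
Proof. by case: u => u h; move/asboolP: (h) => []. Qed.

Lemma clim_asymptotic (u : clim) : asymptotic u.
Proof. by case: u => u h; move/asboolP: (h) => []. Qed.

Lemma clim_bounded (u : clim) : bounded_seq u.
Proof.
have [C [N hC]] := asymptotic_bounded (@clim_asymptotic u); exists C => n.
by apply: le_trans (compressed_le n N (@clim_compressed u)) (hC _ (leq_addl _ _)).
Qed.

Lemma clim_eq (u v : clim) : asyeq u v -> u = v.
Proof.
by move=> uv; apply/val_inj/compressed_uniq => //; exact: clim_compressed.
Qed.

Lemma clim_of u : asymptotic u -> exists v : clim, asyeq v u.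
Proof.
move=> au; have [v [cv vu]] := compression au.
by exists (Clim (in_climP cv (asymptotic_asyeq vu au))).
Qed.

Definition cnorm (u : clim) : R := sup (range (fun n => nrm (u n))).

Lemma cnorm_ub (u : clim) n : nrm (u n) <= cnorm u.
Proof.
have [C hC] := clim_bounded u.
by apply: ub_le_sup; [exists C => _ [m _ <-] | exists n].
Qed.

Lemma cnorm_le (u : clim) C : (forall n, nrm (u n) <= C) -> cnorm u <= C.
Proof.
by move=> h; apply: ge_sup; [exists (nrm (u 0%N)), 0%N | move=> _ [n _ <-]].
Qed.

Lemma cnorm_ge0 (u : clim) : 0 <= cnorm u.
Proof. exact: le_trans (nrm_ge0 (u 0%N)) (cnorm_ub u 0). Qed.

Lemma cnormD (u v : clim) : cnorm (u + v) <= cnorm u + cnorm v.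
Proof.
apply: cnorm_le => n; apply: le_trans (nrmD _ _) _.
by apply: lerD; exact: cnorm_ub.
Qed.

Lemma cnormZ_le k (u : clim) : cnorm (k *: u) <= nrm k * cnorm u.
Proof. by apply: cnorm_le => n; rewrite nrmZ ler_wpM2l ?nrm_ge0 ?cnorm_ub. Qed.

Lemma cnorm_eq0 (u : clim) : cnorm u = 0 -> u = 0.
Proof.
move=> u0; apply/val_inj/funext => n; apply: nrm_eq0; apply/eqP.
by rewrite eq_le nrm_ge0 andbT -u0 cnorm_ub.
Qed.

Lemma cnorm_complete (u : nat -> clim) :
  (forall e : R, 0 < e -> exists N, forall m n, (N <= m)%N -> (N <= n)%N ->
     cnorm (u m - u n) <= e) ->
  exists l, forall e : R, 0 < e -> exists N, forall n, (N <= n)%N -> cnorm (u n - l) <= e.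
Proof.
move=> cu; have h i : exists l, tends (fun n => u n i) l.
  apply: complete_cauchy_seq => e /cu[N hN]; exists N => m n Nm Nn.
  by apply: le_trans (hN _ _ Nm Nn); exact: (cnorm_ub (u m - u n)).
have {h}[w hw] := choice h.
have close e : 0 < e -> exists N, forall n i, (N <= n)%N -> nrm (u n i - w i) <= e.
  move=> /cu[N hN]; exists N => n i Nn.
  apply: (@tends_norm _ _ (fun m => u n i - u (m + N)%N i)).
    move=> m; apply: le_trans (hN n (m + N)%N Nn (leq_addl _ _)).
    exact: (cnorm_ub (u n - u (m + N)%N)).
  exact: tends_sub_shift (hw i).
have cw : compressed w.
  move=> n; have lip x y : nrm (kappa x - kappa y) <= 1 * nrm (x - y).
    by rewrite mul1r -retrB retr_norm.
  apply: (tends_unique (tends_lipschitz lip (hw n.+1))).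
  have := hw n; congr tends; apply/funext => m /=.
  by rewrite clim_compressed.
have aw : asymptotic w.
  move=> e e0; have e3 : 0 < e / 3 by rewrite divr_gt0.
  have [N /(_ N _ (leqnn N)) hN] := close _ e3.
  have [M hM] := @clim_asymptotic (u N) _ e3; exists M => n k Mn.
  apply: le_trans (nrm_tri (u N (n + k)%N) _ _) _.
  have -> : e = e / 3 + (e / 3 + e / 3) by lra.
  apply: lerD; first by rewrite nrmC.
  apply: le_trans (nrm_tri (iter k rho (u N n)) _ _) _.
  by apply: lerD; rewrite ?hM // -(homB (iter_endo_hom k)) iter_endo_norm.
exists (Clim (in_climP cw aw)) => e /close[N hN]; exists N => n Nn.
by apply: cnorm_le => i; exact: hN.
Qed.

HB.instance Definition _ := Lmodule_isBanach.Build R clim cnormD cnormZ_le cnorm_eq0 cnorm_complete.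

(** [kappa] is not multiplicative, so the pointwise product is only an asymptotic orbit and has to
    be compressed; the star needs no such correction. *)
Definition clim_mul (u v : clim) : clim :=
  projT1 (cid (clim_of (asymptotic_mul (@clim_asymptotic u) (@clim_asymptotic v)))).

Lemma clim_mulP (u v : clim) : asyeq (clim_mul u v) (fun n => cmul (u n) (v n)).
Proof. by rewrite /clim_mul; case: cid. Qed.

Lemma clim_star_subproof (u : clim) : in_clim (fun n => cstar (u n)).
Proof.
apply: in_climP => [n|]; first by rewrite retr_star clim_compressed.
exact/asymptotic_star/clim_asymptotic.
Qed.

Definition clim_star (u : clim) : clim := Clim (clim_star_subproof u).

Lemma clim_mulA (u v w : clim) : clim_mul u (clim_mul v w) = clim_mul (clim_mul u v) w.
Proof.
apply: clim_eq; apply: asyeq_trans (clim_mulP _ _) _.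
have bd (s t : clim) : bounded_seq (fun n => cmul (s n) (t n)).
  have [[C hC] [D hD]] := (clim_bounded s, clim_bounded t); exists (C * D) => n.
  by apply: le_trans (nrm_cmul _ _) _; apply: ler_pM; rewrite ?nrm_ge0.
apply: asyeq_trans (asyeq_mul (clim_bounded u) (bd v w) (asyeq_refl _) (clim_mulP v w)) _.
apply: asyeq_trans (asyeq_sym (clim_mulP _ _)).
apply: asyeq_sym.
have := asyeq_mul (clim_bounded (clim_mul u v)) (clim_bounded w) (clim_mulP u v) (asyeq_refl w).
congr asyeq; apply/funext => n; exact/esym/cmulA.
Qed.

Lemma clim_linl k (u v w : clim) : clim_mul (k *: u + v) w = k *: clim_mul u w + clim_mul v w.
Proof.
apply: clim_eq; apply: asyeq_trans (clim_mulP _ _) _; apply: asyeq_sym.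
have := asyeq_linear k (clim_mulP u w) (clim_mulP v w).
by congr asyeq; apply/funext => n; rewrite -cmul_linearl.
Qed.

Lemma clim_linr k (u v w : clim) : clim_mul w (k *: u + v) = k *: clim_mul w u + clim_mul w v.
Proof.
apply: clim_eq; apply: asyeq_trans (clim_mulP _ _) _; apply: asyeq_sym.
have := asyeq_linear k (clim_mulP w u) (clim_mulP w v).
by congr asyeq; apply/funext => n; rewrite -cmul_linearr.
Qed.

Lemma clim_starK (u : clim) : clim_star (clim_star u) = u.
Proof. by apply/val_inj/funext => n; exact: cstarK. Qed.

Lemma clim_starM (u v : clim) : clim_star (clim_mul u v) = clim_mul (clim_star v) (clim_star u).
Proof.
apply: clim_eq; apply: asyeq_trans (asyeq_sym (clim_mulP _ _)).
have := asyeq_star (clim_mulP u v).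
by congr asyeq; apply/funext => n; exact: cstarM.
Qed.

Lemma clim_star_antilinear k (u v : clim) :
  clim_star (k *: u + v) = k^* *: clim_star u + clim_star v.
Proof. by apply/val_inj/funext => n; exact: cstar_antilinear. Qed.

Lemma nrm_clim (u : clim) : nrm u = cnorm u. Proof. by []. Qed.

Lemma cnorm_asyeq (u : clim) w C : asyeq u w ->
  (exists N, forall n, (N <= n)%N -> nrm (w n) <= C) -> cnorm u <= C.
Proof.
by move=> uw h; apply/cnorm_le/(compressed_asyeq_le _ uw h)/clim_compressed.
Qed.

Lemma clim_normM (u v : clim) : `|clim_mul u v| <= `|u| * `|v|.
Proof.
rewrite !nrmE -realCM lecR !nrm_clim; apply: cnorm_asyeq (clim_mulP u v) _.
exists 0%N => n _; apply: le_trans (nrm_cmul _ _) _.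
by apply: ler_pM; rewrite ?nrm_ge0 ?cnorm_ub.
Qed.

Lemma clim_norm_star (u : clim) : `|clim_mul (clim_star u) u| = `|u| ^+ 2.
Proof.
rewrite !nrmE -rmorphXn; congr real_complex_def; rewrite !nrm_clim.
set m := clim_mul _ _; apply/eqP; rewrite eq_le; apply/andP; split.
  apply: cnorm_asyeq (clim_mulP _ _) _; exists 0%N => n _.
  by rewrite nrm_cstar_mul ler_pXn2r ?nnegrE ?nrm_ge0 ?cnorm_ge0 ?cnorm_ub.
suff h : cnorm u <= Num.sqrt (cnorm m).
  by rewrite -(sqr_sqrtr (cnorm_ge0 m)) ler_pXn2r ?nnegrE ?cnorm_ge0 ?sqrtr_ge0.
apply: cnorm_le => n; rewrite -(@ler_pXn2r _ 2) ?nnegrE ?nrm_ge0 ?sqrtr_ge0 //.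
rewrite sqr_sqrtr ?cnorm_ge0 //; apply/ler_addgt0Pr => e.
move=> /(clim_mulP (clim_star u) u)[N hN].
(* Norms increase, and at index n + N the representative of the product is e-close to the pointwise
   product, where the C*-identity of [A] applies. *)
apply: (@le_trans _ _ (nrm (u (n + N)%N) ^+ 2)).
  rewrite ler_pXn2r ?nnegrE ?nrm_ge0 //.
  exact: compressed_le (@clim_compressed u).
rewrite -nrm_cstar_mul; apply: le_trans (nrm_sub_le _ (m (n + N)%N)) _.
by rewrite lerD ?cnorm_ub // nrmC hN // leq_addl.
Qed.

HB.instance Definition _ := CompleteNormedModule_isCstar.Build R clim
  clim_mulA clim_linl clim_linr clim_starK clim_starM clim_star_antilinear
  clim_normM clim_norm_star.

(** For n < m truncated subtraction leaves x itself; only large n matter. *)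
Lemma asymptotic_orbit m x : asymptotic (fun n => iter (n - m) rho x).
Proof.
move=> e e0; exists m => n k mn; rewrite -iterD addnC -addnBA //.
by rewrite subrr nrm0 ltW.
Qed.

Definition clim_in m x : clim := projT1 (cid (clim_of (asymptotic_orbit m x))).

Lemma clim_inP m x : asyeq (clim_in m x) (fun n => iter (n - m) rho x).
Proof. by rewrite /clim_in; case: cid. Qed.

Lemma clim_in_cocone : cocone rho clim_in.
Proof.
have bd m x : bounded_seq (fun n => iter (n - m) rho x).
  by exists (nrm x) => n; rewrite iter_endo_norm.
split=> [m|m x].
  split=> [k x y|x y|x]; apply: clim_eq; apply: asyeq_trans (clim_inP _ _) _; apply: asyeq_sym.
  - have := asyeq_linear k (clim_inP m x) (clim_inP m y); congr asyeq.
    by apply/funext => n; case: (iter_endo_hom (n - m)) => ->.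
  - apply: asyeq_trans (clim_mulP _ _) _.
    have := asyeq_mul (clim_bounded (clim_in m x)) (bd m y) (clim_inP m x) (clim_inP m y).
    by congr asyeq; apply/funext => n; case: (iter_endo_hom (n - m)) => _ ->.
  - have := asyeq_star (clim_inP m x); congr asyeq.
    by apply/funext => n; case: (iter_endo_hom (n - m)) => _ _ ->.
apply: clim_eq; apply: asyeq_trans (clim_inP _ _) _; apply: asyeq_sym.
apply: asyeq_trans (clim_inP _ _) _ => e e0; exists m.+1 => n mn.
by rewrite -iterSr -subSn // subSS subrr nrm0 ltW.
Qed.

Lemma cocone_iter (D : cstarType R) (h : nat -> A -> D) n k x :
  cocone rho h -> h (n + k)%N (iter k rho x) = h n x.
Proof.
move=> [_ hr]; elim: k => [|k IH]; first by rewrite addn0.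
by rewrite addnS /= hr.
Qed.

(** Density of the images of [A], the source of uniqueness in the universal property. *)
Lemma clim_in_close (u : clim) : tends (fun n => clim_in n (u n)) u.
Proof.
move=> e /(@clim_asymptotic u)[N hN]; exists N => n Nn; rewrite nrm_clim.
apply: (@cnorm_asyeq _ (fun m => iter (m - n) rho (u n) - u m)).
  have := asyeq_linear (-1) (asyeq_refl u) (clim_inP n (u n)).
  by congr asyeq; apply/funext => m; rewrite scaleN1r addrC.
by exists n => m /subnKC <-; rewrite addKn nrmC hN.
Qed.

(** The induced map is f u = lim_n h_n(u_n): the cocone identity turns h_m(u_m) - h_n(u_n) into
    h_m(u_m - rho^(m-n) u_n), and every h_m is contractive. *)
Lemma clim_is_colim : is_colim rho clim_in.
Proof.
split=> [|D h ch]; first exact: clim_in_cocone.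
have hh := ch.1.
have hB n x y : h n x - h n y = h n (x - y) by rewrite (homB (hh n)).
have hlim (u : clim) : exists l, tends (fun n => h n (u n)) l.
  apply: complete_cauchy_seq => e /(@clim_asymptotic u)[N hN].
  have le n m : (N <= n)%N -> (n <= m)%N -> nrm (h m (u m) - h n (u n)) <= e.
    move=> Nn /subnKC <-; rewrite -(cocone_iter n (m - n) (u n) ch) hB.
    by apply: le_trans (star_hom_norm _ (hh _)) _; apply: hN.
  exists N => m n Nm Nn; have [mn|/ltnW nm] := leqP m n; last exact: le.
  by rewrite nrmC le.
have [f hf] := choice hlim.
(* Any asymptotically equal sequence computes the same limit; this is needed because products and
   orbits are known only up to null sequences. *)
have hasy (u : clim) w : asyeq u w -> tends (fun n => h n (w n)) (f u).
  move=> uw e e0; have e2 : 0 < e / 2 by rewrite divr_gt0.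
  have [[N hN] [M hM]] := (hf u _ e2, uw _ e2); exists (maxn N M) => n.
  rewrite geq_max => /andP[/hN h1 /hM h2].
  apply: (@nrm_split _ _ (h n (u n))) => //.
  by rewrite nrmC hB; apply: le_trans (star_hom_norm _ (hh _)) _.
have f_hom : star_hom f.
  split=> [k u v|u v|u].
  - apply: (tends_unique (hf _)).
    have nz (a : R[i]) (b : D) : nrm (a *: b) <= nrm a * nrm b by rewrite nrmZ.
    have sl (a b : R[i]) (c : D) : (a - b) *: c = a *: c - b *: c by rewrite scalerBl.
    have sr (a b : D) (c : R[i]) : c *: (a - b) = c *: a - c *: b by rewrite scalerBr.
    have := tendsD (tends_bilin (m := fun (a : R[i]) (b : D) => a *: b)
      sl sr nz (tends_cst k) (hf u)) (hf v).
    by congr tends; apply/funext => n; case: (hh n) => <-.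
  - apply: (tends_unique (hasy _ _ (clim_mulP u v))).
    have := tends_bilin (m := @cmul R D) (@cmulBl _ D) (@cmulBr _ D) (@nrm_cmul _ D) (hf u) (hf v).
    by congr tends; apply/funext => n; case: (hh n) => _ <-.
  - apply: (tends_unique (hf _)) => e /(hf u)[N hN]; exists N => n /hN.
    by rewrite (homS (hh n)) -cstarB nrm_cstar.
exists f; split; [split=> // n x|move=> f' [f'_hom f'_in]].
  apply: (tends_unique (hasy _ _ (clim_inP n x))) => e e0; exists n => m /subnKC <-.
  by rewrite addKn cocone_iter // subrr nrm0 ltW.
apply/funext => u; apply: (tends_unique (hf u)).
have lip (x y : clim) : nrm (f' x - f' y) <= 1 * nrm (x - y).
  by rewrite -(homB f'_hom) mul1r star_hom_norm.
have := tends_lipschitz lip (clim_in_close u); congr tends; apply/funext => n /=.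
by rewrite f'_in.
Qed.

Lemma split_endo_colim_nonzero : (exists x : A, x <> 0) -> colim_nonzero rho.
Proof.
move=> [x x0]; exists clim, clim_in; split; first exact: clim_is_colim.
exists (clim_in 0 x) => h; apply: x0; apply: nrm_small => e e0.
have [N hN] := clim_inP 0 x e0; have := hN N (leqnn N).
by rewrite h sub0r nrmN iter_endo_norm.
Qed.

End Colimit.

(** * Topology of the torus *)

Section TorusTopology.
Variables (R : realType) (d : nat).
Local Notation X := (torus R d).

Lemma nbhs_set_type (T : topologicalType) (S : set T) (x : S) (U : set S) :
  nbhs x U <-> exists2 V, nbhs (\val x) V & forall y : S, V (\val y) -> U y.
Proof.
split=> [|[V]].
  move=> [_ [[V oV <-] Vx VU]]; exists V; last by move=> y Vy; apply: VU.
  by apply: open_nbhs_nbhs; split.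
rewrite nbhsE => -[W [oW Wx] WV] VU.
by exists (set_val @^-1` W); split; [exists W | | move=> y /WV/VU].
Qed.

Lemma nbhs_row (z : 'rV[R[i]]_d) (V : set 'rV[R[i]]_d) :
  nbhs z V <-> exists2 e : R, 0 < e & forall w : 'rV[R[i]]_d, (forall j, nrm (z 0 j - w 0 j) < e) -> V w.
Proof.
split=> [/nbhs_ballP[_ /pos_complex[e e0 ->] h]|[e e0 h]].
  exists e => // w zw; apply: h; split; first by rewrite ltcR.
  by move=> i j; rewrite (ord1 i); apply/(@ball_nrm R R[i]); exact: zw.
apply/nbhs_ballP; exists e%:C; first by rewrite /= ltcR.
move=> w [_ zw]; apply: h => j; exact/(@ball_nrm R R[i])/zw.
Qed.

Definition crd (x : X) (j : 'I_d) : R[i] := (\val x : 'rV__) 0 j.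

Lemma nbhs_torus (x : X) (U : set X) :
  nbhs x U <-> exists2 e : R, 0 < e & forall y, (forall j, nrm (crd x j - crd y j) < e) -> U y.
Proof.
split=> [/nbhs_set_type[V /nbhs_row[e e0 h] VU]|[e e0 h]].
  by exists e => // y xy; apply/VU/h.
apply/nbhs_set_type; exists [set w : 'rV__ | forall j, nrm (crd x j - w 0 j) < e]; last by [].
by apply/nbhs_row; exists e.
Qed.

Lemma continuous_nrm (T : topologicalType) (f : T -> R[i]) :
  continuous f <-> forall x (e : R), 0 < e -> nbhs x [set y | nrm (f x - f y) < e].
Proof.
split=> [cf x e e0|h x V /(@nbhs_nrm R R[i])[e e0 hV]].
  by apply: (cf x [set w | nrm (f x - w) < e]); apply/(@nbhs_nrm R R[i]); exists e.
by apply: filterS (h x e e0) => y; exact: hV.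
Qed.

Lemma torus_continuousP (f : X -> R[i]) :
  continuous f <-> forall x (e : R), 0 < e -> exists2 c : R, 0 < c &
    forall y, (forall j, nrm (crd x j - crd y j) < c) -> nrm (f x - f y) < e.
Proof.
split=> [/continuous_nrm cf x e /(cf x)/nbhs_torus//|h].
by apply/continuous_nrm => x e /(h x)h'; apply/nbhs_torus.
Qed.

Lemma crd1 (x : X) j : nrm (crd x j) = 1.
Proof.
have /(_ j) h : torus R d (\val x) by exact: set_valP.
by rewrite /crd /nrm h.
Qed.

Lemma torus_eq (x y : X) : (forall j, crd x j = crd y j) -> x = y.
Proof. by move=> h; apply/val_inj/rowP => j; exact: h. Qed.

Lemma crd_ex (z : 'I_d -> R[i]) : (forall j, nrm (z j) = 1) -> exists x : X, forall j, crd x j = z j.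
Proof.
move=> h; have p : \row_j z j \in torus R d.
  by rewrite inE => j; rewrite mxE nrmE h.
by exists (exist _ (\row_j z j) p) => j; rewrite /crd /= mxE.
Qed.

Section Omega.
Variables F G : 'M[int]_d.
Local Notation E := (Omega R F G).

Lemma omega_continuousP (f : E -> R[i]) :
  continuous f <-> forall p (e : R), 0 < e -> exists2 c : R, 0 < c & forall q : E,
    (forall j, nrm (crd (\val p).1 j - crd (\val q).1 j) < c) ->
    (forall j, nrm (crd (\val p).2 j - crd (\val q).2 j) < c) -> nrm (f p - f q) < e.
Proof.
split=> [/continuous_nrm cf p e /(cf p)/nbhs_set_type[V Vp h]|h].
  case: Vp => -[P Q] /= [/nbhs_torus[a a0 hP] /nbhs_torus[b b0 hQ]] PQ.
  exists (Num.min a b); first by rewrite lt_min a0.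
  move=> q h1 h2; apply: (h q); apply: PQ; split => /=.
    by apply: hP => j; apply: lt_le_trans (h1 j) _; rewrite ge_min lexx.
  by apply: hQ => j; apply: lt_le_trans (h2 j) _; rewrite ge_min lexx orbT.
apply/continuous_nrm => p e /(h p)[c c0 hc]; apply/nbhs_set_type.
exists ([set y | forall j, nrm (crd (\val p).1 j - crd y j) < c] `*`
        [set y | forall j, nrm (crd (\val p).2 j - crd y j) < c]).
  by exists ([set y | forall j, nrm (crd (\val p).1 j - crd y j) < c],
          [set y | forall j, nrm (crd (\val p).2 j - crd y j) < c]) => //=;
    split; apply/nbhs_torus; exists c.
by move=> q [h1 h2]; exact: hc.
Qed.

End Omega.

Lemma circle_compact : compact [set z : R[i] | `|z| = 1].
Proof.
(* The circle is a closed subset of the image of the square [-1, 1]^2, whose compactness is known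
   for real row vectors. *)
pose K := [set v : 'rV[R]_2 | forall i, `[-1, 1]%classic (v ord0 i)].
have cK : compact K.
  by apply: (@rV_compact R 2 (fun=> `[(-1 : R), 1]%classic)) => i; exact: segment_compact.
pose g (v : 'rV[R]_2) : R[i] := v 0 0 +i* v 0 1.
have cg : continuous g.
  apply/continuous_nrm => v e e0; have e2 : 0 < e / 2 by rewrite divr_gt0.
  apply/nbhs_ballP; exists (e / 2) => // w [_ vw] /=.
  apply: le_lt_trans (nrm_ReIm _) _; rewrite (splitr e).
  have := vw 0 0; have := vw 0 1; rewrite -!ball_normE /ball_ /= => h1 h0.
  exact: ltrD.
have cgK : compact (g @` K) by apply: continuous_compact => //; exact: continuous_subspaceT.
apply: subclosed_compact cgK _.
  apply/(@closed_nrm R R[i]) => x h /=; rewrite nrmE; congr real_complex_def.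
  apply/eqP; rewrite -subr_eq0 -normr_eq0 eq_le normr_ge0 andbT.
  apply/ler_addgt0Pr => e /h[y /= y1 xy]; rewrite add0r; apply: le_trans xy.
  have ny : nrm y = 1 by rewrite /nrm y1.
  have := nrm_sub_le y x; have := nrm_sub_le x y; rewrite (nrmC y) ny ler_norml; lra.
move=> z z1; have nz : nrm z = 1 by rewrite /nrm z1.
exists (\row_i (if i == 0 then complex.Re z else complex.Im z)); last first.
  by rewrite /g !mxE /=; case: (z).
move=> i /=; rewrite mxE in_itv /= -ler_norml.
by case: ifP => _; rewrite -nz ?nrm_Re ?nrm_Im.
Qed.

(** Compactness passes from the subset of row vectors to the subtype by pushing filters forward
    along the inclusion. *)
Lemma torus_compact : compact [set: X].
Proof.
have cT : compact (torus R d).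
  apply: (@rV_compact R[i] d (fun=> [set z : R[i] | `|z| = 1])) => i; exact: circle_compact.
move=> F PF _; pose v (x : X) : 'rV[R[i]]_d := \val x.
have FT : (v @ F) (torus R d).
  rewrite (_ : (v @ F) _ = F setT); first exact: filterT.
  by congr F; apply/seteqP; split=> x _ //=; exact: (set_valP x).
have [z [Tz cz]] := cT (v @ F) _ FT.
exists (exist _ z (mem_set Tz)); split=> // U V FU /nbhs_set_type[W Wz WV].
have vU : (v @ F) (v @` U) by apply: (@filterS _ F _ U) => [y Uy|//]; exists y.
have [_ [[y Uy <-] Wy]] := cz _ W vU Wz.
by exists y; split => //; apply: WV.
Qed.

Lemma torus_bounded (f : X -> R[i]) : continuous f -> exists C : R, forall x, nrm (f x) <= C.
Proof.
move=> /continuous_nrm cf; have /compact_near_coveringP ck := torus_compact.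
have [|C [_ hC]] := ck R +oo (fun C x => nrm (f x) <= C) _.
  move=> x _; exists ([set y | nrm (f x - f y) < 1], [set C | nrm (f x) + 1 <= C]).
    by split; [exact: cf | by apply: nbhs_pinfty_ge; rewrite num_real].
  move=> [y C] [/= xy hC]; apply: le_trans hC; apply: le_trans (nrm_sub_le _ (f x)) _.
  by rewrite lerD2l nrmC ltW.
by exists (C + 1) => x; apply: hC => //; rewrite ltrDl.
Qed.

(** Nearby points are handled by uniform continuity at scale c, distant ones by 2 B = (2 B / c^2)
    c^2. The quadratic form is chosen because [fejer_tail] bounds the second moment of the Fejer
    kernel. *)
Lemma torus_modulus (f : X -> R[i]) (e : R) : continuous f -> 0 < e -> exists C : R,
  0 <= C /\ forall x y, nrm (f x - f y) <= e + C * \sum_j nrm (crd x j - crd y j) ^+ 2.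
Proof.
move=> cf e0; have [B hB] := torus_bounded cf.
move/torus_continuousP : cf => cf.
have /compact_near_coveringP ck := torus_compact.
have e2 : 0 < e / 2 by rewrite divr_gt0.
have [c c0 hc] : exists2 c : R, 0 < c & forall x y, (forall j, nrm (crd x j - crd y j) < c) ->
    nrm (f x - f y) <= e.
  have := ck R 0^'+ (fun c x => forall y, (forall j, nrm (crd x j - crd y j) < c) ->
    nrm (f x - f y) <= e) _.
  case=> [x _|c /= c0 hc].
    have [c c0 hc] := cf x _ e2; have c2 : 0 < c / 2 by rewrite divr_gt0.
    exists ([set y | forall j, nrm (crd x j - crd y j) < c / 2], [set b | b < c / 2]).
      split; first by apply/nbhs_torus; exists (c / 2).
      exact: nbhs_right_lt.
    move=> [y b] [/= xy bc] z yz; apply: le_trans (nrm_tri (f x) _ _) _.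
    rewrite (splitr e) lerD //; [rewrite nrmC|]; apply/ltW/hc => j.
      by apply: lt_trans (xy j) _; rewrite ltr_pdivrMr // ltr_pMr // ltr1n.
    apply: le_lt_trans (nrm_tri (crd y j) _ _) _; rewrite (splitr c).
    by rewrite ltrD // (lt_trans (yz j)).
  exists (c / 2); first by rewrite divr_gt0.
  move=> x; apply: (hc (c / 2)) => //=; last by rewrite divr_gt0.
  rewrite sub0r normrN ger0_norm ?divr_ge0 ?ltW //.
  by rewrite ltr_pdivrMr // ltr_pMr // ltr1n.
have B0 : 0 <= 2 * B.
  have [x _] := crd_ex (fun=> nrm1 R); rewrite mulr_ge0 //.
  exact: le_trans (nrm_ge0 _) (hB x).
exists (2 * B / c ^+ 2); split; first by rewrite divr_ge0 // sqr_ge0.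
move=> x y; have [xy|] := pselect (forall j, nrm (crd x j - crd y j) < c).
  apply: le_trans (hc _ _ xy) _; rewrite lerDl mulr_ge0 ?divr_ge0 ?sqr_ge0 //.
  by apply: sumr_ge0 => j _; rewrite sqr_ge0.
move=> /existsNP[j /negP]; rewrite -leNgt => xy.
apply: (@le_trans _ _ (2 * B)).
  by apply: le_trans (nrmB _ _) _; have := hB x; have := hB y; lra.
apply: (@le_trans _ _ (2 * B / c ^+ 2 * c ^+ 2)).
  by rewrite divfK // sqrf_eq0 gt_eqF.
apply: (@le_trans _ _ (2 * B / c ^+ 2 * \sum_j nrm (crd x j - crd y j) ^+ 2)); last first.
  by rewrite lerDr ltW.
apply: ler_wpM2l; first by rewrite divr_ge0 // sqr_ge0.
rewrite (bigD1 j) //=; apply: (@le_trans _ _ (nrm (crd x j - crd y j) ^+ 2)).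
  by rewrite ler_pXn2r ?nnegrE ?nrm_ge0 // ltW.
by rewrite lerDl; apply: sumr_ge0 => i _; rewrite sqr_ge0.
Qed.

End TorusTopology.

(** * Roots of unity and Fejer means *)

Section RootsOfUnity.
Variable R : realType.
Local Notation C := R[i].

(** X^n - 1 splits over the closed field [R[i]] and is separable, so it has n distinct roots; among
    n distinct n-th roots of unity one is primitive. *)
Lemma prim_root_exists n : (0 < n)%N -> exists z : C, n.-primitive_root z.
Proof.
move=> n0; pose p : {poly C} := 'X^n - 1.
have [r Dp] := closed_field_poly_normal p.
rewrite (monicP _) ?monicXnsubC // scale1r in Dp.
have rn1 : all n.-unity_root r by apply/allP => z; rewrite -root_prod_XsubC -Dp.
have sz_r : (n < (size r).+1)%N by rewrite -(size_prod_XsubC r id) -Dp size_XnsubC.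
have [|z] := hasP (cyclic.has_prim_root n0 rn1 _ sz_r); last by exists z.
by rewrite -separable.separable_prod_XsubC -Dp cyclotomic.separable_Xn_sub_1 // pnatr_eq0 -lt0n.
Qed.

Definition zeta n : C := xget 1 [set z | n.-primitive_root z].

Lemma zetaP n : (0 < n)%N -> n.-primitive_root (zeta n).
Proof. by move=> /prim_root_exists[z hz]; rewrite /zeta; case: xgetP => [//|/(_ z)]. Qed.

Lemma nrm_root (z : C) n : (0 < n)%N -> nrm (z ^+ n) = 1 -> nrm z = 1.
Proof.
by move=> n0; rewrite nrmX => /eqP; rewrite pexpr_eq1 ?nrm_ge0 // => /eqP.
Qed.

Lemma zeta_pow n : (0 < n)%N -> zeta n ^+ n = 1.
Proof. by move=> /zetaP/prim_expr_order. Qed.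

Lemma nrm_zeta n : (0 < n)%N -> nrm (zeta n) = 1.
Proof. by move=> n0; apply: (nrm_root n0); rewrite zeta_pow // nrm1. Qed.

Lemma nrm_zetaX n k : (0 < n)%N -> nrm (zeta n ^+ k) = 1.
Proof. by move=> n0; rewrite nrmX nrm_zeta // expr1n. Qed.

Lemma sum_root (z : C) n : z ^+ n = 1 -> z != 1 -> \sum_(k < n) z ^+ k = 0.
Proof.
move=> zn z1; have := subrX1 z n; rewrite zn subrr => /esym/eqP.
by rewrite mulf_eq0 subr_eq0 (negPf z1) => /eqP.
Qed.

(** Orthogonality of characters, with [w] the inverse of [z]; the bounds on [k] and [l] exclude
    exponents that agree only modulo [n]. *)
Lemma sum_prim_root (z w : C) n k l : n.-primitive_root z -> z * w = 1 ->
  (k < n)%N -> (l < n)%N -> \sum_(i < n) (w ^+ k * z ^+ l) ^+ i = (if k == l then n%:R else 0).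
Proof.
move=> pz zw kn ln; have [<-|kl] := eqVneq k l.
  rewrite -exprMn [w * z]mulrC zw (eq_bigr (fun=> 1)); last by move=> i _; rewrite !expr1n.
  by rewrite sumr_const card_ord.
apply: sum_root.
  rewrite exprMn -!exprM ![(_ * n)%N]mulnC !exprM (prim_expr_order pz) expr1n mulr1.
  have -> : w ^+ n = 1.
    by rewrite -[LHS]mul1r -{1}(prim_expr_order pz) -exprMn zw expr1n.
  by rewrite expr1n.
apply: contraNneq kl => h; have : z ^+ l = z ^+ k.
  by rewrite -[LHS]mul1r -(expr1n _ k) -{1}zw exprMn -mulrA h mulr1.
by move/eqP; rewrite (eq_prim_root_expr pz) !modn_small // eq_sym.
Qed.

End RootsOfUnity.

Section Fejer.
Variable R : realType.
Local Notation C := R[i].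

(** The Fejer kernel as a normalised squared geometric sum, which makes positivity immediate. *)
Definition fejer n (w : C) : R := n%:R^-1 * nrm (\sum_(k < n) w ^+ k) ^+ 2.

Lemma fejer_ge0 n w : 0 <= fejer n w.
Proof. by rewrite mulr_ge0 ?invr_ge0 ?ler0n ?sqr_ge0. Qed.

(** The geometric sum telescopes against 1 - w to 1 - w^n, of modulus at most 2. *)
Lemma fejer_tail n (w : C) : (0 < n)%N -> nrm w = 1 -> fejer n w * nrm (1 - w) ^+ 2 <= 4 / n%:R.
Proof.
move=> n0 w1; rewrite /fejer -mulrA [leRHS]mulrC ler_pM2l ?invr_gt0 ?ltr0n //.
rewrite -exprMn mulrC -nrmM.
have -> : (1 - w) * (\sum_(k < n) w ^+ k) = 1 - w ^+ n.
  by rewrite -[RHS]opprB subrX1 -mulNr opprB.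
have -> : (4 : R) = 2 ^+ 2 by rewrite expr2 -natrM.
rewrite ler_pXn2r ?nnegrE ?nrm_ge0 ?ler0n //; apply: le_trans (nrmB _ _) _.
by rewrite nrm1 nrmX w1 expr1n.
Qed.

(** Expanding the square gives frequencies k - l with k, l < n; summing over all n-th roots of unity
    kills all but the diagonal, so a discrete sum replaces the integral exactly. *)
Lemma fejer_sum n (y z : C) : n.-primitive_root z -> nrm y = 1 -> nrm z = 1 ->
  \sum_(i < n) fejer n (y * (z ^+ i)^*) = n%:R.
Proof.
move=> pz y1 z1; have n0 := prim_order_gt0 pz.
rewrite -mulr_sumr; apply: (mulfI (_ : (n%:R : R) != 0)); first by rewrite pnatr_eq0 -lt0n.
rewrite mulrA divff ?pnatr_eq0 -?lt0n // mul1r; apply: complexI.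
rewrite rmorph_sum /= realCM !rmorph_nat.
have zz : z * z^* = 1 by rewrite nrm1_conjV.
have yy : y * y^* = 1 by rewrite nrm1_conjV.
under eq_bigr => i _.
  rewrite nrm_sqr [X in _ * X]rmorph_sum mulr_suml.
  under eq_bigr => k _ do rewrite mulr_sumr.
  over.
rewrite exchange_big /=; under eq_bigr => k _ do rewrite exchange_big /=.
transitivity (\sum_(k < n) (n%:R : C)); last by rewrite sumr_const card_ord [RHS]mulr_natr.
apply: eq_bigr => k _.
transitivity (\sum_(l < n) y ^+ k * y^* ^+ l * (if k == l :> nat then n%:R else 0)).
  apply: eq_bigr => l _.
  rewrite -(sum_prim_root pz zz (ltn_ord k) (ltn_ord l)) mulr_sumr; apply: eq_bigr => i _.
  rewrite !rmorphXn /= rmorphM /= rmorphXn /= conjCK !exprMn -!exprM.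
  rewrite (mulnC k) (mulnC l); ring.
rewrite (bigD1 k) //= eqxx big1 ?addr0; first by rewrite -exprMn yy expr1n mul1r.
by move=> l lk; rewrite eq_sym (negPf lk : (l == k :> nat) = false) mulr0.
Qed.

End Fejer.

(** * Density of trigonometric polynomials in C(T^d) *)

Section TrigDensity.
Variables (R : realType) (d : nat).
Local Notation X := (torus R d).

(** An inductive closure instead of explicit coefficients: it provides the induction by which the
    gauge action is seen to fix [pi f]. *)
Inductive trig : (X -> R[i]) -> Prop :=
| trig_cst c : trig (fun=> c)
| trig_crd j : trig (fun x => crd x j)
| trig_conj f : trig f -> trig (fun x => (f x)^*)
| trig_add f g : trig f -> trig g -> trig (fun x => f x + g x)
| trig_mul f g : trig f -> trig g -> trig (fun x => f x * g x).

Lemma trig_sum I (s : seq I) (f : I -> X -> R[i]) :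
  (forall i, trig (f i)) -> trig (fun x => \sum_(i <- s) f i x).
Proof.
move=> h; elim: s => [|i s IH].
  rewrite (_ : (fun _ => _) = fun=> 0); first exact: trig_cst.
  by apply/funext => x; rewrite big_nil.
rewrite (_ : (fun _ => _) = fun x => f i x + \sum_(i <- s) f i x); first exact: trig_add.
by apply/funext => x; rewrite big_cons.
Qed.

Lemma trig_prod I (s : seq I) (f : I -> X -> R[i]) :
  (forall i, trig (f i)) -> trig (fun x => \prod_(i <- s) f i x).
Proof.
move=> h; elim: s => [|i s IH].
  rewrite (_ : (fun _ => _) = fun=> 1); first exact: trig_cst.
  by apply/funext => x; rewrite big_nil.
rewrite (_ : (fun _ => _) = fun x => f i x * \prod_(i <- s) f i x); first exact: trig_mul.
by apply/funext => x; rewrite big_cons.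
Qed.

Lemma trig_exp f n : trig f -> trig (fun x => f x ^+ n).
Proof.
move=> tf; elim: n => [|n IH]; first exact: trig_cst.
rewrite (_ : (fun _ => _) = fun x => f x * f x ^+ n); first exact: trig_mul.
by apply/funext => x; rewrite exprS.
Qed.

Lemma trig_fejer n (c : R[i]) j : trig (fun x => (fejer n (crd x j * c))%:C).
Proof.
rewrite (_ : (fun _ => _) = fun x => (n%:R^-1) * ((\sum_(k < n) (crd x j * c) ^+ k) *
  (\sum_(k < n) (crd x j * c) ^+ k)^*)).
  have ts : trig (fun x => \sum_(k < n) (crd x j * c) ^+ k).
    apply: trig_sum => k; apply: trig_exp.
    by apply: trig_mul; [exact: trig_crd | exact: trig_cst].
  by apply: trig_mul; [exact: trig_cst | apply: trig_mul => //; exact: trig_conj].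
by apply/funext => x; rewrite /fejer realCM nrm_sqr fmorphV rmorph_nat.
Qed.

(* Discrete Fejer means over the group of n-th roots of unity: both the total
   mass and the concentration of the kernel are exact finite sums. *)
Lemma trig_dense (f : X -> R[i]) (e : R) : continuous f -> 0 < e ->
  exists2 g, trig g & forall x, nrm (f x - g x) <= e.
Proof.
move=> cf e0; have e2 : 0 < e / 2 by rewrite divr_gt0.
have [B [B0 hB]] := torus_modulus cf e2.
have D0 : 0 < 4 * B * d%:R + 1 by rewrite ltr_wpDl // !mulr_ge0.
(* n is taken so large that the tail 4 B d / n is at most e / 2. *)
have [N /(_ N (leqnn N)) hN] := archi_inv (divr_gt0 e2 D0).
set n := N.+1 in hN *; have n0 : (0 < n)%N by [].
have pz := zetaP R n0; set z := zeta R n in pz.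
have z1 i : nrm (z ^+ i) = 1 by exact: nrm_zetaX.
pose I := {ffun 'I_d -> 'I_n}.
have /choice[node hnode] : forall w : I, exists y : X, forall j, crd y j = z ^+ w j.
  by move=> w; apply: (@crd_ex R d (fun j => z ^+ w j)) => j; exact: z1.
pose K x (w : I) : R := \prod_j fejer n (crd x j * (z ^+ w j)^*).
have K0 x w : 0 <= K x w by apply: prodr_ge0 => j _; exact: fejer_ge0.
have sumK x : \sum_w K x w = n%:R ^+ d.
  rewrite -(bigA_distr_bigA (fun j (k : 'I_n) => fejer n (crd x j * (z ^+ k)^*))).
  rewrite -[d in RHS]card_ord -prodr_const; apply: eq_bigr => j _.
  by apply: fejer_sum => //; rewrite ?crd1 // -[z]expr1.
have tail x j : \sum_w K x w * nrm (crd x j - crd (node w) j) ^+ 2 <= n%:R ^+ d * (4 / n%:R).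
  (* Bounding the j-th factor times the squared distance by 4 / n leaves 1 in its place; its n terms
     sum to n, like the mass of a genuine Fejer factor. *)
  pose G i (k : 'I_n) := if i == j then 1 else fejer n (crd x i * (z ^+ k)^*).
  apply: (@le_trans _ _ (\sum_(w : I) (\prod_i G i (w i)) * (4 / n%:R))).
    apply: ler_sum => w _; rewrite /K (bigD1 j) //= [X in _ <= X * _](bigD1 j) //=.
    rewrite {1}/G eqxx mul1r mulrAC mulrC.
    rewrite (eq_bigr (fun i => G i (w i))); last by move=> i /negPf ij; rewrite /G ij.
    apply: ler_wpM2l.
      by apply: prodr_ge0 => i _; rewrite /G; case: ifP => // _; exact: fejer_ge0.
    have -> : nrm (crd x j - crd (node w) j) = nrm (1 - crd x j * (z ^+ w j)^*).
      rewrite hnode nrmC -[nrm (1 - _)]mul1r -(z1 (w j)) -nrmM mulrBr mulr1.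
      by rewrite mulrCA nrm1_conjV ?z1 // mulr1.
    by apply: fejer_tail; rewrite // nrmM nrm_conj z1 crd1 mulr1.
  rewrite -mulr_suml -(bigA_distr_bigA G) ler_wpM2r ?divr_ge0 //.
  rewrite -[d in leRHS]card_ord -prodr_const le_eqVlt; apply/orP; left; apply/eqP.
  apply: eq_bigr => i _; rewrite /G; case: eqP => _; first by rewrite sumr_const card_ord.
  by apply: fejer_sum => //; rewrite ?crd1 // -[z]expr1.
have nd0 : 0 < n%:R ^+ d :> R by rewrite exprn_gt0 ?ltr0n.
exists (fun x => ((n%:R ^+ d)^-1 : R)%:C * \sum_w f (node w) * (K x w)%:C).
  apply: trig_mul; first exact: trig_cst.
  apply: trig_sum => w; apply: trig_mul; first exact: trig_cst.
  rewrite (_ : (fun _ => _) = fun x => \prod_j (fejer n (crd x j * (z ^+ w j)^*))%:C).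
    by apply: trig_prod => j; exact: trig_fejer.
  by apply/funext => x; rewrite /K rmorph_prod.
(* Writing [f x] with the same kernel of total mass n^d turns the error into a weighted mean of f x
   - f y over the nodes y. *)
move=> x; have -> : f x = ((n%:R ^+ d)^-1 : R)%:C * \sum_w f x * (K x w)%:C.
  by rewrite -mulr_sumr -rmorph_sum sumK /= mulrCA -realCM mulVf ?gt_eqF // mulr1.
rewrite -mulrBr -sumrB nrmM nrmR ger0_norm ?invr_ge0 ?(ltW nd0) //.
rewrite ler_pdivrMl //; apply: le_trans (nrm_sum _ _ _) _.
apply: (@le_trans _ _ (\sum_w (K x w * (e / 2) +
   B * \sum_j K x w * nrm (crd x j - crd (node w) j) ^+ 2))).
  apply: ler_sum => w _; rewrite -mulrBl nrmM nrmR ger0_norm ?K0 // mulrC.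
  by rewrite -mulr_sumr [B * _]mulrCA -mulrDr ler_wpM2l.
rewrite big_split /= -mulr_suml sumK -mulr_sumr exchange_big /=.
rewrite {2}(splitr e) mulrDr lerD2l.
apply: (@le_trans _ _ (B * \sum_(j < d) n%:R ^+ d * (4 / n%:R))).
  by apply: ler_wpM2l => //; apply: ler_sum => j _; exact: tail.
rewrite sumr_const card_ord -[_ *+ d]mulr_natr.
have -> : B * (n%:R ^+ d * (4 / n%:R) * d%:R) = n%:R ^+ d * ((4 * B * d%:R) * n%:R^-1) by ring.
rewrite ler_pM2l //; apply: le_trans (ler_wpM2l _ hN) _; first by rewrite !mulr_ge0.
by rewrite mulrA ler_pdivrMr // mulrC ler_wpM2l ?(ltW e2) // lerDl.
Qed.

End TrigDensity.

(** * Fibres and the finite Fourier expansion *)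

Section ContinuousAlgebra.
Variables (R : realType) (T : topologicalType).
Implicit Types f g : T -> R[i].

Lemma continuous_cst (c : R[i]) : continuous (fun _ : T => c).
Proof. by move=> x; exact: cvg_cst. Qed.

Lemma continuous_add f g : continuous f -> continuous g -> continuous (fun x => f x + g x).
Proof. by move=> cf cg x; exact: (cvgD (cf x) (cg x)). Qed.

Lemma continuous_mul f g : continuous f -> continuous g -> continuous (fun x => f x * g x).
Proof. by move=> cf cg x; exact: (cvgM (cf x) (cg x)). Qed.

Lemma continuous_conj f : continuous f -> continuous (fun x => (f x)^*).
Proof.
move=> /continuous_nrm cf; apply/continuous_nrm => x e e0.
by apply: filterS (cf x e e0) => y /=; rewrite -rmorphB nrm_conj.
Qed.

Lemma continuous_bigsum I (s : seq I) (P : pred I) (f : I -> T -> R[i]) :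
  (forall i, continuous (f i)) -> continuous (fun x => \sum_(i <- s | P i) f i x).
Proof.
move=> cf; elim: s => [|i s IH].
  rewrite (_ : (fun _ => _) = fun=> 0); first exact: continuous_cst.
  by apply/funext => x; rewrite big_nil.
rewrite (_ : (fun _ => _) = fun x => (if P i then f i x else 0) + \sum_(i <- s | P i) f i x).
  apply: continuous_add; last exact: IH.
  by case: (P i); [exact: cf | exact: continuous_cst].
by apply/funext => x; rewrite big_cons; case: (P i); rewrite ?add0r.
Qed.

End ContinuousAlgebra.

Lemma finite_min (R : realType) (I : finType) (P : I -> R -> Prop) :
  (forall i c c', 0 < c' <= c -> P i c -> P i c') ->
  (forall i, exists2 c, 0 < c & P i c) -> exists2 c : R, 0 < c & forall i, P i c.
Proof.
move=> mono h; have /choice[c hc'] : forall i, exists c, 0 < c /\ P i c.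
  by move=> i; have [c] := h i; exists c.
have c0 i := (hc' i).1; have hc i := (hc' i).2.
(* The seed 1 keeps the minimum positive when [I] is empty. *)
exists (\big[Num.min/1]_i c i); first by elim/big_ind: _ => // x y x0 y0; rewrite lt_min x0.
move=> i; apply: mono (hc i); rewrite bigmin_le_cond // andbT.
by elim/big_ind: _ => // x y x0 y0; rewrite lt_min x0.
Qed.

Section Roots.
Variable R : realType.
Local Notation C := R[i].

Lemma nrm1_neq0 (z : C) : nrm z = 1 -> z != 0.
Proof. by move=> z1; apply/eqP => z0; move/eqP: z1; rewrite z0 nrm0 eq_sym oner_eq0. Qed.

(** The n-th roots y of c satisfy prod |y - y0| = |c - y0^n|, so the closest of them has |y - y0|^n
    <= |c - c0|. This replaces continuous branches of the root. *)
Lemma root_near n (y0 c0 c : C) : (0 < n)%N -> nrm c = 1 -> y0 ^+ n = c0 ->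
  exists2 y, y ^+ n = c & nrm (y - y0) ^+ n <= nrm (c - c0).
Proof.
move=> n0 c1 y0c; have pz := zetaP R n0; set z := zeta R n in pz.
pose t := n.-root c; have tn : t ^+ n = c by rewrite /t rootCK.
have t1 : nrm t = 1 by apply: (nrm_root n0); rewrite tn.
have t0 := nrm1_neq0 t1.
have prodE : \prod_(i < n) nrm (t * z ^+ i - y0) = nrm (c - c0).
  have := congr1 (fun p => p.[y0 / t]) (factor_Xn_sub_1 pz).
  rewrite !hornerE horner_prod big_mkord => h.
  have {}h : \prod_(i < n) nrm (y0 / t - z ^+ i) = nrm (y0 ^+ n / c - 1).
    rewrite -tn -expr_div_n.
    have <- := h; rewrite (big_morph (@nrm R C) (@nrmM R) (nrm1 R)).
    by apply: eq_bigr => i _; rewrite !hornerE.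
  have cV : nrm (y0 ^+ n / c - 1) = nrm (c - c0).
    rewrite -[LHS]mul1r -c1 -nrmM mulrBr mulr1 mulrCA divff ?mulr1 ?y0c 1?nrmC //.
    by rewrite -tn expf_neq0.
  rewrite -cV -h; apply: eq_bigr => i _.
  by rewrite -[RHS]mul1r -t1 -nrmM mulrBr mulrCA divff // mulr1 nrmC.
have [i _ imin] := @arg_minP _ _ _ (Ordinal n0) xpredT (fun i : 'I_n => nrm (t * z ^+ i - y0)) isT.
exists (t * z ^+ i); first by rewrite exprMn tn exprAC (prim_expr_order pz) expr1n mulr1.
rewrite -prodE -{2}[n]card_ord -prodr_const; apply: ler_prod => k _.
by rewrite nrm_ge0 imin.
Qed.

End Roots.

Section Monomials.
Variables (R : realType) (d : nat).
Local Notation X := (torus R d).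

Definition mono (nu : 'rV[int]_d) (x : X) : R[i] := \prod_j crd x j ^ nu 0 j.

Lemma conj_crd (x : X) j : (crd x j)^* = (crd x j)^-1.
Proof. by apply/esym/mulr1_eq; rewrite nrm1_conjV ?crd1. Qed.

Lemma trig_mono nu : trig (mono nu).
Proof.
apply: trig_prod => j; case: (nu 0 j) => n; first exact/trig_exp/trig_crd.
rewrite (_ : (fun _ => _) = fun x => (crd x j)^* ^+ n.+1); first exact/trig_exp/trig_conj/trig_crd.
by apply/funext => x; rewrite NegzE -exprnN conj_crd exprVn.
Qed.

Lemma crd_continuous j : continuous (fun x : X => crd x j).
Proof. by apply/torus_continuousP => x e e0; exists e. Qed.

Lemma trig_continuous (f : X -> R[i]) : trig f -> continuous f.
Proof.
elim=> {f} [c|j|f _ cf|f g _ cf _ cg|f g _ cf _ cg].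
- exact: continuous_cst.
- exact: crd_continuous.
- exact: (continuous_conj cf).
- exact: (continuous_add cf cg).
- exact: (continuous_mul cf cg).
Qed.

Lemma mono_continuous nu : continuous (mono nu).
Proof. exact/trig_continuous/trig_mono. Qed.

Lemma nrm_mono nu x : nrm (mono nu x) = 1.
Proof.
rewrite (big_morph (@nrm R R[i]) (@nrmM R) (nrm1 R)) big1 // => j _.
case: (nu 0 j) => n; first by rewrite -exprnP nrmX crd1 expr1n.
by rewrite NegzE -exprnN -exprVn -conj_crd nrmX nrm_conj crd1 expr1n.
Qed.

End Monomials.

Section Fibres.
Variables (R : realType) (d : nat) (a : 'rV[int]_d) (G : 'M[int]_d).
Hypothesis a_gt0 : forall j, 0 < a 0 j.
Local Notation X := (torus R d).
Local Notation E := (Omega R (diag_mx a) G).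

Definition deg j : nat := absz (a 0 j).

Lemma deg_gt0 j : (0 < deg j)%N.
Proof. by rewrite absz_gt0 gt_eqF. Qed.

Lemma degE j : a 0 j = (deg j)%:Z.
Proof. by rewrite /deg gez0_abs // ltW. Qed.

Definition src (p : E) : X := (\val p).1.
Definition rng (p : E) : X := (\val p).2.

Lemma sigmaF (y : X) j : sigma (diag_mx a) (\val y) 0 j = crd y j ^+ deg j.
Proof.
rewrite mxE (bigD1 j) //= mxE eqxx mulr1n degE big1 ?mulr1 // => k kj.
by rewrite mxE eq_sym (negPf kj) mulr0n expr0z.
Qed.

Lemma sigmaG (x : X) j : sigma G (\val x) 0 j = mono (row j G) x.
Proof. by rewrite mxE; apply: eq_bigr => k _; rewrite mxE. Qed.

Lemma edge_eq (p : E) j : crd (rng p) j ^+ deg j = mono (row j G) (src p).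
Proof.
have : sigma (diag_mx a) (\val (rng p)) = sigma G (\val (src p)) by exact: (set_valP p).
by move=> /rowP/(_ j); rewrite sigmaF sigmaG.
Qed.

Lemma edge_ex (x y : X) : (forall j, crd y j ^+ deg j = mono (row j G) x) ->
  exists p : E, src p = x /\ rng p = y.
Proof.
move=> h; have p : (x, y) \in E.
  by rewrite inE; apply/rowP => j; rewrite sigmaF sigmaG h.
by exists (exist _ (x, y) p).
Qed.

Lemma edge_inj (p q : E) : src p = src q -> rng p = rng q -> p = q.
Proof.
by move=> h1 h2; apply/val_inj; rewrite [\val p]surjective_pairing [RHS]surjective_pairing; congr pair.
Qed.

Lemma base_near (x : X) (p : E) :
  exists y : X, (forall j, crd y j ^+ deg j = mono (row j G) x) /\
    forall j, nrm (crd y j - crd (rng p) j) ^+ deg j <=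
      nrm (mono (row j G) x - mono (row j G) (src p)).
Proof.
have h j : exists y, y ^+ deg j = mono (row j G) x /\ nrm (y - crd (rng p) j) ^+ deg j <=
    nrm (mono (row j G) x - mono (row j G) (src p)).
  by have [y] := root_near (deg_gt0 j) (nrm_mono (row j G) x) (edge_eq p j); exists y.
have [y hy] := choice h.
have [j|z hz] := @crd_ex R d y.
  by apply: (nrm_root (deg_gt0 j)); rewrite (hy j).1 nrm_mono.
by exists z; split=> j; rewrite hz; case: (hy j).
Qed.

(** With [below] this is the index set I(F): instead of a dependent product of the ['I_(deg j)],
    functions into one large ordinal, cut down afterwards. The successor keeps that ordinal
    inhabited. *)
Definition index_ffun : finType := {ffun 'I_d -> 'I_(\max_j deg j).+1}.
Implicit Types w : index_ffun.

Definition below w : bool := w \in family (fun j => [pred k : 'I_(\max_j deg j).+1 | (k < deg j)%N]).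

Lemma belowP w : reflect (forall j, (w j < deg j)%N) (below w).
Proof. by rewrite /below; apply: (iffP familyP) => h j; have := h j; rewrite inE. Qed.

Lemma sum_below (f : 'I_d -> nat -> R[i]) :
  \sum_(w | below w) \prod_j f j (w j) = \prod_j \sum_(k < deg j) f j k.
Proof.
rewrite -(bigA_distr_big_dep (fun j => [pred k : 'I_(\max_j deg j).+1 | (k < deg j)%N])
  (fun j (k : 'I_(\max_j deg j).+1) => f j k)).
apply: eq_bigr => j _; rewrite [RHS](big_ord_widen (\max_j deg j).+1) //.
by rewrite ltnW // ltnS leq_bigmax.
Qed.

Definition ndeg : nat := \prod_j deg j.

Lemma ndeg_gt0 : (0 < ndeg)%N.
Proof. by apply: prodn_gt0 => j; exact: deg_gt0. Qed.

Lemma ndeg_neq0 : (ndeg%:R : R[i]) != 0.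
Proof. by rewrite pnatr_eq0 -lt0n ndeg_gt0. Qed.

Lemma detF : (`|\det (diag_mx a)|%:~R : R[i]) = ndeg%:R.
Proof.
rewrite det_diag; have -> : \prod_j a 0 j = ndeg%:Z.
  rewrite /ndeg (big_morph Posz PoszM (erefl (Posz 1))).
  by apply: eq_bigr => j _; rewrite degE.
by rewrite ger0_norm.
Qed.

(** The fibre over x as the orbit of a base point y under products of roots of unity; indices in
    [below] meet each point once. *)
Definition fibre_param (x y : X) (P : index_ffun -> E) : Prop := forall w,
  src (P w) = x /\ forall j, crd (rng (P w)) j = crd y j * zeta R (deg j) ^+ w j.

Lemma fibre_param_ex (x y : X) : (forall j, crd y j ^+ deg j = mono (row j G) x) ->
  exists P, fibre_param x y P.
Proof.
move=> h; suff /choice[P hP] : forall w, exists p : E,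
  src p = x /\ forall j, crd (rng p) j = crd y j * zeta R (deg j) ^+ w j by exists P.
move=> w; have [j|z hz] := @crd_ex R d (fun j => crd y j * zeta R (deg j) ^+ w j).
  by rewrite nrmM crd1 nrm_zetaX ?mulr1 // deg_gt0.
have [|p [px pz]] := @edge_ex x z.
  by move=> j; rewrite hz exprMn exprAC zeta_pow ?deg_gt0 // expr1n mulr1.
by exists p; rewrite px pz.
Qed.

Lemma fibre_inj (x y : X) P w w' : fibre_param x y P -> below w -> below w' ->
  P w = P w' -> w = w'.
Proof.
move=> hP /belowP hw /belowP hw' e; apply/ffunP => j; apply/val_inj => /=.
have y0 : crd y j != 0 by exact/nrm1_neq0/crd1.
have := (hP w).2 j; rewrite e (hP w').2.
move=> /(mulfI y0)/eqP; rewrite (eq_prim_root_expr (zetaP _ (deg_gt0 j))).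
by rewrite !modn_small // => /eqP.
Qed.

(** Two points of a fibre differ in coordinate j by a root of unity of order dividing [deg j], so P
    maps [below] bijectively onto the fibre and the sum over a set becomes an ordinary finite
    sum. *)
Lemma fibre_sum (x y : X) P (f : E -> R[i]) : (forall j, crd y j ^+ deg j = mono (row j G) x) ->
  fibre_param x y P ->
  \sum_(p \in [set p : E | (\val p).1 = x]) f p = \sum_(w | below w) f (P w).
Proof.
move=> hy hP; have y0 j : crd y j != 0 by exact/nrm1_neq0/crd1.
rewrite (fsbigE [seq P w | w <- [seq w <- index_enum index_ffun | below w]]).
- rewrite big_map big_filter_cond; apply: eq_bigl => w.
  by rewrite [X in _ && X]mem_set ?andbT //=; exact: (hP w).1.
- rewrite map_inj_in_uniq ?filter_uniq ?index_enum_uniq // => w w'.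
  by rewrite !mem_filter => /andP[hw _] /andP[hw' _]; exact: fibre_inj hP hw hw'.
- by move=> _ /= /mapP[w _ ->]; exact: (hP w).1.
move=> p /= px /negP[]; apply/mapP.
have h j : exists k : 'I_(deg j), crd (rng p) j = crd y j * zeta R (deg j) ^+ k.
  have e : (crd (rng p) j / crd y j) ^+ deg j = 1.
    by rewrite expr_div_n edge_eq hy /src px divff // -hy expf_neq0.
  have [k hk] := prim_rootP (zetaP R (deg_gt0 j)) e.
  by exists k; rewrite -hk mulrCA divff // mulr1.
pose k j := sval (cid (h j)); have hk j := svalP (cid (h j)).
pose w : index_ffun := [ffun j => inord (k j)].
have wk j : w j = k j :> nat.
  rewrite ffunE inordK // ltnS; apply: leq_trans (ltnW (ltn_ord (k j))) _.
  exact: leq_bigmax.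
exists w; first by rewrite mem_filter mem_index_enum andbT; apply/belowP => j; rewrite wk.
apply: edge_inj; first by rewrite (hP w).1.
by apply: torus_eq => j; rewrite (hP w).2 wk hk.
Qed.

Lemma fibre_base (x : X) : exists y : X, forall j, crd y j ^+ deg j = mono (row j G) x.
Proof.
have h j : exists y, y ^+ deg j = mono (row j G) x.
  by have [y] := root_near (deg_gt0 j) (nrm_mono (row j G) x) (expr1n _ _); exists y.
have [y hy] := choice h.
have [j|z hz] := @crd_ex R d y.
  by apply: (nrm_root (deg_gt0 j)); rewrite hy nrm_mono.
by exists z => j; rewrite hz.
Qed.

Lemma innerE (x y : X) P (xi eta : E -> R[i]) :
  (forall j, crd y j ^+ deg j = mono (row j G) x) -> fibre_param x y P ->
  inner xi eta x = ndeg%:R^-1 * \sum_(w | below w) (xi (P w))^* * eta (P w).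
Proof. by move=> hy hP; rewrite /inner detF (fibre_sum _ hy hP). Qed.

Lemma card_below : \sum_(w | below w) (1 : R[i]) = ndeg%:R.
Proof.
transitivity (\sum_(w | below w) \prod_(j < d) (1 : R[i])).
  by apply: eq_bigr => w _; rewrite big1.
rewrite (sum_below (fun _ _ => 1)) /ndeg natr_prod; apply: eq_bigr => j _.
by rewrite sumr_const card_ord.
Qed.

Lemma inner11 x : inner (fun _ : E => 1) (fun=> 1) x = 1.
Proof.
have [y hy] := fibre_base x; have [P hP] := fibre_param_ex hy.
rewrite (innerE _ _ hy hP); under eq_bigr => w _ do rewrite conjC1 mulr1.
by rewrite card_below mulVf // ndeg_neq0.
Qed.

(** No branch of the roots is chosen continuously. For x' near x, [base_near] finds a base point
    close to the one over x, and the two fibres are compared index by index through the same roots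
    of unity. *)
Lemma inner_continuous (xi eta : E -> R[i]) : continuous xi -> continuous eta ->
  continuous (inner xi eta).
Proof.
move=> cxi ceta; pose h p := (xi p)^* * eta p.
have /omega_continuousP ch : continuous h.
  exact: (continuous_mul (continuous_conj cxi) ceta).
apply/torus_continuousP => x e e0.
have [y hy] := fibre_base x; have [P hP] := fibre_param_ex hy.
have [p0 [p0x p0y]] := edge_ex hy.
have [||c c0 hc] := @finite_min R index_ffun (fun w c => forall q : E,
    (forall j, nrm (crd (src (P w)) j - crd (src q) j) < c) ->
    (forall j, nrm (crd (rng (P w)) j - crd (rng q) j) < c) -> nrm (h (P w) - h q) < e).
- move=> w c c' /andP[_ cc] hh q h1 h2; apply: hh => j.
    exact: lt_le_trans (h1 j) cc.
  exact: lt_le_trans (h2 j) cc.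
- by move=> w; exact: ch.
(* The estimate of [base_near] bounds the [deg j]-th power of the distance, hence the threshold (c /
   2)^(deg j). *)
have [||b b0 hb] := @finite_min R 'I_d (fun j b => forall x' : X,
    (forall i, nrm (crd x i - crd x' i) < b) ->
    nrm (mono (row j G) x - mono (row j G) x') < (c / 2) ^+ deg j).
- move=> j b b' /andP[_ bb] hh x' h1; apply: hh => i.
  exact: lt_le_trans (h1 i) bb.
- move=> j; have /torus_continuousP cm := @mono_continuous R d (row j G).
  by apply: cm; rewrite exprn_gt0 // divr_gt0.
exists (Num.min b c); first by rewrite lt_min b0.
move=> x' xx'; have [y' [hy' yy']] := base_near x' p0.
have [P' hP'] := fibre_param_ex hy'.
rewrite (innerE _ _ hy hP) (innerE _ _ hy' hP') -mulrBr -sumrB nrmM.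
have yc j : nrm (crd y' j - crd y j) < c.
  rewrite -p0y; apply: (@le_lt_trans _ _ (c / 2)); last by rewrite ltr_pdivrMr // ltr_pMr // ltr1n.
  rewrite -(@ler_pXn2r _ (deg j)) ?nnegrE ?nrm_ge0 ?divr_ge0 ?(ltW c0) ?deg_gt0 //.
  apply: le_trans (yy' j) _; rewrite p0x nrmC; apply/ltW/hb => i.
  by apply: lt_le_trans (xx' i) _; rewrite ge_min lexx.
rewrite nrmV; have nN : nrm (ndeg%:R : R[i]) = ndeg%:R.
  by rewrite -(rmorph_nat (@real_complex R)) nrmR ger0_norm.
rewrite nN ltr_pdivrMl ?ltr0n ?ndeg_gt0 //.
have cb : \sum_(w | below w) (1 : R) = ndeg%:R.
  by apply: complexI; rewrite rmorph_sum /= rmorph1 card_below rmorph_nat.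
rewrite -cb mulr_suml; apply: le_lt_trans (nrm_sum _ _ _) _.
apply: ltr_sum => [|w bw].
  apply/hasP; exists [ffun=> ord0]; first by rewrite mem_index_enum.
  by apply/belowP => j; rewrite ffunE deg_gt0.
rewrite mul1r; apply: (hc w (P' w)) => j.
  rewrite (hP w).1 (hP' w).1; apply: lt_le_trans (xx' j) _.
  by rewrite ge_min lexx orbT.
rewrite (hP w).2 (hP' w).2 -mulrBl nrmM nrm_zetaX ?deg_gt0 // mulr1 nrmC.
exact: yc.
Qed.

Definition nu_of w : 'rV[int]_d := \row_j (w j : nat)%:Z.

Lemma nu_of_index w : below w -> index_set a (nu_of w).
Proof.
move=> /belowP bw; apply/forallP => j; rewrite mxE degE.
by apply/andP; split=> //; rewrite lerBrDr lezD1 ltz_nat bw.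
Qed.

Definition char_of w (p : E) : R[i] := mono (nu_of w) (rng p).

Lemma mono_nu_of w (x : X) : mono (nu_of w) x = \prod_j crd x j ^+ w j.
Proof. by apply: eq_bigr => j _; rewrite mxE -exprnP. Qed.

(** The ratio of the j-th coordinates of the two ranges is a root of unity of order dividing
    [deg j]; the sum factors over j into geometric sums, one of which vanishes when p and q
    differ. *)
Lemma char_orthogonal (p q : E) : src p = src q ->
  \sum_(w | below w) char_of w p * (char_of w q)^* = if p == q then ndeg%:R else 0.
Proof.
move=> pq; pose z j := crd (rng p) j * (crd (rng q) j)^*.
have zn j : z j ^+ deg j = 1.
  by rewrite exprMn -rmorphXn /= !edge_eq pq nrm1_conjV // nrm_mono.
transitivity (\sum_(w | below w) \prod_j z j ^+ w j).
  apply: eq_bigr => w _; rewrite /char_of !mono_nu_of rmorph_prod -big_split /=.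
  by apply: eq_bigr => j _; rewrite rmorphXn exprMn.
rewrite (sum_below (fun j k => z j ^+ k)); case: eqVneq => [e|npq].
  rewrite /ndeg natr_prod; apply: eq_bigr => j _.
  rewrite (eq_bigr (fun=> 1)); first by rewrite sumr_const card_ord.
  by move=> k _; rewrite /z e nrm1_conjV ?crd1 // expr1n.
have [j zj] : exists j, z j != 1.
  apply/existsP; rewrite -negb_forall; apply: contra npq => /forallP hz; apply/eqP.
  apply: edge_inj => //; apply: torus_eq => j.
  have := eqP (hz j); rewrite /z conj_crd => h.
  by apply: (mulIf (_ : (crd (rng q) j)^-1 != 0)); rewrite ?invr_eq0 ?h ?divff // nrm1_neq0 // crd1.
by rewrite (bigD1 j) //= sum_root // mul0r.
Qed.

Lemma char_continuous w : continuous (char_of w).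
Proof.
have /torus_continuousP cm := @mono_continuous R d (nu_of w).
apply/omega_continuousP => p e e0; have [c c0 hc] := cm (rng p) e e0.
by exists c => // q _; exact: hc.
Qed.

(** The characters are a finite Parseval frame of the module: the identity is the sum of the rank
    one operators theta(chi_w, chi_w). Hence left multiplications have finite rank and [T xi]
    expands over the S_nu. *)
Lemma fourier_expansion (xi : E -> R[i]) p :
  xi p = \sum_(w | below w) char_of w p * inner (char_of w) xi (src p).
Proof.
have hy j := edge_eq p j; have [P hP] := fibre_param_ex hy.
under eq_bigr => w _ do rewrite (innerE _ _ hy hP) mulrCA mulr_sumr.
rewrite -mulr_sumr exchange_big /=.
rewrite (eq_bigr (fun v => (if p == P v then ndeg%:R else 0) * xi (P v))); last first.
  move=> v bv; rewrite -char_orthogonal ?(hP v).1 // mulr_suml.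
  by apply: eq_bigr => w _; rewrite mulrA.
(* With [rng p] as base point, p itself has index 0. *)
pose w0 : index_ffun := [ffun=> ord0].
have b0 : below w0 by apply/belowP => j; rewrite ffunE deg_gt0.
have Pw0 : P w0 = p.
  apply: edge_inj; first by rewrite (hP w0).1.
  by apply: torus_eq => j; rewrite (hP w0).2 ffunE expr0 mulr1.
rewrite (bigD1 w0) //= Pw0 eqxx big1 ?addr0 => [|v /andP[bv vw]].
  by rewrite mulrA mulVf ?mul1r // ndeg_neq0.
case: eqP => [e|]; last by rewrite mul0r.
by move: vw; rewrite (fibre_inj hP bv b0) ?eqxx // Pw0.
Qed.

End Fibres.

(** * Covariant pairs *)

Section ComposeReal.
Variables (R : realType) (T : topologicalType).

Lemma continuous_Re_comp (phi : R -> R) (g : T -> R[i]) : continuous phi -> continuous g ->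
  continuous (fun x => (phi (complex.Re (g x)))%:C).
Proof.
move=> cphi /continuous_nrm cg; apply/continuous_nrm => x e e0.
have /cvgrPdist_lt/(_ _ e0)/nbhs_ballP[c /= c0 hc] := cphi (complex.Re (g x)).
apply: filterS (cg x c c0) => y /= xy; rewrite -realCB nrmR; apply: hc.
by rewrite -ball_normE /ball_ /=; apply: le_lt_trans xy; rewrite -raddfB nrm_Re.
Qed.

End ComposeReal.

Lemma generatesP (R : realType) (O : cstarType R) (X D : set O) :
  generates X -> closed_star_subalgebra D -> X `<=` D -> forall x, D x.
Proof. by move=> gX hD XD x; have : setT x by []; rewrite -gX; apply: smallest_sub. Qed.

Section Pair.
Variables (R : realType) (d : nat) (a : 'rV[int]_d) (G : 'M[int]_d).
Hypothesis a_gt0 : forall j, 0 < a 0 j.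
Local Notation X := (torus R d).
Local Notation E := (Omega R (diag_mx a) G).
Variables (O : cstarType R) (T : (E -> R[i]) -> O) (pi : (X -> R[i]) -> O).
Hypothesis pairTpi : covariant_pair T pi.
Implicit Types (f g : X -> R[i]) (xi eta : E -> R[i]) (x y : O).

Definition cp_one : O := pi (fun=> 1).

Lemma pi0 : pi (fun=> 0) = 0.
Proof.
have c0 : continuous (fun _ : X => 0 : R[i]) by exact: continuous_cst.
have := pi_linear pairTpi 1 c0 c0; rewrite scale1r.
rewrite (_ : (fun _ => _) = fun=> 0); last by apply/funext => z; rewrite mulr0 addr0.
by rewrite -{1}[pi _]addr0 => /addrI.
Qed.

Lemma piZ k f : continuous f -> pi (fun z => k * f z) = k *: pi f.
Proof.
move=> cf; have c0 : continuous (fun _ : X => 0 : R[i]) by exact: continuous_cst.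
have := pi_linear pairTpi k cf c0; rewrite pi0 addr0 => <-; congr pi.
by apply/funext => z; rewrite addr0.
Qed.

Lemma piD f g : continuous f -> continuous g -> pi (fun z => f z + g z) = pi f + pi g.
Proof.
move=> cf cg; rewrite -[pi f]scale1r -(Defs.pi_linear pairTpi 1 cf cg); congr pi.
by apply/funext => z; rewrite mul1r.
Qed.

Lemma piB f g : continuous f -> continuous g -> pi (fun z => f z - g z) = pi f - pi g.
Proof.
move=> cf cg; rewrite addrC -scaleN1r -(Defs.pi_linear pairTpi (-1) cg cf); congr pi.
by apply/funext => z; rewrite mulN1r addrC.
Qed.

Lemma one_mul f : continuous f -> cmul cp_one (pi f) = pi f.
Proof.
move=> cf; rewrite /cp_one -(Defs.pi_mul pairTpi (@continuous_cst R X 1) cf).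
by congr pi; apply/funext => z; rewrite mul1r.
Qed.

Lemma one_mulT xi : continuous xi -> cmul cp_one (T xi) = T xi.
Proof.
move=> cxi; rewrite /cp_one -(Defs.T_lact pairTpi (@continuous_cst R X 1) cxi).
by congr T; apply/funext => p; rewrite /lact mul1r.
Qed.

Lemma one_star : cstar cp_one = cp_one.
Proof.
rewrite /cp_one -(Defs.pi_star pairTpi (@continuous_cst R X 1)).
by congr pi; apply/funext => z; rewrite conjC1.
Qed.

Lemma src_continuous f : continuous f -> continuous (fun p : E => f (src p)).
Proof.
move=> /torus_continuousP cf; apply/omega_continuousP => p e e0.
by have [c c0 hc] := cf (src p) e e0; exists c => // q h _; exact: hc.
Qed.

Lemma rng_continuous f : continuous f -> continuous (fun p : E => f (rng p)).
Proof.
move=> /torus_continuousP cf; apply/omega_continuousP => p e e0.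
by have [c c0 hc] := cf (rng p) e e0; exists c => // q _ h; exact: hc.
Qed.

Lemma ract_continuous xi f : continuous xi -> continuous f -> continuous (ract xi f).
Proof. by move=> cxi cf; exact: (continuous_mul cxi (src_continuous cf)). Qed.

Lemma lact_continuous xi f : continuous xi -> continuous f -> continuous (lact f xi).
Proof. by move=> cxi cf; exact: (continuous_mul (rng_continuous cf) cxi). Qed.

Lemma inner_ractr xi eta f : inner xi (ract eta f) = (fun z => inner xi eta z * f z).
Proof.
apply/funext => z; have [y hy] := fibre_base G a_gt0 z.
have [P hP] := fibre_param_ex a_gt0 hy.
rewrite !(innerE a_gt0 _ _ hy hP) -mulrA mulr_suml; congr (_ * _); apply: eq_bigr => w _.
by rewrite /ract -/(src _) (hP w).1 mulrA.
Qed.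

Lemma inner_conj xi eta : inner eta xi = (fun z => (inner xi eta z)^*).
Proof.
apply/funext => z; have [y hy] := fibre_base G a_gt0 z.
have [P hP] := fibre_param_ex a_gt0 hy.
rewrite !(innerE a_gt0 _ _ hy hP) rmorphM fmorphV rmorph_nat rmorph_sum; congr (_ * _).
by apply: eq_bigr => w _; rewrite rmorphM /= conjCK mulrC.
Qed.

Lemma inner_ractl xi eta f : inner (ract xi f) eta = (fun z => (f z)^* * inner xi eta z).
Proof.
rewrite inner_conj inner_ractr; apply/funext => z.
by rewrite rmorphM /= [inner eta xi]inner_conj conjCK mulrC.
Qed.

(** Compatibility with the right action is not an axiom of a pair. The difference D of the two sides
    has D^* D = q - q - q + q = 0. *)
Lemma T_ract xi f : continuous xi -> continuous f -> T (ract xi f) = cmul (T xi) (pi f).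
Proof.
move=> cxi cf; have cr := ract_continuous cxi cf.
have ci := inner_continuous a_gt0 cxi cxi.
have cc := continuous_conj cf; have cif := continuous_mul ci cf.
set q := pi (fun z => (f z)^* * (inner xi xi z * f z)).
have qE : q = cmul (pi (fun z => (f z)^*)) (cmul (pi (inner xi xi)) (pi f)).
  by rewrite /q (Defs.pi_mul pairTpi cc cif) (Defs.pi_mul pairTpi ci cf).
have h1 : cmul (cstar (T (ract xi f))) (T (ract xi f)) = q.
  rewrite (Defs.T_inner pairTpi cr cr) inner_ractr inner_ractl; congr pi.
  by apply/funext => z /=; rewrite -?mulrA.
have h2 : cmul (cstar (T (ract xi f))) (cmul (T xi) (pi f)) = q.
  rewrite cmulA (Defs.T_inner pairTpi cr cxi) inner_ractl.
  by rewrite (Defs.pi_mul pairTpi cc ci) qE cmulA.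
have h3 : cmul (cstar (cmul (T xi) (pi f))) (T (ract xi f)) = q.
  rewrite cstarM -(Defs.pi_star pairTpi cf) -cmulA (Defs.T_inner pairTpi cxi cr) inner_ractr.
  by rewrite (Defs.pi_mul pairTpi ci cf) qE.
have h4 : cmul (cstar (cmul (T xi) (pi f))) (cmul (T xi) (pi f)) = q.
  rewrite cstarM -(Defs.pi_star pairTpi cf) -cmulA [cmul (cstar _) (cmul _ _)]cmulA.
  by rewrite (Defs.T_inner pairTpi cxi cxi) qE.
apply/eqP; rewrite -subr_eq0; apply/eqP/cstar_mul_eq0.
by rewrite cstarB cmulBl !cmulBr h1 h2 h3 h4 !subrr.
Qed.

Lemma mul_one f : continuous f -> cmul (pi f) cp_one = pi f.
Proof.
move=> cf; rewrite /cp_one -(Defs.pi_mul pairTpi cf (@continuous_cst R X 1)).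
by congr pi; apply/funext => z; rewrite mulr1.
Qed.

Lemma mul_oneT xi : continuous xi -> cmul (T xi) cp_one = T xi.
Proof.
move=> cxi; rewrite /cp_one -(T_ract cxi (@continuous_cst R X 1)).
by congr T; apply/funext => p; rewrite /ract mulr1.
Qed.

Lemma nrm_one : nrm cp_one <= 1.
Proof.
have := nrm_cstar_mul cp_one; rewrite one_star (one_mul (@continuous_cst R X 1)).
have := nrm_ge0 cp_one; move: (nrm cp_one) => c c0 h; nra.
Qed.

(** [pi] is defined on plain functions, so [star_hom_norm] does not apply; r is the mean of the
    unimodular functions r + i sqrt(1 - r^2) and r - i sqrt(1 - r^2), which [pi] sends to elements
    of norm at most 1. *)
Lemma pi_contract_real (r : X -> R) : continuous (fun z => (r z)%:C) ->
  (forall z, `|r z| <= 1) -> nrm (pi (fun z => (r z)%:C)) <= 1.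
Proof.
move=> cr r1; pose s z := ((Num.sqrt (1 - r z ^+ 2))%:C : R[i]).
have cs : continuous s.
  apply: (@continuous_Re_comp R X (fun c => Num.sqrt (1 - c ^+ 2)) (fun z => (r z)%:C)) => //.
  move=> c; apply: continuous_comp; last exact: sqrt_continuous.
  apply: cvgB; first exact: cvg_cst.
  exact: exprn_continuous.
have unit j : j^* = - j -> j * j = -1 -> nrm (pi (fun z => j * s z + (r z)%:C)) <= 1.
  move=> jc jj; have cu : continuous (fun z => j * s z + (r z)%:C).
    by apply: continuous_add cr; apply: (continuous_mul _ cs); exact: continuous_cst.
  suff : nrm (pi (fun z => j * s z + (r z)%:C)) ^+ 2 <= 1.
    by rewrite -[X in _ <= X](expr1n _ 2) ler_pXn2r ?nnegrE ?nrm_ge0.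
  rewrite -nrm_cstar_mul -(Defs.pi_star pairTpi cu) -(Defs.pi_mul pairTpi (continuous_conj cu) cu).
  rewrite (_ : (fun _ => _) = fun=> 1); first exact: nrm_one.
  apply/funext => z; rewrite rmorphD rmorphM /= jc.
  have -> : ((r z)%:C)^* = (r z)%:C :> R[i] by exact: conjc_real.
  have -> : (s z)^* = s z by exact: conjc_real.
  have ss : s z * s z = 1 - (r z)%:C ^+ 2.
    rewrite /s -realCM -expr2 sqr_sqrtr; first by rewrite realCB rmorphXn.
    by rewrite subr_ge0 -[X in _ <= X](expr1n _ 2) -real_normK ?num_real // ler_pXn2r ?nnegrE.
  transitivity ((r z)%:C ^+ 2 - j * j * (s z * s z)); first by ring.
  by rewrite jj ss; ring.
have i2 : ('i : R[i]) * 'i = -1 by rewrite -expr2 sqrCi.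
have u1 := unit 'i (conjCi _) i2.
have u2 : nrm (pi (fun z => - 'i * s z + (r z)%:C)) <= 1.
  by apply: unit; rewrite ?mulrNN // raddfN /= conjCi.
have c1 : continuous (fun z => 'i * s z + (r z)%:C).
  by apply: continuous_add cr; apply: (continuous_mul _ cs); exact: continuous_cst.
have c2 : continuous (fun z => - 'i * s z + (r z)%:C).
  by apply: continuous_add cr; apply: (continuous_mul _ cs); exact: continuous_cst.
have : nrm (2 *: pi (fun z => (r z)%:C)) <= 1 + 1.
  rewrite -(piZ _ cr) (_ : (fun _ => _) = fun z => ('i * s z + (r z)%:C) + (- 'i * s z + (r z)%:C)).
    by rewrite (piD c1 c2); apply: le_trans (nrmD _ _) (lerD u1 u2).
  by apply/funext => z; ring.
rewrite nrmZ -[2](rmorph_nat (@real_complex R)) nrmR ger0_norm //.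
by lra.
Qed.

Lemma pi_contract f (C : R) : continuous f -> (forall z, nrm (f z) <= C) -> nrm (pi f) <= C.
Proof.
(* A point of the torus yields 0 <= C, and adding e makes the scaling constant positive. *)
move=> cf hC; have [z0 _] := crd_ex (fun _ : 'I_d => nrm1 R).
apply/ler_addgt0Pr => e e0; set D := C + e.
have D0 : 0 < D by rewrite ltr_wpDl // (le_trans (nrm_ge0 _) (hC z0)).
pose k : R[i] := (D^-1)%:C; pose g z := k * f z.
have cg : continuous g by apply: (continuous_mul _ cf); exact: continuous_cst.
have nk : nrm k = D^-1 by rewrite nrmR ger0_norm // invr_ge0 ltW.
have g1 z : nrm (g z) <= 1.
  rewrite nrmM nk mulrC ler_pdivrMr // mul1r (le_trans (hC z)) //.
  by rewrite lerDl ltW.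
suff : nrm (pi g) <= 1 by rewrite (piZ _ cf) nrmZ nk mulrC ler_pdivrMr // mul1r.
suff : nrm (pi g) ^+ 2 <= 1.
  by rewrite -[X in _ <= X](expr1n _ 2) ler_pXn2r ?nnegrE ?nrm_ge0.
rewrite -nrm_cstar_mul -(Defs.pi_star pairTpi cg) -(Defs.pi_mul pairTpi (continuous_conj cg) cg).
have E0 : (fun z => (g z)^* * g z) = (fun z => (nrm (g z) ^+ 2)%:C).
  by apply/funext => z; rewrite nrm_sqr mulrC.
rewrite E0; apply: pi_contract_real.
  by rewrite -E0; exact: (continuous_mul (continuous_conj cg) cg).
by move=> z; rewrite ger0_norm ?sqr_ge0 // -[X in _ <= X](expr1n _ 2) ler_pXn2r ?nnegrE ?nrm_ge0.
Qed.

Lemma T0 : T (fun=> 0) = 0.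
Proof.
have c0 : continuous (fun _ : E => 0 : R[i]) by exact: continuous_cst.
have := Defs.T_linear pairTpi 1 c0 c0; rewrite scale1r.
rewrite (_ : (fun _ => _) = fun=> 0); last by apply/funext => z; rewrite mulr0 addr0.
by rewrite -{1}[T _]addr0 => /addrI.
Qed.

Lemma TD xi eta : continuous xi -> continuous eta -> T (fun p => xi p + eta p) = T xi + T eta.
Proof.
move=> cf cg; rewrite -[T xi]scale1r -(Defs.T_linear pairTpi 1 cf cg); congr T.
by apply/funext => z; rewrite mul1r.
Qed.

Lemma T_sum I (s : seq I) (P : pred I) (h : I -> E -> R[i]) : (forall i, continuous (h i)) ->
  T (fun p => \sum_(i <- s | P i) h i p) = \sum_(i <- s | P i) T (h i).
Proof.
move=> ch; elim: s => [|i s IH].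
  by rewrite big_nil -T0; congr T; apply/funext => p; rewrite big_nil.
rewrite big_cons -IH; case Pi: (P i).
  have cs : continuous (fun p => \sum_(i <- s | P i) h i p) by exact: continuous_bigsum ch.
  rewrite -(TD (ch i) cs).
  by congr T; apply/funext => p; rewrite big_cons Pi.
by congr T; apply/funext => p; rewrite big_cons Pi.
Qed.

Lemma S_star_S : cmul (cstar (gen_S T)) (gen_S T) = cp_one.
Proof.
rewrite /gen_S (Defs.T_inner pairTpi (@continuous_cst R E 1) (@continuous_cst R E 1)).
by rewrite /cp_one; congr pi; apply/funext => z; rewrite inner11.
Qed.

(** Applies [T] to the Fourier expansion. What is known about S and [pi] thereby reaches every
    [T xi]. *)
Lemma T_expand xi : continuous xi ->
  T xi = \sum_(w : index_ffun a | below w) cmul (gen_Snu T pi (nu_of w)) (pi (inner (char_of w) xi)).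
Proof.
move=> cxi; have ci w : continuous (inner (char_of (R := R) (G := G) w) xi).
  by apply: (inner_continuous a_gt0 _ cxi); exact: char_continuous.
have cc w : continuous (fun p : E => char_of w p * inner (char_of w) xi (src p)).
  apply: (continuous_mul _ (src_continuous (ci w))); exact: char_continuous.
rewrite [in LHS](_ : xi = fun p => \sum_(w : index_ffun a | below w)
    char_of w p * inner (char_of w) xi (src p)).
  rewrite (T_sum _ _ cc); apply: eq_bigr => w _; rewrite /gen_Snu /gen_Upow /gen_S.
  have c1 : continuous (fun _ : E => 1 : R[i]) by exact: continuous_cst.
  have cr := ract_continuous c1 (ci w).
  rewrite -cmulA -(T_ract c1 (ci w)) -(Defs.T_lact pairTpi (@mono_continuous R d (nu_of w)) cr).
  by congr T; apply/funext => p; rewrite /lact /ract mul1r.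
by apply/funext => p; rewrite {1}(fourier_expansion a_gt0 xi p).
Qed.

End Pair.

(** * Words and the fixed point algebra *)

Section Words.
Variables (R : realType) (d : nat) (a : 'rV[int]_d) (G : 'M[int]_d).
Hypothesis a_gt0 : forall j, 0 < a 0 j.
Local Notation X := (torus R d).
Local Notation E := (Omega R (diag_mx a) G).
Variables (O : cstarType R) (T : (E -> R[i]) -> O) (pi : (X -> R[i]) -> O).
Hypothesis pairTpi : covariant_pair T pi.
Hypothesis genTpi : generates ([set T xi | xi in [set xi : E -> R[i] | continuous xi]] `|`
               [set pi a | a in [set a : X -> R[i] | continuous a]]).
Implicit Types (f g : X -> R[i]) (xi eta : E -> R[i]) (x y : O).

Local Notation one := (cp_one pi).

(** [O] is not assumed unital: [pi] of 1 is neutral on the generators, and the elements on which it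
    is neutral form a closed star-subalgebra. *)
Lemma one_unit : is_one one.
Proof.
apply: (generatesP genTpi).
  split.
  - apply/closed_nrm => x h; split; apply: nrm_small_eq => e e0.
      have [y [y1 _] xy] := h (e / 2) (divr_gt0 e0 (ltr0n _ 2)).
      apply: (@nrm_split _ _ y); last by rewrite nrmC.
      rewrite -{1}y1 -cmulBr; apply: le_trans (nrm_cmul _ _) _.
      by apply: le_trans xy; rewrite ler_piMl ?nrm_ge0 // (nrm_one pairTpi).
    have [y [_ y1] xy] := h (e / 2) (divr_gt0 e0 (ltr0n _ 2)).
    apply: (@nrm_split _ _ y); last by rewrite nrmC.
    rewrite -{1}y1 -cmulBl; apply: le_trans (nrm_cmul _ _) _.
    by apply: le_trans xy; rewrite ler_piMr ?nrm_ge0 // (nrm_one pairTpi).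
  - by rewrite cmul0l cmul0r.
  - by move=> k x y [h1 h2] [h3 h4]; rewrite cmul_linearl cmul_linearr h1 h2 h3 h4.
  - by move=> x y [h1 h2] [h3 h4]; rewrite cmulA h1 -cmulA h4.
  - by move=> x [h1 h2]; rewrite -(one_star pairTpi) -!cstarM h1 h2.
move=> _ [[xi cxi <-]|[f cf <-]].
  by rewrite (one_mulT pairTpi cxi) (mul_oneT a_gt0 pairTpi cxi).
by rewrite (one_mul pairTpi cf) (mul_one pairTpi cf).
Qed.

Lemma mul1O x : cmul one x = x. Proof. by have [] := one_unit x. Qed.
Lemma mulO1 x : cmul x one = x. Proof. by have [] := one_unit x. Qed.

(** Products with m factors T xi on the left and n adjoints of such factors on the right; m - n is
    the gauge degree. Arbitrary xi, instead of the S_nu, make products of words words again. *)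
Inductive word : nat -> nat -> O -> Prop :=
| word_pi f : continuous f -> word 0 0 (pi f)
| word_l m n xi x : continuous xi -> word m n x -> word m.+1 n (cmul (T xi) x)
| word_r m n xi x : continuous xi -> word m n x -> word m n.+1 (cmul x (cstar (T xi))).

Lemma word_star m n x : word m n x -> word n m (cstar x).
Proof.
elim=> {m n x} [f cf|m n xi x cxi _ IH|m n xi x cxi _ IH].
- by rewrite -(Defs.pi_star pairTpi cf); exact: word_pi (continuous_conj cf).
- by rewrite cstarM; exact: word_r cxi IH.
- by rewrite cstarM cstarK; exact: word_l cxi IH.
Qed.

Lemma word_pil m n x f : continuous f -> word m n x -> word m n (cmul (pi f) x).
Proof.
move=> cf; elim=> {m n x} [g cg|m n xi x cxi hx IH|m n xi x cxi _ IH].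
- by rewrite -(Defs.pi_mul pairTpi cf cg); exact: word_pi (continuous_mul cf cg).
- by rewrite cmulA -(Defs.T_lact pairTpi cf cxi); exact: word_l (lact_continuous cxi cf) hx.
- by rewrite cmulA; exact: word_r cxi IH.
Qed.

Lemma word_scale m n x k : word m n x -> word m n (k *: x).
Proof.
elim=> {m n x} [f cf|m n xi x cxi _ IH|m n xi x cxi _ IH].
- rewrite -(piZ pairTpi k cf); apply: word_pi.
  by apply: (continuous_mul _ cf); exact: continuous_cst.
- by rewrite -cmulZr; exact: word_l cxi IH.
- by rewrite -cmulZl; exact: word_r cxi IH.
Qed.

(** The equation says, without subtraction, that the new factor lowers the degree m - n by one. *)
Lemma word_Tstar m n x xi : continuous xi -> word m n x ->
  exists m' n', (m' + n.+1 = m + n')%N /\ word m' n' (cmul (cstar (T xi)) x).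
Proof.
move=> cxi; elim=> {m n x} [f cf|m n eta x ceta hx IH|m n eta x ceta _ [m' [n' [e h]]]].
- exists 0%N, 1%N; split=> //; have cc := continuous_conj cf.
  have -> : cmul (cstar (T xi)) (pi f) = cstar (T (lact (fun z => (f z)^*) xi)).
    rewrite (Defs.T_lact pairTpi cc cxi) cstarM -(Defs.pi_star pairTpi cc); congr (cmul _ (pi _)).
    by apply/funext => z; rewrite conjCK.
  rewrite -[cstar _]mul1O; apply: word_r (lact_continuous cxi cc) _.
  by apply: word_pi; exact: continuous_cst.
- exists m, n; split; first by rewrite addnS.
  rewrite cmulA (Defs.T_inner pairTpi cxi ceta).
  exact: word_pil (inner_continuous a_gt0 cxi ceta) hx.
- exists m', n'.+1; split; first by rewrite !addnS -e addnS.
  by rewrite cmulA; exact: word_r ceta h.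
Qed.

Lemma word_mul m n k l x y : word m n x -> word k l y ->
  exists m' n', (m' + n + l = m + k + n')%N /\ word m' n' (cmul x y).
Proof.
move=> hx; elim: hx k l y => {m n x} [f cf|m n xi x cxi _ IH|m n xi x cxi _ IH] k l y hy.
- by exists k, l; split; [rewrite addn0 | exact: word_pil cf hy].
- have [m' [n' [e h]]] := IH _ _ _ hy; exists m'.+1, n'; split; first by lia.
  by rewrite -cmulA; exact: word_l cxi h.
- have [k' [l' [e h]]] := word_Tstar cxi hy.
  have [m' [n' [e' h']]] := IH _ _ _ h; exists m', n'; split; first by lia.
  by rewrite -cmulA.
Qed.

Inductive span : O -> Prop :=
| span0 : span 0
| span_add m n x y : word m n x -> span y -> span (x + y).

Lemma span_word m n x : word m n x -> span x.
Proof. by move=> h; rewrite -[x]addr0; exact: span_add h span0. Qed.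

Lemma spanD x y : span x -> span y -> span (x + y).
Proof.
move=> hx hy; elim: hx => {x} [|m n x z h _ IH]; first by rewrite add0r.
by rewrite -addrA; exact: span_add h IH.
Qed.

Lemma spanZ k x : span x -> span (k *: x).
Proof.
elim=> {x} [|m n x y h _ IH]; first by rewrite scaler0; exact: span0.
by rewrite scalerDr; exact: span_add (word_scale k h) IH.
Qed.

Lemma span_star x : span x -> span (cstar x).
Proof.
elim=> {x} [|m n x y h _ IH]; first by rewrite cstar0; exact: span0.
by rewrite cstarD; exact: span_add (word_star h) IH.
Qed.

Lemma span_mul x y : span x -> span y -> span (cmul x y).
Proof.
move=> hx hy; elim: hx => {x} [|m n x z h _ IH]; first by rewrite cmul0l; exact: span0.
rewrite cmulDl; apply: spanD IH; elim: hy => {y} [|k l y w h' _ IH].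
  by rewrite cmul0r; exact: span0.
rewrite cmulDr; apply: spanD IH.
by have [m' [n' [_ h'']]] := word_mul h h'; exact: span_word h''.
Qed.

Lemma span_dense x (e : R) : 0 < e -> exists2 y, span y & nrm (x - y) <= e.
Proof.
move: e; apply: (@generatesP R O _
  [set x | forall e : R, 0 < e -> exists2 y, span y & nrm (x - y) <= e] genTpi).
  split.
  - apply/closed_nrm => z h e e0; have e2 : 0 < e / 2 by rewrite divr_gt0.
    have [y /= hy zy] := h _ e2; have [w sw yw] := hy _ e2; exists w => //.
    exact: (@nrm_split _ _ y).
  - by move=> e e0; exists 0; [exact: span0 | rewrite subrr nrm0 ltW].
  - move=> k z w hz hw e e0; have k0 : 0 < nrm k + 1 by rewrite ltr_wpDl ?nrm_ge0.
    have e2 : 0 < e / 2 by rewrite divr_gt0.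
    have [[z' sz zz] [w' sw ww]] := (hz _ (divr_gt0 e2 k0), hw _ e2).
    exists (k *: z' + w'); first exact: spanD (spanZ k sz) sw.
    exact: nrm_linear_close.
  - move=> z w hz hw e e0.
    have z0 : 0 < nrm z + 1 by rewrite ltr_wpDl ?nrm_ge0.
    have w0 : 0 < nrm w + 1 by rewrite ltr_wpDl ?nrm_ge0.
    have e2 : 0 < e / 2 by rewrite divr_gt0.
    (* [w] is approximated before [z], since the tolerance for [z] depends on the chosen [w']. *)
    have [w' sw ww] := hw _ (divr_gt0 e2 z0).
    have w'0 : 0 < nrm w' + 1 by rewrite ltr_wpDl ?nrm_ge0.
    have [z' sz zz] := hz _ (divr_gt0 e2 w'0).
    exists (cmul z' w'); first exact: span_mul.
    exact: (nrm_bilin_close (@cmulBl _ O) (@cmulBr _ O) (@nrm_cmul _ O) (lexx _) (lexx _)).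
  - move=> z hz e /hz[y sy zy]; exists (cstar y); first exact: span_star.
    by rewrite -cstarB nrm_cstar.
move=> _ [[xi cxi <-]|[f cf <-]] e e0.
  exists (T xi); last by rewrite subrr nrm0 ltW.
  rewrite -[T xi]mulO1; apply: span_word; apply: word_l cxi _.
  by apply: word_pi; exact: continuous_cst.
by exists (pi f); [exact: span_word (word_pi cf) | rewrite subrr nrm0 ltW].
Qed.

Definition linear_set (D : O -> Prop) : Prop :=
  D 0 /\ forall (k : R[i]) x y, D x -> D y -> D (k *: x + y).

Lemma linear_sum D I (s : seq I) (P : pred I) (F : I -> O) : linear_set D ->
  (forall i, P i -> D (F i)) -> D (\sum_(i <- s | P i) F i).
Proof.
move=> [D0 Dl] h; elim/big_ind: _ => // x y Dx Dy.
by rewrite -[x]scale1r; exact: Dl.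
Qed.

Inductive lword : nat -> O -> Prop :=
| lword_pi f : continuous f -> lword 0 (pi f)
| lword_T m xi x : continuous xi -> lword m x -> lword m.+1 (cmul (T xi) x).

Lemma lword_pil m x f : continuous f -> lword m x -> lword m (cmul (pi f) x).
Proof.
move=> cf [g cg|{}m xi {}x cxi hx].
  by rewrite -(Defs.pi_mul pairTpi cf cg); exact: lword_pi (continuous_mul cf cg).
by rewrite cmulA -(Defs.T_lact pairTpi cf cxi); exact: lword_T (lact_continuous cxi cf) hx.
Qed.

Lemma lword_pir m x f : continuous f -> lword m x -> lword m (cmul x (pi f)).
Proof.
move=> cf; elim=> {m x} [g cg|m xi x cxi _ IH].
  by rewrite -(Defs.pi_mul pairTpi cg cf); exact: lword_pi (continuous_mul cg cf).
by rewrite -cmulA; exact: lword_T cxi IH.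
Qed.

Lemma wordE m n x : word m n x -> exists l r, [/\ lword m l, lword n r & x = cmul l (cstar r)].
Proof.
elim=> {m n x} [f cf|m n xi x cxi _ [l [r [hl hr ->]]]|m n xi x cxi _ [l [r [hl hr ->]]]].
- exists (pi f), one; split; [exact: lword_pi| |by rewrite (one_star pairTpi) mulO1].
  by apply: lword_pi; exact: continuous_cst.
- by exists (cmul (T xi) l), r; split; [exact: lword_T | | rewrite cmulA].
- by exists l, (cmul (T xi) r); split; [| exact: lword_T | rewrite cstarM cmulA].
Qed.

Local Notation SW alpha := (Sword T pi alpha one).

Lemma SwordE alpha x : Sword T pi alpha x = cmul (SW alpha) x.
Proof. by elim: alpha => [|nu alpha IH] /=; [rewrite mul1O | rewrite IH cmulA]. Qed.

Lemma SconjE alpha beta x : Sconj T pi alpha beta x =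
  cmul (SW alpha) (cmul x (cstar (SW beta))).
Proof. by rewrite /Sconj SwordE [Sword _ _ beta _]SwordE cstarM cstarK. Qed.

Lemma lword_inv m l : lword m l ->
  if m is m'.+1 then exists xi l', [/\ continuous xi, lword m' l' & l = cmul (T xi) l']
  else exists2 f, continuous f & l = pi f.
Proof. by case=> {m l} [f cf|m xi x cxi hx]; [exists f | exists xi, x]. Qed.

(** Each [T xi] is expanded over the S_nu and its coefficient is absorbed by the rest of the word
    through the left action, until a single function remains at the end. [D] changes during the
    induction to hold the letters already expanded. *)
Lemma lword_span m l (D : O -> Prop) : linear_set D ->
  (forall alpha f, size alpha = m -> all (index_set a) alpha -> continuous f ->
    D (cmul (SW alpha) (pi f))) -> lword m l -> D l.
Proof.
elim: m l D => [|m IH] l D Dl hD.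
  by move=> /lword_inv[f cf ->]; have := hD [::] f erefl erefl cf; rewrite mul1O.
move=> /lword_inv[xi [l' [cxi hl ->]]].
rewrite (T_expand a_gt0 pairTpi cxi) cmul_suml; apply: (linear_sum _ Dl) => w bw.
have ci : continuous (inner (char_of w) xi).
  by apply: (inner_continuous a_gt0 _ cxi); exact: char_continuous.
rewrite -cmulA; apply: (IH _ (fun y => D (cmul (gen_Snu T pi (nu_of w)) y)));
  last exact: lword_pil ci hl.
  split; first by rewrite cmul0r; exact: Dl.1.
  by move=> k y z hy hz; rewrite cmul_linearr; exact: Dl.2.
move=> alpha f sz ia cf; rewrite cmulA; apply: (hD (nu_of w :: alpha)) => //=.
  by rewrite sz.
by rewrite ia (nu_of_index a_gt0 bw).
Qed.

(** The right half is expanded first; its coefficient crosses to the end of the left half, which is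
    expanded in turn. *)
Lemma word_span m n x (D : O -> Prop) : linear_set D ->
  (forall alpha beta f, size alpha = m -> size beta = n -> all (index_set a) alpha ->
    all (index_set a) beta -> continuous f -> D (Sconj T pi alpha beta (pi f))) ->
  word m n x -> D x.
Proof.
move=> Dl hD /wordE[l [r [hl hr ->]]].
apply: (lword_span (D := fun y => D (cmul l (cstar y))) _ _ hr).
  split; first by rewrite cstar0 cmul0r; exact: Dl.1.
  by move=> k y z hy hz; rewrite cstar_antilinear cmul_linearr; exact: Dl.2.
move=> beta g sb ib cg; rewrite cstarM cmulA -(Defs.pi_star pairTpi cg).
have := lword_pir (continuous_conj cg) hl; move: (cmul l _) => {hl} y hy.
apply: (lword_span (D := fun y => D (cmul y (cstar (SW beta)))) _ _ hy).
  split; first by rewrite cmul0l; exact: Dl.1.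
  by move=> k z z' hz hz'; rewrite cmul_linearl; exact: Dl.2.
by move=> alpha f sa ia cf; rewrite -cmulA -SconjE; exact: hD.
Qed.

(** * Averaging over the gauge action *)

Section Gauge.
Variable gamma : R[i] -> O -> O.
Hypothesis gaugeP : gauge_action T pi gamma.

Lemma gauge_hom t : `|t| = 1 -> star_hom (gamma t).
Proof. by move=> /(gauge_auto gaugeP)[]. Qed.

Lemma gauge_one_fixed t : `|t| = 1 -> gamma t one = one.
Proof.
move=> t1; have [ht [inv invK Kinv]] := gauge_auto gaugeP t1.
by rewrite -[LHS]mulO1 -{2}(Kinv one) -(homM ht) mul1O Kinv.
Qed.

Lemma gauge_trig t f : `|t| = 1 -> trig f -> gamma t (pi f) = pi f.
Proof.
move=> t1; have ht := gauge_hom t1.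
elim=> {f} [c|j|f tf IH|f g tf IHf tg IHg|f g tf IHf tg IHg].
- have c1 : continuous (fun _ : X => 1 : R[i]) by exact: continuous_cst.
  have -> : pi (fun=> c) = c *: one.
    by rewrite -(piZ pairTpi c c1); congr pi; apply/funext => z; rewrite mulr1.
  by rewrite (homZ ht) gauge_one_fixed.
- exact: (gauge_U gaugeP).
- by rewrite (Defs.pi_star pairTpi (trig_continuous tf)) (homS ht) IH.
- rewrite (piD pairTpi (trig_continuous tf) (trig_continuous tg)).
  by rewrite (homD ht) IHf IHg.
- rewrite (Defs.pi_mul pairTpi (trig_continuous tf) (trig_continuous tg)).
  by rewrite (homM ht) IHf IHg.
Qed.

(** The action is prescribed on the coordinates only, hence known on [trig] functions; density and
    the contractivity of [pi] and [gamma t] do the rest. *)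
Lemma gauge_pi t f : `|t| = 1 -> continuous f -> gamma t (pi f) = pi f.
Proof.
move=> t1 cf; have ht := gauge_hom t1; apply: nrm_small_eq => e e0.
have [g tg fg] := trig_dense cf (divr_gt0 e0 (ltr0n _ 2)).
have cg := trig_continuous tg.
have fg' : nrm (pi f - pi g) <= e / 2.
  rewrite -(piB pairTpi cf cg); apply: (pi_contract pairTpi _ fg).
  apply: (continuous_add cf); apply/continuous_nrm => x c c0.
  have /continuous_nrm/(_ x c c0) := cg; apply: filterS => y /=.
  by rewrite -opprD nrmN.
apply: (@nrm_split _ _ (pi g)).
  by rewrite -(gauge_trig t1 tg) -(homB ht); apply: le_trans (star_hom_norm _ ht) fg'.
by rewrite nrmC.
Qed.

Lemma gauge_T t xi : `|t| = 1 -> continuous xi -> gamma t (T xi) = t *: T xi.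
Proof.
move=> t1 cxi; have ht := gauge_hom t1; rewrite (T_expand a_gt0 pairTpi cxi).
rewrite (hom_sum ht) scaler_sumr; apply: eq_bigr => w _.
have ci : continuous (inner (char_of w) xi).
  by apply: (inner_continuous a_gt0 _ cxi); exact: char_continuous.
rewrite !(homM ht) (gauge_pi t1 ci) (gauge_S gaugeP t1).
rewrite (gauge_pi t1 (@mono_continuous R d (nu_of w))).
by rewrite cmulZr cmulZl.
Qed.

Lemma gauge_word t m n x : `|t| = 1 -> word m n x -> gamma t x = (t ^+ m * t^* ^+ n) *: x.
Proof.
move=> t1; have ht := gauge_hom t1.
elim=> {m n x} [f cf|m n xi x cxi _ IH|m n xi x cxi _ IH].
- by rewrite (gauge_pi t1 cf) !expr0 mulr1 scale1r.
- by rewrite (homM ht) (gauge_T t1 cxi) IH cmulZl cmulZr scalerA exprS mulrA.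
- rewrite (homM ht) (homS ht) (gauge_T t1 cxi) IH cstarZ cmulZl cmulZr scalerA.
  by rewrite exprSr mulrA.
Qed.

Definition average M x : O := M%:R^-1 *: \sum_(k < M) gamma (zeta R M ^+ k) x.

Lemma zeta_norm M k : (0 < M)%N -> `|zeta R M ^+ k| = 1.
Proof. by move=> M0; rewrite nrmE nrm_zetaX. Qed.

Lemma average_word M m n x : (m < M)%N -> (n < M)%N -> word m n x ->
  average M x = if m == n then x else 0.
Proof.
move=> mM nM hx; have M0 : (0 < M)%N by apply: leq_ltn_trans mM.
have zz : (zeta R M)^* * zeta R M = 1 by rewrite mulrC nrm1_conjV // nrm_zeta.
rewrite /average (eq_bigr (fun k : 'I_M => ((zeta R M ^+ m * (zeta R M)^* ^+ n) ^+ k) *: x)).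
  rewrite -scaler_suml.
  have pz : M.-primitive_root (zeta R M)^* by rewrite fmorph_primitive_root zetaP.
  rewrite (sum_prim_root pz zz mM nM); case: eqP => _; last by rewrite scale0r scaler0.
  by rewrite scalerA mulVf ?scale1r // pnatr_eq0 -lt0n.
move=> k _; rewrite (gauge_word (zeta_norm k M0) hx); congr (_ *: _).
by rewrite rmorphXn /= exprMn -!exprM ![(k * _)%N]mulnC.
Qed.

Lemma average_fixed M x : (0 < M)%N -> (forall t, `|t| = 1 -> gamma t x = x) ->
  average M x = x.
Proof.
move=> M0 hx; rewrite /average (eq_bigr (fun=> x)); last by move=> k _; rewrite hx // zeta_norm.
by rewrite sumr_const card_ord -(@scaler_nat R[i] O) scalerA mulVf ?scale1r // pnatr_eq0 -lt0n.
Qed.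

Lemma average_linear M x y : average M (x + y) = average M x + average M y \/ M = 0%N.
Proof.
case: M => [|M]; [by right | left]; rewrite /average -scalerDr -big_split /=; congr (_ *: _).
by apply: eq_bigr => k _; rewrite (homD (gauge_hom (zeta_norm k (ltn0Sn M)))).
Qed.

Lemma average_norm M x : (0 < M)%N -> nrm (average M x) <= nrm x.
Proof.
move=> M0; rewrite nrmZ nrmV -(rmorph_nat (@real_complex R)) nrmR ger0_norm //.
rewrite ler_pdivrMl ?ltr0n //; apply: le_trans (nrm_sum _ _ _) _.
rewrite mulr_natl -[M in _ *+ M]card_ord -sumr_const; apply: ler_sum => k _.
exact: star_hom_norm (gauge_hom (zeta_norm k M0)).
Qed.

(* Averaging over the M-th roots of unity, for M large, kills the words whose two
   lengths differ, so it replaces the conditional expectation. *)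
Lemma fixed_point_dense (D : O -> Prop) : linear_set D -> closed D ->
  (forall k alpha beta f, size alpha = k -> size beta = k -> all (index_set a) alpha ->
    all (index_set a) beta -> continuous f -> D (Sconj T pi alpha beta (pi f))) ->
  forall x, (forall t, `|t| = 1 -> gamma t x = x) -> D x.
Proof.
move=> Dl cD hD x hx; apply: (closed_nrm D).1 => // e e0.
have [y sy xy] := span_dense x e0.
(* [M0] bounds the lengths of all words in [y], so averages of higher order keep exactly the
   balanced ones. *)
have [M0 hM0] : exists M0, forall M, (M0 < M)%N -> D (average M y).
  elim: sy => {y xy} [|m n y z hy _ [M0 hM0]].
    exists 0%N => M M0; rewrite /average big1 ?scaler0; first exact: Dl.1.
    by move=> k _; rewrite (hom0 (gauge_hom (zeta_norm k M0))).
  exists (maxn M0 (maxn m n)) => M; rewrite !gtn_max => /and3P[h1 h2 h3].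
  case: (average_linear M y z) => [->|M00]; last by rewrite M00 in h1.
  rewrite (average_word h2 h3 hy) -[X in D (X + _)]scale1r; apply: Dl.2; last exact: hM0.
  case: eqP => [e1|_]; last exact: Dl.1.
  rewrite -e1 in hy; apply: word_span Dl _ hy => *; exact: (hD m).
exists (average M0.+1 y); first exact: hM0.
(* [x] is its own average and averaging is contractive, so the approximation survives. *)
rewrite -{1}(average_fixed (ltn0Sn M0) hx).
have -> : average M0.+1 x - average M0.+1 y = average M0.+1 (x - y).
  apply/eqP; rewrite subr_eq; have [<-|//] := average_linear M0.+1 (x - y) y.
  by rewrite subrK.
exact: le_trans (average_norm _ _) xy.
Qed.

End Gauge.
End Words.

(** * Operators on square-summable sequences *)

Section BlockOperators.
Variable R : realType.
Local Notation l2 := (l2 R).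
Local Notation C := R[i].
Implicit Types (c : nat -> C) (h g : l2).

Definition bounded_coeff c : Prop := exists B : R, forall n, nrm (c n) <= B.

Lemma l2_mk (x : nat -> C) : is_l2 x -> exists h, forall n, h n = x n.
Proof. by move=> hx; exists (L2 hx). Qed.

Lemma l2_eq h g : (forall n, h n = g n) -> h = g.
Proof. by move=> e; apply/val_inj/funext. Qed.

Lemma l2_is_bop (u v : l2 -> l2) (B : R) : 0 <= B ->
  (forall (k : C) h g, u (k *: h + g) = k *: u h + u g) ->
  (forall h n, sqsum (u h) n <= B * l2_norm2 h) -> adjoint u v -> is_bop u.
Proof.
move=> B0 ul uB uv; split=> //; last by exists v.
exists (Num.sqrt B) => h; apply: l2_nrm_le => [|n]; first by rewrite mulr_ge0 ?sqrtr_ge0 ?nrm_ge0.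
by rewrite exprMn sqr_sqrtr // l2_nrm.
Qed.

Lemma mul_is_l2 c h : bounded_coeff c -> is_l2 (fun n => c n * h n).
Proof.
move=> [B hB]; apply: (@is_l2P _ _ (B ^+ 2 * l2_norm2 h)) => n.
apply: le_trans (ler_wpM2l (sqr_ge0 B) (l2_norm2_ub h n)).
rewrite /sqsum mulr_sumr; apply: ler_sum => i _; rewrite nrmM exprMn.
rewrite ler_wpM2r ?sqr_ge0 // ler_pXn2r ?nnegrE ?nrm_ge0 //.
exact: le_trans (nrm_ge0 _) (hB i).
Qed.

Lemma Mop_ex c : bounded_coeff c -> exists u : bop l2, forall h n, u h n = c n * h n.
Proof.
move=> bc; have bc' : bounded_coeff (fun n => (c n)^*).
  by have [B hB] := bc; exists B => n; rewrite nrm_conj.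
have [u hu] := choice (fun h => l2_mk (mul_is_l2 h bc)).
have [v hv] := choice (fun h => l2_mk (mul_is_l2 h bc')).
have [B hB] := bc.
suff ub : is_bop u by exists (Bop (is_bopbP ub)).
apply: (@l2_is_bop u v (B ^+ 2)); first exact: sqr_ge0.
- move=> k h g; apply: l2_eq => n; rewrite hu.
  by rewrite !(l2DE, l2ZE) !hu; ring.
- move=> h n; apply: le_trans (ler_wpM2l (sqr_ge0 B) (l2_norm2_ub h n)).
  rewrite /sqsum mulr_sumr; apply: ler_sum => i _; rewrite hu nrmM exprMn.
  rewrite ler_wpM2r ?sqr_ge0 // ler_pXn2r ?nnegrE ?nrm_ge0 //.
  exact: le_trans (nrm_ge0 _) (hB i).
- move=> h g; rewrite !l2_hdotE /l2_dot; congr csum; apply/funext => n.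
  by rewrite hu hv rmorphM /= conjCK; ring.
Qed.

(** Total in [c], with default 0 when no such operator exists: [T] and [pi] have to be defined on
    all functions. *)
Definition Mop c : bop l2 := xget 0 [set u : bop l2 | forall h n, u h n = c n * h n].

Lemma MopE c h n : bounded_coeff c -> Mop c h n = c n * h n.
Proof. by move=> /Mop_ex[u hu]; rewrite /Mop; case: xgetP => [v _ ->|/(_ u)]. Qed.

Lemma Mop_star c : bounded_coeff c -> bop_star (Mop c) = Mop (fun n => (c n)^*).
Proof.
move=> bc; have bc' : bounded_coeff (fun n => (c n)^*).
  by have [B hB] := bc; exists B => n; rewrite nrm_conj.
apply: bop_star_uniq => h g; rewrite !l2_hdotE /l2_dot; congr csum; apply/funext => n.
by rewrite !MopE // rmorphM /= conjCK; ring.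
Qed.

Variable N : nat.
Hypothesis N0 : (0 < N)%N.

Lemma block_sum (F : nat -> R) n :
  \sum_(m < n * N) F m = \sum_(p < n) \sum_(i < N) F (p * N + i)%N.
Proof.
elim: n => [|n IH]; first by rewrite !big_ord0.
by rewrite mulSnr big_split_ord /= IH big_ord_recr.
Qed.

Lemma dup_sqsum h n : sqsum (fun m => h (m %/ N)%N) n <= N%:R * l2_norm2 h.
Proof.
apply: (@le_trans _ _ (\sum_(m < n * N) nrm (h (m %/ N)%N) ^+ 2)).
  have /subnKC <- : (n <= n * N)%N by rewrite leq_pmulr.
  by rewrite big_split_ord /= lerDl; apply: sumr_ge0 => i _; rewrite sqr_ge0.
rewrite (block_sum (fun m => nrm (h (m %/ N)%N) ^+ 2)).
apply: le_trans (ler_wpM2l (ler0n _ N) (l2_norm2_ub h n)).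
rewrite /sqsum mulr_sumr; apply: ler_sum => p _.
rewrite (eq_bigr (fun=> nrm (h p) ^+ 2)); last first.
  by move=> i _; rewrite divnMDl // divn_small // addn0.
by rewrite sumr_const card_ord mulr_natl.
Qed.

(** A crude constant: only boundedness matters. *)
Lemma blk_sqsum h n : sqsum (fun p => \sum_(i < N) h (p * N + i)%N) n <= N%:R ^+ 2 * l2_norm2 h.
Proof.
apply: le_trans (ler_wpM2l (sqr_ge0 _) (l2_norm2_ub h (n * N))).
rewrite /sqsum (block_sum (fun m => nrm (h m) ^+ 2)) mulr_sumr; apply: ler_sum => p _.
set s := \sum_(i < N) _ ^+ 2; have s0 : 0 <= s by apply: sumr_ge0 => i _; rewrite sqr_ge0.
have -> : N%:R ^+ 2 * s = (N%:R * Num.sqrt s) ^+ 2 by rewrite exprMn sqr_sqrtr.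
rewrite ler_pXn2r ?nnegrE ?nrm_ge0 ?mulr_ge0 ?sqrtr_ge0 //.
apply: le_trans (nrm_sum _ _ _) _.
rewrite mulr_natl -[N in leRHS]card_ord -sumr_const; apply: ler_sum => i _.
rewrite -[leLHS]ger0_norm ?nrm_ge0 // -sqrtr_sqr ler_sqrt //.
by rewrite /s (bigD1 i) //= lerDl; apply: sumr_ge0 => j _; rewrite sqr_ge0.
Qed.

(** The first operator repeats entry p over the N children of p, its adjoint sums over children.
    Both are built together because membership in [bop] requires an adjoint. *)
Lemma Vop_ex : exists uv : bop l2 * bop l2, [/\ forall h m, uv.1 h m = h (m %/ N)%N,
  forall h p, uv.2 h p = \sum_(i < N) h (p * N + i)%N & bop_star uv.1 = uv.2].
Proof.
have [u hu] := choice (fun h => l2_mk (is_l2P (dup_sqsum h))).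
have [v hv] := choice (fun h => l2_mk (is_l2P (blk_sqsum h))).
have uv : adjoint u v.
  move=> h g; rewrite !l2_hdotE; have := tends_psum_block N0 (l2_dotP (u h) g).
  move=> /csum_eq <-; rewrite /l2_dot; congr csum; apply/funext => p.
  rewrite hv rmorph_sum mulr_sumr; apply: eq_bigr => i _.
  by rewrite hu divnMDl // divn_small // addn0.
have vu : adjoint v u by exact: adjointC.
have ub : is_bop u.
  apply: l2_is_bop uv; first exact: (ler0n R N); last first.
    by move=> h n; apply: le_trans (dup_sqsum h n); rewrite /sqsum; under eq_bigr do rewrite hu.
  move=> k h g; apply: l2_eq => m.
  by rewrite l2DE l2ZE !hu l2DE l2ZE.
have vb : is_bop v.
  apply: l2_is_bop vu; first exact: (sqr_ge0 (N%:R : R)); last first.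
    by move=> h n; apply: le_trans (blk_sqsum h n); rewrite /sqsum; under eq_bigr do rewrite hv.
  move=> k h g; apply: l2_eq => m.
  rewrite l2DE l2ZE !hv mulr_sumr -big_split.
  by apply: eq_bigr => i _; rewrite l2DE l2ZE.
exists (Bop (is_bopbP ub), Bop (is_bopbP vb)); split=> //.
exact: bop_star_uniq.
Qed.

End BlockOperators.

(** * A nonzero covariant pair *)

Section PathRepresentation.
Variables (R : realType) (d : nat) (a : 'rV[int]_d) (G : 'M[int]_d).
Hypothesis a_gt0 : forall j, 0 < a 0 j.
Local Notation X := (torus R d).
Local Notation E := (Omega R (diag_mx a) G).
Local Notation N := (ndeg a).
Local Notation l2 := (l2 R).

Let N0 : (0 < N)%N := ndeg_gt0 a_gt0.

Definition index0 : index_ffun a := [ffun=> ord0].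

Lemma below_index0 : below index0.
Proof. by apply/belowP => j; rewrite ffunE deg_gt0. Qed.

Lemma enum_below : exists e : nat -> index_ffun a, [/\ e 0%N = index0,
  forall i, (i < N)%N -> below (e i),
  forall i k, (i < N)%N -> (k < N)%N -> e i = e k -> i = k &
  forall F : index_ffun a -> R[i], \sum_(w | below w) F w = \sum_(i < N) F (e i)].
Proof.
pose s := [seq w <- index_enum (index_ffun a) | below w].
have us : uniq s by rewrite filter_uniq ?index_enum_uniq.
have s0 : index0 \in s by rewrite mem_filter below_index0 mem_index_enum.
have sumE (F : index_ffun a -> R[i]) : \sum_(w | below w) F w = \sum_(w <- s) F w.
  by rewrite big_filter.
have szs : size s = N.
  apply/eqP; rewrite -(eqr_nat R[i]) -(card_below R a) sumE big_const_seq count_predT.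
  by rewrite iter_addr addr0.
pose s' := index0 :: rem index0 s.
have ps : perm_eq s s' by exact: perm_to_rem.
have szs' : size s' = N by rewrite -(perm_size ps).
have us' : uniq s' by rewrite -(perm_uniq ps).
exists (nth index0 s'); split=> //.
- move=> i iN; have : nth index0 s' i \in s by rewrite (perm_mem ps) mem_nth // szs'.
  by rewrite mem_filter => /andP[].
- by move=> i k iN kN /eqP; rewrite nth_uniq ?szs' // => /eqP.
- by move=> F; rewrite sumE (perm_big _ ps) /= (big_nth index0) szs' big_mkord.
Qed.

Lemma torus1 : exists x : X, forall j, crd x j = 1.
Proof. by have [x hx] := crd_ex (fun _ : 'I_d => nrm1 R); exists x. Qed.

(* The vertices of the tree of backward orbits of the point 1, numbered so that
   the edges ending with source r p are those with range r (p * N + i), i < N. *)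
Lemma path_ex : exists (r : nat -> X) (ed : nat -> E), [/\
  forall m, src (ed m) = r (m %/ N)%N, forall m, rng (ed m) = r m,
  forall p i k, (i < N)%N -> (k < N)%N -> ed (p * N + i)%N = ed (p * N + k)%N -> i = k &
  forall xi eta p, inner xi eta (r p) = N%:R^-1 *
    \sum_(i < N) (xi (ed (p * N + i)%N))^* * eta (ed (p * N + i)%N)].
Proof.
have [e [e0 eb einj esum]] := enum_below.
have [x1 hx1] := torus1.
have [base0 hb0] := choice (fibre_base (R := R) G a_gt0).
(* Vertex 0 is its own parent in the numbering, so its point must lie in its own fibre: the point 1
   does, and is taken as its own base point. *)
pose base x := if x == x1 then x1 else base0 x.
have mono1 nu : mono nu x1 = 1 by rewrite /mono big1 // => j _; rewrite hx1 exp1rz.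
have hb x j : crd (base x) j ^+ deg a j = mono (row j G) x.
  rewrite /base; case: eqVneq => [->|_]; last exact: hb0.
  by rewrite mono1 hx1 expr1n.
have [P hP] := choice (fun x : X => fibre_param_ex a_gt0 (hb x)).
pose step x w := rng (P x w).
have step1 : step x1 index0 = x1.
  by apply: torus_eq => j; rewrite (hP x1 index0).2 /base eqxx ffunE expr0 mulr1.
(* Recursion on the parent m %/ N, done by iterating from a constant: the k-th iterate is final on
   all m <= k. *)
pose rk k := iter k (fun q m => step (q (m %/ N)%N) (e (m %% N)%N)) (fun=> x1).
have stab k m : (m <= k)%N -> rk k.+1 m = rk k m.
  (* For N = 1 the parent of m is m itself and nothing decreases, but then every vertex is the point
     1. *)
  have [N1|N2] := leqP N 1.
    have NE : N = 1%N by apply/eqP; rewrite eqn_leq N1 N0.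
    have all1 : forall i m', rk i m' = x1.
      by elim=> [//|i IH] m' /=; rewrite IH NE modn1 e0 step1.
    by rewrite !all1.
  elim: k m => [|k IH] m mk.
    by move: mk; rewrite leqn0 => /eqP ->; rewrite /= mod0n e0 step1.
  rewrite [LHS]/= [RHS]/=; congr (step _ _); apply: IH.
  case: m mk => [|m] mk; first by rewrite div0n.
  by rewrite -ltnS; apply: leq_trans (ltn_Pdiv N2 (ltn0Sn m)) mk.
pose r m := rk m m.
have rE k m : (m <= k)%N -> rk k m = r m.
  move=> /subnKC <-; elim: (k - m)%N => [|i IH]; first by rewrite addn0.
  by rewrite addnS stab ?leq_addr.
have rstep m : r m = step (r (m %/ N)%N) (e (m %% N)%N).
  by rewrite -(rE m.+1 m (leqnSn m)) /= rE // leq_div.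
pose ed m := P (r (m %/ N)%N) (e (m %% N)%N).
have blk p i : (i < N)%N -> ed (p * N + i)%N = P (r p) (e i).
  by move=> iN; rewrite /ed divnMDl // divn_small // addn0 modnMDl modn_small.
exists r, ed; split.
- by move=> m; exact: (hP _ _).1.
- by move=> m; rewrite rstep.
- move=> p i k iN kN; rewrite !blk //.
  by move=> /(fibre_inj a_gt0 (hP (r p)) (eb i iN) (eb k kN))/(einj i k iN kN).
- move=> xi eta p; rewrite (innerE a_gt0 _ _ (hb (r p)) (hP (r p))) esum; congr (_ * _).
  by apply: eq_bigr => i _; rewrite !blk.
Qed.

Lemma omega_bounded (xi : E -> R[i]) : continuous xi -> exists B : R, forall p, nrm (xi p) <= B.
Proof.
move=> cxi; have h (w : index_ffun a) : exists B : R, forall x, nrm (inner (char_of w) xi x) <= B.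
  apply: torus_bounded; apply: (inner_continuous a_gt0 _ cxi); exact: char_continuous.
have [B hB] := choice h; exists (\sum_(w : index_ffun a | below w) B w) => p.
rewrite (fourier_expansion a_gt0 xi p); apply: le_trans (nrm_sum _ _ _) _.
by apply: ler_sum => w _; rewrite nrmM nrm_mono mul1r.
Qed.

Lemma opnorm_zero (k : (E -> R[i]) -> E -> R[i]) (e : R) : 0 < e ->
  (forall xi, continuous xi -> k xi = fun=> 0) -> opnorm_le k e.
Proof.
move=> e0 hk xi cxi; rewrite (hk _ cxi).
have -> : Enorm (fun _ : E => 0 : R[i]) = 0.
  rewrite /Enorm; have z x : inner (fun _ : E => 0 : R[i]) (fun=> 0) x = 0.
    by rewrite /inner fsbig1 ?mulr0 // => p _; rewrite mulr0.
  have [x1 _] := torus1.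
  have -> : range (fun x => complex.Re (inner (fun _ : E => 0 : R[i]) (fun=> 0) x)) = [set 0].
    by apply/seteqP; split=> [_ [x _ <-]|_ ->] /=; [rewrite z | exists x1; rewrite // z].
  by rewrite sup1 sqrtr0.
by rewrite mulr_ge0 ?sqrtr_ge0 ?(ltW e0).
Qed.

(** T xi sends h to m |-> N^(-1/2) xi(ed m) h(m %/ N), and pi f multiplies by f along the vertices.
    Covariance holds without approximation: lact f is the sum of the theta(f chi_i, chi_i), and the
    products T(f chi_i) T(chi_i)^* sum to pi f by orthogonality of characters. *)
Theorem nonzero_pair : exists (T : (E -> R[i]) -> bop l2) (pi : (X -> R[i]) -> bop l2),
  covariant_pair T pi /\ pi (fun=> 1) <> 0.
Proof.
have [r [ed [eds edr edinj inn]]] := path_ex.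
have [[V V'] [/= VE V'E VS]] := Vop_ex R N0.
(* The square of [k] is the normalising factor 1 / |det F| of the inner product. *)
pose k : R[i] := ((Num.sqrt N%:R)^-1)%:C.
have kk : k * k = N%:R^-1.
  rewrite -realCM -invfM -expr2 sqr_sqrtr ?ler0n // fmorphV rmorph_nat //.
have kc : k^* = k by exact: conjc_real.
pose T (xi : E -> R[i]) : bop l2 := k *: bop_mul (Mop (xi \o ed)) V.
pose pi (f : X -> R[i]) : bop l2 := Mop (f \o r).
have bT (xi : E -> R[i]) : continuous xi -> bounded_coeff (xi \o ed).
  by move=> /omega_bounded[B hB]; exists B => n; exact: hB.
have bpi (f : X -> R[i]) : continuous f -> bounded_coeff (f \o r).
  by move=> /torus_bounded[B hB]; exists B => n; exact: hB.
have TE xi : continuous xi -> forall h m, T xi h m = k * (xi (ed m) * h (m %/ N)%N).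
  by move=> cxi h m; rewrite /T bopZE -VE -(MopE _ _ (bT _ cxi)).
have piE f : continuous f -> forall h m, pi f h m = f (r m) * h m.
  by move=> cf h m; exact: (MopE _ _ (bpi _ cf)).
have TS xi : continuous xi -> cstar (T xi) = k *: bop_mul V' (Mop (fun n => ((xi \o ed) n)^*)).
  move=> cxi; rewrite /T cstarZ kc; congr (_ *: _).
  rewrite -VS -(Mop_star (bT _ cxi)) -!cstar_bopE; exact: (cstarM (Mop _) V).
have TSE xi : continuous xi -> forall h p, cstar (T xi) h p =
    k * \sum_(i < N) (xi (ed (p * N + i)%N))^* * h (p * N + i)%N.
  move=> cxi h p; rewrite (TS _ cxi) bopZE.
  rewrite l2ZE [bop_mul _ _ _]/(V' _) V'E; congr (_ * _); apply: eq_bigr => i _.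
  apply: MopE; have [B hB] := bT _ cxi; exists B => n; rewrite nrm_conj; exact: hB.
have bopl2 (u v : bop l2) : (forall h n, u h n = v h n) -> u = v.
  by move=> h; apply: bop_eq => x; apply: l2_eq => n.
have linE (c : R[i]) (u v : bop l2) h n : (c *: u + v) h n = c * u h n + v h n.
  by rewrite bopDE bopZE l2DE l2ZE.
exists T, pi; split; last first.
  have d0 : is_l2 (fun n => (n == 0%N)%:R : R[i]).
    apply: (@is_l2P _ _ 1) => -[|n]; first by rewrite /sqsum big_ord0.
    rewrite /sqsum big_ord_recl /= nrm1 expr1n big1 ?addr0 // => i _.
    by rewrite nrm0 expr0n.
  have [h hh] := l2_mk d0 => p0.
  have := piE _ (@continuous_cst R X 1) h 0%N.
  by rewrite p0 mul1r hh => /eqP; rewrite eq_sym oner_eq0.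
split.
- move=> c f g cf cg; apply: bopl2 => h n.
  have c1 := continuous_add (continuous_mul (@continuous_cst R X c) cf) cg.
  by rewrite linE (piE _ c1) (piE _ cf) (piE _ cg); ring.
- move=> f g cf cg; apply: bopl2 => h n.
  by rewrite cmul_bopE (piE _ (continuous_mul cf cg)) (piE _ cf) (piE _ cg) mulrA.
- by move=> f cf; rewrite cstar_bopE (Mop_star (bpi f cf)).
- move=> c xi eta cxi ceta; apply: bopl2 => h n.
  have c1 := continuous_add (continuous_mul (@continuous_cst R E c) cxi) ceta.
  by rewrite linE (TE _ c1) (TE _ cxi) (TE _ ceta); ring.
- move=> xi eta cxi ceta; apply: bopl2 => h p.
  rewrite cmul_bopE (TSE _ cxi) (piE _ (inner_continuous a_gt0 cxi ceta)).
  rewrite inn -kk -!mulrA; congr (_ * _); rewrite mulr_suml mulr_sumr; apply: eq_bigr => i _.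
  by rewrite (TE _ ceta) divnMDl // divn_small // addn0; ring.
- move=> f xi cf cxi; apply: bopl2 => h n.
  rewrite cmul_bopE (piE _ cf) (TE _ (lact_continuous cxi cf)) (TE _ cxi).
  by rewrite /lact -/(rng _) edr; ring.
move=> f [cf _ _] e e0.
have [en [_ enb _ ensum]] := enum_below.
pose ch i := char_of (R := R) (G := G) (en i).
have cch i : continuous (ch i) by exact: char_continuous.
have cf' i : continuous (lact f (ch i)) by exact: lact_continuous (cch i) cf.
exists N, (fun i => lact f (ch i)), (fun i => ch i); split; [exact: cf' | exact: cch | |].
  apply: (opnorm_zero e0) => zeta cz; apply/funext => p.
  rewrite {1}/lact (fourier_expansion a_gt0 zeta p) ensum mulr_sumr -sumrB big1 // => i _.
  by rewrite /theta /ract /lact mulrA subrr.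
suff -> : \sum_(i < N) cmul (T (lact f (ch i))) (cstar (T (ch i))) = pi f.
  by rewrite subrr normr0 lecR (ltW e0).
apply: bopl2 => h m.
have sumE n (F : 'I_n -> bop l2) : (\sum_(i < n) F i) h m = \sum_(i < n) F i h m.
  elim: n F => [|n IH] F; first by rewrite !big_ord0.
  by rewrite !big_ord_recr bopDE l2DE IH.
rewrite sumE (piE _ cf); pose p := (m %/ N)%N; have mE : m = (p * N + m %% N)%N by exact: divn_eq.
(* Once the sums are exchanged, the characters test whether the edges m and p N + j coincide; within
   a block this happens only for j = m %% N. *)
transitivity (\sum_(i < N) \sum_(j < N) f (r m) * (N%:R^-1 * h (p * N + j)%N) *
    (ch i (ed m) * (ch i (ed (p * N + j)%N))^*)).
  apply: eq_bigr => i _.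
  rewrite cmul_bopE (TE _ (cf' i)) (TSE _ (cch i)).
  rewrite -/p !mulr_sumr; apply: eq_bigr => j _.
  by rewrite /lact -/(rng _) edr -kk; ring.
rewrite exchange_big /=.
rewrite (eq_bigr (fun j : 'I_N => if ed m == ed (p * N + j)%N then f (r m) * h (p * N + j)%N else 0)).
  rewrite (bigD1 (Ordinal (ltn_pmod m N0))) //= -mE eqxx big1 ?addr0 // => j jm.
  case: eqP => // e1; case/negP: jm; apply/eqP/val_inj => /=.
  by apply: (edinj p) => //; [exact: ltn_pmod | rewrite -mE].
move=> j _; rewrite -mulr_sumr -(ensum (fun w => char_of w (ed m) * (char_of w (ed (p * N + j)%N))^*)).
rewrite (char_orthogonal a_gt0); last by rewrite !eds divnMDl // (divn_small (ltn_ord j)) addn0.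
case: eqP => _; last by rewrite mulr0.
by field; exact: ndeg_neq0.
Qed.

End PathRepresentation.

(** * The crossed product *)

Section BoundedOperators.
Variables (R : realType) (H : hilbertType R).

Lemma bounded_op_bound (u : H -> H) : bounded_op u ->
  exists C : R, forall x, nrm (u x) <= C * nrm x.
Proof.
move=> [ul uc]; have u0 : u 0 = 0.
  by apply: (addrI (u 0)); have := ul 1 0 0; rewrite !scale1r !addr0 => <-.
have uZ k x : u (k *: x) = k *: u x by rewrite -[k *: x]addr0 ul u0 addr0.
have : nbhs (0 : H) (u @^-1` [set y | nrm y < 1]).
  apply: uc; rewrite u0; apply/nbhs_nrm; exists 1 => // y /=.
  by rewrite sub0r nrmN.
move=> /nbhs_nrm[c c0 hc]; exists (2 / c) => x.
have [x0|x0] := eqVneq (nrm x) 0; first by rewrite (nrm_eq0 x0) u0 nrm0 mulr0.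
have {}x0 : 0 < nrm x by rewrite lt0r x0 nrm_ge0.
(* Scaling x to norm c / 2 puts it inside the ball on which [u] has norm below 1. *)
pose k := c / (2 * nrm x); have k0 : 0 < k by rewrite divr_gt0 // mulr_gt0.
have nk : nrm (k%:C : R[i]) = k by rewrite nrmR ger0_norm // ltW.
have := hc (k%:C *: x); rewrite /= sub0r nrmN uZ !nrmZ nk.
have -> : k * nrm x = c / 2 by rewrite /k; field; rewrite gt_eqF.
rewrite gtr_pMr // invf_lt1 ?ltr1n // => /(_ isT)/ltW h.
rewrite -(ler_pM2l k0); apply: le_trans h _.
by rewrite /k le_eqVlt; apply/orP; left; apply/eqP; field; rewrite !gt_eqF.
Qed.

Lemma bounded_op_is_bop (u v : H -> H) : bounded_op u -> adjoint u v -> is_bop u.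
Proof. by move=> hu huv; split; [case: hu | exact: bounded_op_bound | exists v]. Qed.

Lemma bop_bounded_op (u : bop H) : bounded_op u.
Proof.
split=> [k x y|x U]; first exact: bop_linear.
move=> /nbhs_nrm[e e0 hU]; apply/nbhs_nrm.
have o0 : 0 < opn u + 1 by rewrite ltr_wpDl ?opn_ge0.
exists (e / (opn u + 1)); first exact: divr_gt0.
move=> y xy; apply: hU; rewrite -bopBr; apply: le_lt_trans (opn_bound _ _) _.
apply: (@le_lt_trans _ _ ((opn u + 1) * nrm (x - y))).
  by rewrite ler_wpM2r ?nrm_ge0 // lerDl.
by rewrite mulrC -ltr_pdivlMr.
Qed.

End BoundedOperators.

Section Main.
Variables (R : realType) (d : nat) (a : 'rV[int]_d) (G : 'M[int]_d).
Hypothesis a_gt0 : forall j, 0 < a 0 j.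
Local Notation X := (torus R d).
Local Notation E := (Omega R (diag_mx a) G).
Variables (O : cstarType R) (T : (E -> R[i]) -> O) (pi : (X -> R[i]) -> O).
Hypothesis O_cp : cuntz_pimsner T pi.
Variable gamma : R[i] -> O -> O.
Hypothesis gaugeP : gauge_action T pi gamma.
Variables (A : cstarType R) (incl : A -> O).
Hypothesis A_fixed : fixed_point_algebra gamma incl.
Implicit Types (b c : A) (x y : O) (f : X -> R[i]) (xi eta : E -> R[i]).

Let pairTpi := cuntz_pimsner_pair O_cp.
Let genTpi := cuntz_pimsner_generated O_cp.
Let inclH : star_hom incl. Proof. by case: A_fixed. Qed.

Local Notation S := (gen_S T).
Local Notation one := (cp_one pi).
Local Notation "x ** y" := (cmul x y) (at level 40, left associativity).
Local Notation "x ^#" := (cstar x) (at level 2, format "x ^#").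

Definition fixed x : Prop := forall t, `|t| = 1 -> gamma t x = x.

Lemma c1E : continuous (fun _ : E => 1 : R[i]). Proof. exact: continuous_cst. Qed.
Lemma c1X : continuous (fun _ : X => 1 : R[i]). Proof. exact: continuous_cst. Qed.

Let SS : S^# ** S = one := S_star_S a_gt0 pairTpi.
Let m1 x : one ** x = x := mul1O a_gt0 pairTpi genTpi x.
Let mr1 x : x ** one = x := mulO1 a_gt0 pairTpi genTpi x.

Lemma incl_nrm b : nrm (incl b) = nrm b.
Proof. by case: A_fixed => _ h _; rewrite /nrm h. Qed.

Lemma incl_inj b c : incl b = incl c -> b = c.
Proof.
move=> e; apply/eqP; rewrite -subr_eq0; apply/eqP/nrm_eq0.
by rewrite -incl_nrm (homB inclH) e subrr nrm0.
Qed.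

Lemma incl_fixed b : fixed (incl b).
Proof.
case: A_fixed => _ _ h; have : range incl (incl b) by exists b.
by rewrite h.
Qed.

(** Inverse of [incl] on fixed points, with junk value 0 elsewhere; its algebraic identities
    therefore carry fixedness hypotheses. *)
Definition lift x : A := xget 0 [set b | incl b = x].

Lemma liftK x : fixed x -> incl (lift x) = x.
Proof.
move=> fx; have [b _ bx] : range incl x by case: A_fixed => _ _ ->.
by rewrite /lift; case: xgetP => [c _ //|/(_ b)].
Qed.

Lemma inclK b : lift (incl b) = b.
Proof. by apply: incl_inj; rewrite liftK //; exact: incl_fixed. Qed.

Let gh t (t1 : `|t| = 1) : star_hom (gamma t) := gauge_hom gaugeP t1.

Lemma fixedM x y : fixed x -> fixed y -> fixed (x ** y).
Proof. by move=> fx fy t t1; rewrite (homM (gh t1)) fx // fy. Qed.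

Lemma fixed_star x : fixed x -> fixed x^#.
Proof. by move=> fx t t1; rewrite (homS (gh t1)) fx. Qed.

Lemma fixed_linear k x y : fixed x -> fixed y -> fixed (k *: x + y).
Proof. by move=> fx fy t t1; rewrite (homD (gh t1)) (homZ (gh t1)) fx // fy. Qed.

Lemma fixed_pi f : continuous f -> fixed (pi f).
Proof. by move=> cf t t1; exact: (gauge_pi a_gt0 pairTpi genTpi gaugeP t1 cf). Qed.

Lemma unit_conj (t : R[i]) (V : lmodType R[i]) (v : V) : `|t| = 1 ->
  ((t * t^* *: v = v) * (t^* * t *: v = v))%type.
Proof.
move=> t1; have tt : t * t^* = 1 by rewrite nrm1_conjV // /nrm t1.
by split; rewrite ?[t^* * t]mulrC tt scale1r.
Qed.

Lemma fixed_TT xi eta : continuous xi -> continuous eta -> fixed (T xi ** (T eta)^#).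
Proof.
move=> cxi ceta t t1; have gT := gauge_T a_gt0 pairTpi genTpi gaugeP t1.
rewrite (homM (gh t1)) (homS (gh t1)) (gT _ cxi) (gT _ ceta) cstarZ cmulZl cmulZr scalerA.
by rewrite unit_conj.
Qed.

Lemma fixed_S_conj x : fixed x -> fixed (S ** x ** S^#).
Proof.
move=> fx t t1; rewrite !(homM (gh t1)) (homS (gh t1)) (gauge_S gaugeP t1) fx //.
rewrite cstarZ !cmulZl !cmulZr scalerA.
by rewrite unit_conj.
Qed.

Lemma fixed_S_compress x : fixed x -> fixed (S^# ** x ** S).
Proof.
move=> fx t t1; rewrite !(homM (gh t1)) (homS (gh t1)) (gauge_S gaugeP t1) fx //.
rewrite cstarZ !cmulZl !cmulZr scalerA.
by rewrite unit_conj.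
Qed.

Lemma fixed_one : fixed one.
Proof. exact: fixed_pi c1X. Qed.

Lemma lift_linear k x y : fixed x -> fixed y -> lift (k *: x + y) = k *: lift x + lift y.
Proof.
move=> fx fy; apply: incl_inj; rewrite liftK; last exact: fixed_linear.
by rewrite (homD inclH) (homZ inclH) !liftK.
Qed.

Lemma liftM x y : fixed x -> fixed y -> lift (x ** y) = lift x ** lift y.
Proof.
move=> fx fy; apply: incl_inj; rewrite liftK; last exact: fixedM.
by rewrite (homM inclH) !liftK.
Qed.

Lemma lift_star x : fixed x -> lift x^# = (lift x)^#.
Proof.
move=> fx; apply: incl_inj; rewrite liftK; last exact: fixed_star.
by rewrite (homS inclH) !liftK.
Qed.

Definition shift b : A := lift (S ** incl b ** S^#).
Definition unshift b : A := lift (S^# ** incl b ** S).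

Lemma incl_shift b : incl (shift b) = S ** incl b ** S^#.
Proof. by apply: liftK; apply: fixed_S_conj; exact: incl_fixed. Qed.

Lemma incl_unshift b : incl (unshift b) = S^# ** incl b ** S.
Proof. by apply: liftK; apply: fixed_S_compress; exact: incl_fixed. Qed.

Lemma SSx x : S^# ** (S ** x) = x. Proof. by rewrite cmulA SS m1. Qed.

Lemma shift_hom : star_hom shift.
Proof.
split=> [k b c|b c|b]; apply: incl_inj.
- rewrite (homD inclH) (homZ inclH) !incl_shift (homD inclH) (homZ inclH).
  by rewrite cmul_linearr cmul_linearl.
- by rewrite (homM inclH) !incl_shift (homM inclH) -!cmulA SSx.
- by rewrite (homS inclH) !incl_shift (homS inclH) !cstarM cstarK !cmulA.
Qed.

Lemma nrm_S : nrm S <= 1.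
Proof.
have := nrm_cstar_mul S; rewrite SS; have := nrm_one pairTpi.
by move=> h1 h2; rewrite -(@ler_pXn2r _ 2) ?nnegrE ?nrm_ge0 // expr1n -h2.
Qed.

Lemma unshift_linear k b c : unshift (k *: b + c) = k *: unshift b + unshift c.
Proof.
apply: incl_inj; rewrite (homD inclH) (homZ inclH) !incl_unshift (homD inclH) (homZ inclH).
by rewrite cmul_linearr cmul_linearl.
Qed.

Lemma unshift_star b : unshift b^# = (unshift b)^#.
Proof.
by apply: incl_inj; rewrite (homS inclH) !incl_unshift (homS inclH) !cstarM cstarK !cmulA.
Qed.

Lemma unshift_norm b : nrm (unshift b) <= nrm b.
Proof.
rewrite -incl_nrm incl_unshift -(incl_nrm b); have nS := nrm_S; have S0 := nrm_ge0 S.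
have b0 := nrm_ge0 (incl b).
apply: le_trans (nrm_cmul _ _) _; apply: (@le_trans _ _ (nrm (S^# ** incl b))).
  by rewrite ler_piMr ?nrm_ge0.
apply: le_trans (nrm_cmul _ _) _; rewrite nrm_cstar.
by rewrite ler_piMl.
Qed.

Lemma shiftK b : unshift (shift b) = b.
Proof. by apply: incl_inj; rewrite incl_unshift incl_shift -!cmulA SSx SS mr1. Qed.

Definition shift_split : split_endo A :=
  SplitEndo shift_hom unshift_linear unshift_star unshift_norm shiftK.

Lemma Snu_T (nu : 'rV[int]_d) : gen_Snu T pi nu = T (lact (mono nu) (fun=> 1)).
Proof. by rewrite (Defs.T_lact pairTpi (@mono_continuous R d nu) c1E). Qed.

Lemma Snu0 : gen_Snu T pi 0 = S.
Proof.
rewrite Snu_T; congr T; apply/funext => p; rewrite /lact mulr1 /mono big1 // => j _.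
by rewrite mxE expr0z.
Qed.

Lemma Sconj_cons nu mu alpha beta x :
  Sconj T pi (nu :: alpha) (mu :: beta) x =
  gen_Snu T pi nu ** Sconj T pi alpha beta x ** (gen_Snu T pi mu)^#.
Proof.
have SE := SconjE a_gt0 pairTpi genTpi.
by rewrite !SE /= cstarM !cmulA.
Qed.

Lemma Sconj_nil x : Sconj T pi [::] [::] x = x.
Proof. by rewrite /Sconj /= cstarK. Qed.

Lemma fixed_Snu nu mu x : fixed x -> fixed (gen_Snu T pi nu ** x ** (gen_Snu T pi mu)^#).
Proof.
move=> fx t t1; have cl nu' : continuous (lact (mono nu') (fun _ : E => 1 : R[i])).
  exact: (lact_continuous c1E (@mono_continuous R d nu')).
have gT := gauge_T a_gt0 pairTpi genTpi gaugeP t1.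
rewrite !Snu_T !(homM (gh t1)) (homS (gh t1)) !(gT _ (cl _)) fx //.
rewrite cstarZ !cmulZl !cmulZr scalerA.
by rewrite unit_conj.
Qed.

Lemma fixed_Sconj alpha beta f : size alpha = size beta -> continuous f ->
  fixed (Sconj T pi alpha beta (pi f)).
Proof.
elim: alpha beta => [|nu alpha IH] [|mu beta] // sz cf.
  by rewrite Sconj_nil; exact: fixed_pi.
by rewrite Sconj_cons; apply: fixed_Snu; case: sz => sz; exact: IH.
Qed.

Lemma shift_shift_endomorphism : shift_endomorphism T pi incl shift.
Proof.
split=> [|k alpha beta f _ _ cf]; first exact: shift_hom.
have fS : fixed (Sconj T pi alpha beta (pi f)) by apply: fixed_Sconj; rewrite ?size_tuple.
exists (lift (Sconj T pi alpha beta (pi f))); rewrite incl_shift liftK //.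
by rewrite Sconj_cons Snu0.
Qed.

Lemma fixed_closed x : (forall e : R, 0 < e -> exists2 y, fixed y & nrm (x - y) <= e) -> fixed x.
Proof.
move=> h t t1; apply: nrm_small_eq => e e0.
have [y fy xy] := h _ (divr_gt0 e0 (ltr0n _ 2)).
apply: (@nrm_split _ _ y) => //; last by rewrite nrmC.
by rewrite -{1}(fy t t1) -(homB (gh t1)); apply: le_trans (star_hom_norm _ (gh t1)) _.
Qed.

(** An induction principle for [A], transported from [O]. Fixedness is carried along with [P], since
    [lift] is controlled only on fixed points. *)
Lemma fixed_algebra_dense (P : A -> Prop) : P 0 ->
  (forall k b c, P b -> P c -> P (k *: b + c)) ->
  (forall b, (forall e : R, 0 < e -> exists2 c, P c & nrm (b - c) <= e) -> P b) ->
  (forall k alpha beta f, size alpha = k -> size beta = k -> all (index_set a) alpha ->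
    all (index_set a) beta -> continuous f -> P (lift (Sconj T pi alpha beta (pi f)))) ->
  forall b, P b.
Proof.
move=> P0 Pl Pc PS b; rewrite -(inclK b).
suff [] : fixed (incl b) /\ P (lift (incl b)) by [].
apply: (fixed_point_dense a_gt0 pairTpi genTpi gaugeP
  (D := fun x => fixed x /\ P (lift x))); last exact: incl_fixed.
- split.
    rewrite -(hom0 inclH) inclK; split=> //; exact: incl_fixed.
  move=> k x y [fx Px] [fy Py]; split; first exact: fixed_linear.
  by rewrite lift_linear //; exact: Pl.
- apply/closed_nrm => x h.
  have fx : fixed x.
    by apply: fixed_closed => e /h[y [fy _] xy]; exists y.
  split=> //; apply: Pc => e /h[y [fy Py] xy]; exists (lift y) => //.
  by rewrite -incl_nrm (homB inclH) !liftK.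
- move=> k alpha beta f sa sb ia ib cf; split; last exact: PS sa sb ia ib cf.
  by apply: fixed_Sconj; rewrite ?sa.
Qed.

(** Two contractive maps that agree on the dense span of the S_alpha f S_beta^* coincide. *)
Lemma shift_unique rho' : shift_endomorphism T pi incl rho' -> rho' =1 shift.
Proof.
move=> [hr hS]; apply: (fixed_algebra_dense (P := fun b => rho' b = shift b)).
- by rewrite (hom0 hr) (hom0 shift_hom).
- move=> k b c hb hc; rewrite (homD hr) (homZ hr) hb hc.
  by rewrite (homD shift_hom) (homZ shift_hom).
- move=> b h; apply: nrm_small_eq => e e0; have [c cE bc] := h _ (divr_gt0 e0 (ltr0n _ 2)).
  apply: (@nrm_split _ _ (rho' c)).
    by rewrite -(homB hr); apply: le_trans (star_hom_norm _ hr) _.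
  by rewrite cE -(homB shift_hom); apply: le_trans (star_hom_norm _ shift_hom) _; rewrite nrmC.
move=> k alpha beta f sa sb ia ib cf.
have sa' : size alpha == k by rewrite sa.
have sb' : size beta == k by rewrite sb.
have [b [bE rE]] := hS k (Tuple sa') (Tuple sb') f ia ib cf.
rewrite -bE inclK; apply: incl_inj.
by rewrite rE incl_shift bE Sconj_cons Snu0.
Qed.

(** The universal property maps [O] to the path representation, where the image of 1 is nonzero. *)
Lemma one_neq0 : one <> 0.
Proof.
have [T' [pi' [hp pi'1]]] := nonzero_pair R G a_gt0.
have [f [hf _ fpi]] := cuntz_pimsner_universal O_cp hp.
by move=> e; apply: pi'1; rewrite -(fpi _ c1X) -/(cp_one pi) e (hom0 hf).
Qed.

Lemma shift_colim : colim_nonzero shift.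
Proof.
apply: (@split_endo_colim_nonzero _ _ shift_split); exists (lift one) => e.
by apply: one_neq0; rewrite -(liftK fixed_one) e (hom0 inclH).
Qed.

Lemma lift_one_unit : is_one (lift one).
Proof.
by move=> b; split; apply: incl_inj; rewrite (homM inclH) (liftK fixed_one) ?m1 ?mr1.
Qed.

(** * The universal property of the crossed product *)

Section Universal.
Variables (H : hilbertType R) (p : A -> H -> H) (t t' : H -> H).
Hypotheses (hp : representation p) (ndp : Defs.nondegenerate p).
Hypothesis ht : isometry_with_adjoint t t'.
Hypothesis pshift : forall b h, p (shift b) h = t (p b (t' h)).

Definition rep_op b : bop H :=
  Bop (is_bopbP (bounded_op_is_bop (rep_bounded hp b) (rep_star hp b))).

Lemma tt_bop : is_bop t.
Proof. by have [ht1 _ ht3 _] := ht; exact: bounded_op_is_bop ht1 ht3. Qed.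

Definition tt : bop H := Bop (is_bopbP tt_bop).

Lemma tt_star h : tt^# h = t' h.
Proof.
have [_ ht2 ht3 _] := ht.
have vb : is_bop t' by exact: (bounded_op_is_bop ht2 (adjointC ht3)).
by rewrite cstar_bopE (@bop_star_uniq _ _ tt (Bop (is_bopbP vb))).
Qed.

Lemma rep_op_hom : star_hom rep_op.
Proof.
split=> [k b c|b c|b].
- by apply: bop_eq => h; exact: (rep_linear hp).
- by apply: bop_eq => h; exact: (rep_mul hp).
- by apply/esym; rewrite cstar_bopE; apply: bop_star_uniq => h g; exact: (rep_star hp).
Qed.

Lemma tt_isometry (u : bop H) : tt^# ** (tt ** u) = u.
Proof.
by have [_ _ _ t't] := ht; apply: bop_eq => h; rewrite !cmul_bopE tt_star /= t't.
Qed.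

Lemma rep_op_shift b : rep_op (shift b) = tt ** rep_op b ** tt^#.
Proof. by apply: bop_eq => h; rewrite !cmul_bopE tt_star; exact: pshift. Qed.

(** The vectors fixed by the image of the unit form a closed set containing all sums of p(b) x, and
    these are dense by nondegeneracy. *)
Lemma rep_op_one h : rep_op (lift one) h = h.
Proof.
set P := rep_op _.
suff : [set y | P y = y] h by [].
have cl : closed [set y | P y = y].
  apply/closed_nrm => x hx /=; apply: nrm_small_eq => e e0.
  have P0 : 0 < opn P + 1 by rewrite ltr_wpDl ?opn_ge0.
  have [y /= Py xy] := hx _ (divr_gt0 (divr_gt0 e0 (ltr0n _ 2)) P0).
  have [y2 /= Py2 xy2] := hx _ (divr_gt0 e0 (ltr0n _ 2)).
  have P1 : nrm (P x - x) <= (opn P + 1) * nrm (x - y).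
    apply: le_trans (nrm_tri y _ _) _; rewrite mulrDl mul1r (nrmC y) lerD //.
    by rewrite -{1}Py -bopBr opn_bound.
  apply: le_trans P1 _; apply: (@le_trans _ _ ((opn P + 1) * (e / 2 / (opn P + 1)))).
    by rewrite ler_wpM2l ?(ltW P0).
  by rewrite mulrC divfK ?gt_eqF //; lra.
apply: cl; have : closure [set y | exists n (b : 'I_n -> A) (x : 'I_n -> H),
    y = \sum_(i < n) p (b i) (x i)] h by rewrite ndp.
apply: closure_subset => _ [n [b [x ->]]] /=.
have Psum : P (\sum_(i < n) p (b i) (x i)) = \sum_(i < n) P (p (b i) (x i)).
  apply: (big_morph P) => [u v|]; last exact: bop0r.
  by rewrite -[u]scale1r bop_linear !scale1r.
rewrite [LHS]Psum; apply: eq_bigr => i _; rewrite /P /= -(rep_mul hp).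
by have [-> _] := lift_one_unit (b i).
Qed.

(** The covariance relation at the unit. It keeps products across t t^* inside the image of [A]. *)
Lemma tt_tt : tt ** tt^# = rep_op (shift (lift one)).
Proof. by rewrite rep_op_shift; apply: bop_eq => h; rewrite !cmul_bopE rep_op_one. Qed.

Definition rep_pi f : bop H := rep_op (lift (pi f)).
Definition rep_T xi : bop H := rep_op (lift (T xi ** S^#)) ** tt.

Let PM b c : rep_op (b ** c) = rep_op b ** rep_op c := homM rep_op_hom b c.

(* T xi = (T xi S^* ) S, where T xi S^* lies in the fixed point algebra. *)
Lemma rep_TT xi eta : continuous xi -> continuous eta ->
  rep_T xi ** (rep_T eta)^# = rep_op (lift (T xi ** (T eta)^#)).
Proof.
move=> cxi ceta; have fx := fixed_TT cxi c1E; have fy := fixed_TT ceta c1E.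
rewrite /rep_T cstarM -(homS rep_op_hom) -lift_star // !cmulA -(cmulA _ tt) tt_tt.
rewrite -!PM; congr rep_op; apply: incl_inj.
rewrite !(homM inclH) incl_shift !liftK //; try exact: fixed_one; try exact: fixed_star;
  try exact: fixed_TT.
by rewrite cstarM cstarK mr1 -!cmulA !SSx.
Qed.

Lemma rep_covariant : covariant_pair rep_T rep_pi.
Proof.
split.
- move=> k f g cf cg; rewrite /rep_pi (Defs.pi_linear pairTpi k cf cg).
  rewrite lift_linear; try exact: fixed_pi.
  by rewrite (homD rep_op_hom) (homZ rep_op_hom).
- move=> f g cf cg; rewrite /rep_pi (Defs.pi_mul pairTpi cf cg).
  by rewrite liftM ?PM //; exact: fixed_pi.
- move=> f cf; rewrite /rep_pi (Defs.pi_star pairTpi cf).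
  by rewrite lift_star ?(homS rep_op_hom) //; exact: fixed_pi.
- move=> k xi eta cxi ceta; rewrite /rep_T (Defs.T_linear pairTpi k cxi ceta).
  rewrite cmul_linearl lift_linear; try exact: (fixed_TT _ c1E).
  by rewrite (homD rep_op_hom) (homZ rep_op_hom) cmul_linearl.
- move=> xi eta cxi ceta; have ci := inner_continuous a_gt0 cxi ceta.
  have fx := fixed_TT cxi c1E; have fy := fixed_TT ceta c1E.
  rewrite /rep_T cstarM -(homS rep_op_hom) -lift_star // -cmulA [in X in _ ** X]cmulA -PM.
  (* The adjoint of T xi S^* times T eta S^* equals S <xi, eta> S^*, a shifted element, and
     compression by t undoes the shift. *)
  have -> : lift (T xi ** S^#)^# ** lift (T eta ** S^#) = shift (lift (pi (inner xi eta))).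
    apply: incl_inj; rewrite incl_shift (homM inclH) !liftK //; try exact: fixed_star;
      try exact: fixed_pi.
    by rewrite cstarM cstarK -(Defs.T_inner pairTpi cxi ceta) !cmulA.
  rewrite rep_op_shift -!cmulA tt_isometry /rep_pi.
  apply: bop_eq => h; have [_ _ _ t't] := ht.
  by rewrite !cmul_bopE tt_star /= t't.
- move=> f xi cf cxi; rewrite /rep_T /rep_pi (Defs.T_lact pairTpi cf cxi).
  rewrite -cmulA liftM ?PM ?cmulA //; [exact: fixed_pi | exact: (fixed_TT cxi c1E)].
move=> f hf e e0; have cf : continuous f by case: hf.
have [n [xi [eta [cxi ceta h1 h2]]]] := Defs.pair_covariant pairTpi hf e0.
(* The operator estimate does not mention the pair, so the same xi and eta serve; only the norm
   estimate in [O] is transported, by contractivity. *)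
exists n, xi, eta; split=> //.
rewrite nrmE lecR; rewrite nrmE lecR in h2; apply: le_trans h2.
have fT i : fixed (T (xi i) ** (T (eta i))^#) by exact: fixed_TT.
under eq_bigr => i _ do rewrite rep_TT //.
rewrite -(hom_sum rep_op_hom) -(homB rep_op_hom).
apply: le_trans (star_hom_norm _ rep_op_hom) _; rewrite -incl_nrm (homB inclH) (hom_sum inclH).
rewrite liftK; last exact: fixed_pi.
by under eq_bigr => i _ do rewrite liftK //.
Qed.

Lemma rep_extension : exists q : O -> H -> H,
  [/\ representation q, Defs.nondegenerate q,
      forall b h, q (incl b) h = p b h & forall h, q S h = t h].
Proof.
have [f [hf fT fpi]] := cuntz_pimsner_universal O_cp rep_covariant.
have fS : f S = tt.
  rewrite /gen_S (fT _ c1E) /rep_T -/(gen_S T).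
  (* S S^* is rho(1), so S is sent to t t^* t = t. *)
  have -> : lift (S ** S^#) = shift (lift one).
    apply: incl_inj; rewrite incl_shift !liftK ?mr1 //; first exact: fixed_one.
    exact: (fixed_TT c1E c1E).
  rewrite rep_op_shift; apply: bop_eq => h; have [_ _ _ t't] := ht.
  by rewrite !cmul_bopE rep_op_one tt_star /= t't.
have f1 : f one = rep_op (lift one) by rewrite /cp_one (fpi _ c1X).
(* Adding one outer letter on each side preserves agreement of [f] with the representation, so the
   S_alpha f S_beta^* are reached by induction on word length. *)
have step xi eta x : continuous xi -> continuous eta -> fixed x -> f x = rep_op (lift x) ->
    f (T xi ** x ** (T eta)^#) = rep_op (lift (T xi ** x ** (T eta)^#)).
  move=> cxi ceta fx fxE; have fxi := fixed_TT cxi c1E; have feta := fixed_TT ceta c1E.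
  rewrite !(homM hf) (homS hf) (fT _ cxi) (fT _ ceta) fxE /rep_T cstarM.
  rewrite -(homS rep_op_hom) -lift_star //.
  have -> : rep_op (lift (T xi ** S^#)) ** tt ** rep_op (lift x) **
      (tt^# ** rep_op (lift (T eta ** S^#)^#)) =
      rep_op (lift (T xi ** S^#)) ** (tt ** rep_op (lift x) ** tt^#) **
      rep_op (lift (T eta ** S^#)^#) by rewrite !cmulA.
  rewrite -rep_op_shift -!PM; congr rep_op; apply: incl_inj.
  have E0 : T xi ** S^# ** (S ** x ** S^#) ** (T eta ** S^#)^# = T xi ** x ** (T eta)^#.
    by rewrite cstarM cstarK -!cmulA !SSx.
  rewrite !(homM inclH) incl_shift (liftK fxi) (liftK fx) (liftK (fixed_star feta)) E0.
  rewrite liftK // -E0; apply: fixedM (fixed_star feta).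
  exact: fixedM fxi (fixed_S_conj fx).
have cl nu : continuous (lact (mono nu) (fun _ : E => 1 : R[i])).
  exact: (lact_continuous c1E (@mono_continuous R d nu)).
have fincl : forall b, f (incl b) = rep_op b.
  apply: (fixed_algebra_dense (P := fun b => f (incl b) = rep_op b)).
  - by rewrite (hom0 inclH) (hom0 hf) (hom0 rep_op_hom).
  - move=> k b c hb hc; rewrite (homD inclH) (homZ inclH) (homD hf) (homZ hf) hb hc.
    by rewrite (homD rep_op_hom) (homZ rep_op_hom).
  - move=> b h; apply: nrm_small_eq => e e0; have [c cE bc] := h _ (divr_gt0 e0 (ltr0n _ 2)).
    apply: (@nrm_split _ _ (f (incl c))).
      rewrite -(homB hf) -(homB inclH); apply: le_trans (star_hom_norm _ hf) _.
      by rewrite incl_nrm.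
    by rewrite cE -(homB rep_op_hom); apply: le_trans (star_hom_norm _ rep_op_hom) _; rewrite nrmC.
  move=> k alpha beta g sa sb _ _ cg.
  have {k sa sb} sab : size alpha = size beta by rewrite sa.
  rewrite (liftK (fixed_Sconj sab cg)).
  elim: alpha beta sab => [|nu alpha IH] [|mu beta] // sab.
    by rewrite Sconj_nil (fpi _ cg).
  rewrite Sconj_cons !Snu_T; apply: step (cl nu) (cl mu) _ _.
    by apply: fixed_Sconj => //; case: sab.
  by apply: IH; case: sab.
exists (fun x h => f x h); split.
- split.
  + by move=> x; exact: bop_bounded_op.
  + by move=> k x y h; rewrite (homD hf) (homZ hf).
  + by move=> x y h; rewrite (homM hf) cmul_bopE.
  + by move=> x h g; rewrite (homS hf) cstar_bopE; exact: bop_starP.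
- apply/seteqP; split=> // y _; apply: subset_closure.
  by exists 1%N, (fun=> one), (fun=> y); rewrite big_ord1 f1 rep_op_one.
- by move=> b h; rewrite fincl.
- by move=> h; rewrite fS.
Qed.

End Universal.

Lemma shift_crossed_product : crossed_product shift incl S.
Proof.
split.
- exact: inclH.
- exists (lift one), one; split; [exact: lift_one_unit|by move=> x | exact: (liftK fixed_one)|].
  exact: SS.
- exact: incl_shift.
- by move=> H p t t' hp ndp ht pshift; exact: rep_extension hp ndp ht pshift.
apply/seteqP; split=> // x _ D [hD subD].
have pD f : continuous f -> D (pi f).
  by move=> cf; apply: subD; left; exists (lift (pi f)) => //; rewrite liftK //; exact: fixed_pi.
apply: (generatesP genTpi hD) => _ [[xi cxi <-]|[f cf <-]]; last exact: pD.
have -> : T xi = T xi ** S^# ** S by rewrite -cmulA SS mr1.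
have [_ _ _ DM _] := hD; apply: DM; last by apply: subD; right.
apply: subD; left; exists (lift (T xi ** S^#)) => //.
by rewrite liftK //; exact: (fixed_TT cxi c1E).
Qed.

End Main.

Theorem theorem5p9 (R : realType) (d : nat) (a : 'rV[int]_d) (G : 'M[int]_d)
    (a_gt0 : forall j, 0 < a 0 j) (detG_neq0 : \det G != 0)
    (O : cstarType R)
    (T : (Omega R (diag_mx a) G -> R[i]) -> O) (pi : (torus R d -> R[i]) -> O)
    (O_cuntz_pimsner : cuntz_pimsner T pi)
    (gamma : R[i] -> O -> O) (gamma_gauge : gauge_action T pi gamma)
    (A : cstarType R) (incl : A -> O)
    (A_fixed : fixed_point_algebra gamma incl) :
  exists rho : A -> A,
    [/\ shift_endomorphism T pi incl rho,
        forall rho', shift_endomorphism T pi incl rho' -> rho' =1 rho,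
        colim_nonzero rho &
        exists (B : cstarType R) (iota : A -> B) (s : B),
          crossed_product rho iota s /\ isomorphic O B].
Proof.
exists (shift T incl); split.
- exact: (shift_shift_endomorphism a_gt0 O_cuntz_pimsner gamma_gauge A_fixed).
- exact: (shift_unique a_gt0 O_cuntz_pimsner gamma_gauge A_fixed).
- exact: (shift_colim a_gt0 O_cuntz_pimsner gamma_gauge A_fixed).
exists O, incl, (gen_S T); split.
  exact: (shift_crossed_product a_gt0 O_cuntz_pimsner gamma_gauge A_fixed).
by exists id; split; [split | exists id].
Qed.
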